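(* Let $M,N\in\mathbb Z_{\ge0}$, $0\le k,j\le M$ and $0\le m,l\le N$, and let $t^M_{kj},t^N_{ml}\in\mathcal F_R(\mathrm{SL}(2))$ be the matrix elements, and $\langle\cdot,\cdot\rangle$ the pairing, described in the context. Then $\langle t_{kj}^M,t_{ml}^N\rangle=0$ unless $k+l=j+m$, and if $k+l=j+m=L$ then $$\langle t_{kj}^M,t_{ml}^N\rangle=f\,T_{M+N-2L},$$ where $$f(\lambda)=(-1)^{j+l+L}q^{(j+l-L)(\lambda+1+j+l-M-N)-2km}\frac{(q^2;q^2)_{L}(q^2;q^2)_{M-k}(q^2;q^2)_{N-m}}{(q^2;q^2)_{j}(q^2;q^2)_{l}(q^2;q^2)_{M-j}(q^2;q^2)_{N-l}}$$ $$\times\frac{1}{1-q^{2(\lambda+1)}}\,\frac{(q^{2(\lambda+1-L)};q^2)_{M-k}(q^{2(\lambda+1-L)};q^2)_{N-m}}{(q^{2(\lambda+1-L)};q^2)_{j}(q^{2(\lambda+1-L)};q^2)_{l}}\,\frac{(q^{2(\lambda+1+M+N-2L)};q^2)_{L+1}}{(q^{2(\lambda+2)};q^2)_{M-k}(q^{2(\lambda+2)};q^2)_{N-m}}$$ $$\times\,{}_4\phi_3\left[\begin{matrix} q^{-2k},q^{-2m},q^{2(k-M-\lambda-1)},q^{2(m-N-\lambda-1)} \\ q^{-2L},q^{2(L-M-N-\lambda-1)},q^{-2\lambda} \end{matrix};q^2,q^2\right].$$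
   Context: Notation: $(a;p)_n=\prod_{i=0}^{n-1}(1-ap^i)$, and for nonnegative integers $k,m$ $${}_{4}\phi_3\left[\begin{matrix} p^{-k},p^{-m},a,b \\ c,d,e \end{matrix};p,z\right]=\sum_{n=0}^{\min(k,m)}\frac{(p^{-k};p)_n(p^{-m};p)_n(a;p)_n(b;p)_n}{(p;p)_n(c;p)_n(d;p)_n(e;p)_n}\,z^n.$$ Basics (here $\mathfrak h=\mathfrak h^*=\mathbb C$). $M_{\mathbb C}$ is the field of meromorphic functions on $\mathbb C$; $(T_sf)(\lambda)=f(\lambda+s)$; $D_{\mathfrak h}$ is the algebra of difference operators $\sum_if_iT_{s_i}$ (finite sums, $f_i\in M_{\mathbb C}$, $s_i\in\mathbb C$), bigraded by $fT_{-s}\in(D_{\mathfrak h})_{ss}$, with $(D_{\mathfrak h})_{st}=0$ for $s\neq t$; a function $f$ is identified with $fT_0$. The algebroid $\mathcal F_R=\mathcal F_R(\mathrm{SL}(2))$. Fix $0<q<1$ and put $$F(\lambda)=\frac{q^{2(\lambda+1)}-q^{-2}}{q^{2(\lambda+1)}-1},\qquad G(\lambda)=\frac{(q^{2(\lambda+1)}-q^2)(q^{2(\lambda+1)}-q^{-2})}{(q^{2(\lambda+1)}-1)^2},$$ $$H(\lambda,\mu)=\frac{(q-q^{-1})(q^{2(\lambda+\mu+2)}-1)}{(q^{2(\lambda+1)}-1)(q^{2(\mu+1)}-1)},\qquad J(\lambda,\mu)=\frac{(q-q^{-1})(q^{2(\mu+1)}-q^{2(\lambda+1)})}{(q^{2(\lambda+1)}-1)(q^{2(\mu+1)}-1)}.$$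 $\mathcal F_R$ is the algebra generated by $\alpha,\beta,\gamma,\delta$ (also written $L_{++},L_{+-},L_{-+},L_{--}$ respectively) and two commuting copies of $M_{\mathbb C}$, with elements $f(\lambda)=\mu_l(f)$ and $f(\mu)=\mu_r(f)$, subject to $f(\lambda)L_{xy}=L_{xy}f(\lambda+\omega(x))$, $f(\mu)L_{xy}=L_{xy}f(\mu+\omega(y))$ where $\omega(\pm)=\pm1$, and $$\alpha\beta=qF(\mu-1)\beta\alpha,\quad\alpha\gamma=qF(\lambda)\gamma\alpha,\quad\beta\delta=qF(\lambda)\delta\beta,\quad\gamma\delta=qF(\mu-1)\delta\gamma,$$ $$\alpha\delta-\delta\alpha=H(\lambda,\mu)\gamma\beta,\quad\beta\gamma-G(\lambda)\gamma\beta=J(\lambda,\mu)\alpha\delta,\quad\alpha\delta-qF(\lambda)\gamma\beta=1.$$ Bigrading: $L_{xy}\in(\mathcal F_R)_{\omega(x),\omega(y)}$, $f(\lambda),f(\mu)\in(\mathcal F_R)_{00}$. $\mathcal F_R\widetilde\otimes\mathcal F_R$ is $\bigoplus_{r,s,t}(\mathcal F_R)_{rs}\otimes_{\mathbb C}(\mathcal F_R)_{st}$ modulo $f(\mu)a\otimes b=a\otimes f(\lambda)b$. Coproduct (an algebra homomorphism $\Delta:\mathcal F_R\to\mathcal F_R\widetilde\otimes\mathcal F_R$): $\Delta(L_{ab})=\sum_{x=\pm}L_{ax}\otimes L_{xb}$, $\Delta(f(\lambda))=f(\lambda)\otimes1$, $\Delta(f(\mu))=1\otimes f(\mu)$. Counit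 (an algebra homomorphism $\varepsilon:\mathcal F_R\to D_{\mathfrak h}$): $\varepsilon(L_{ab})=\delta_{ab}T_{-\omega(a)}$, $\varepsilon(f(\lambda))=\varepsilon(f(\mu))=f$. The pairing. $\langle\cdot,\cdot\rangle:\mathcal F_R\times\mathcal F_R\to D_{\mathfrak h}$ is the $\mathbb C$-bilinear map determined by: with $A=\mathcal F_R$, $\langle A_{rs},A_{tu}\rangle\subseteq(D_{\mathfrak h})_{r+u,s+t}$; $\langle\mu_l(f)a,b\rangle=\langle a,\mu_l(f)b\rangle=f\circ\langle a,b\rangle$; $\langle a\mu_r(f),b\rangle=\langle a,b\mu_r(f)\rangle=\langle a,b\rangle\circ f$; $\langle ab,c\rangle=\sum_i\langle a,c_i'\rangle T_{s_i}\langle b,c_i''\rangle$ if $\Delta(c)=\sum_ic_i'\otimes c_i''$ with $c_i''\in A_{s_it}$; $\langle a,bc\rangle=\sum_i\langle a_i',b\rangle T_{s_i}\langle a_i'',c\rangle$ if $\Delta(a)=\sum_ia_i'\otimes a_i''$ with $a_i''\in A_{s_it}$; $\langle a,1\rangle=\varepsilon(a)$, $\langle1,b\rangle=\varepsilon(b)$; and on generators $$\langle\alpha,\alpha\rangle=T_{-2},\quad\langle\alpha,\delta\rangle=\langle\delta,\alpha\rangle=1,\quad\langle\delta,\delta\rangle=G(\lambda+1)T_2,\quad\langle\beta,\beta\rangle=\frac{q-q^{-1}}{q^\lambda-q^{-\lambda}},\quad\langle\gamma,\gamma\rangle=\frac{q^{-1}-q}{q^{\lambda+2}-q^{-\lambda-2}},$$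 all other pairings of two of $\alpha,\beta,\gamma,\delta$ being zero. (Such a pairing exists.) Matrix elements. For $N\in\mathbb Z_{\ge0}$ the elements $\gamma^{N-k}\alpha^k$, $0\le k\le N$, are linearly independent over $\mu_l(M_{\mathbb C})$, and $t_{kj}^N\in(\mathcal F_R)_{2k-N,2j-N}$ ($0\le k,j\le N$) are the elements defined by $\Delta(\gamma^{N-k}\alpha^k)=\sum_{j=0}^Nt_{kj}^N\otimes\gamma^{N-j}\alpha^j$. *)

(* Defs.v *)
From HB Require Import structures.
From mathcomp Require Import all_boot all_order all_algebra.
From mathcomp Require Import complex ring lra.
From mathcomp Require Import mathcomp_extra boolp classical_sets functions reals.
From mathcomp Require Import topology normedtype landau derive sequences exp trigo.

Set Implicit Arguments.
Unset Strict Implicit.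
Unset Printing Implicit Defensive.

Import Order.TTheory GRing.Theory Num.Theory.
Import numFieldNormedType.Exports.

Local Open Scope classical_set_scope.
Local Open Scope complex_scope.
Local Open Scope ring_scope.
Local Open Scope quotient_scope.

Section Meromorphic.
Variable C : numFieldType.

Definition holomorphic_near (g : C -> C) (z0 : C) : Prop :=
  \forall z \near z0, derivable (g : C^o -> C^o) z 1.

(* Values at the poles are irrelevant: see [meq]. *)
Definition meromorphic (f : C -> C) : Prop :=
  forall z0 : C, exists n : nat, exists2 g : C -> C, holomorphic_near g z0 &
    \forall z \near z0^', f z = g z / (z - z0) ^+ n.

Lemma holomorphicD f g z0 : holomorphic_near f z0 -> holomorphic_near g z0 ->
  holomorphic_near (fun z => f z + g z) z0.
Proof.
rewrite /holomorphic_near; apply: filterS2 => z.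
exact: (@derivableD C C^o C^o f g z 1).
Qed.

Lemma holomorphicM f g z0 : holomorphic_near f z0 -> holomorphic_near g z0 ->
  holomorphic_near (fun z => f z * g z) z0.
Proof.
rewrite /holomorphic_near; apply: filterS2 => z.
exact: (@derivableM C C^o f g z 1).
Qed.

Lemma holomorphicX n (z0 : C) : holomorphic_near (fun z => (z - z0) ^+ n) z0.
Proof.
elim: n => [|n ih].
  near=> z.
  exact: (@derivable_cst C C^o C^o 1).
rewrite (_ : (fun z => _) = (fun z => (z - z0) * (z - z0) ^+ n)); last first.
  by apply/funext => z; rewrite exprS.
apply: (holomorphicM _ ih); near=> z.
apply: (@derivableD C C^o C^o id (fun=> - z0) z 1).
  exact: (@derivable_id C C^o z 1).
exact: (@derivable_cst C C^o C^o (- z0) z 1).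
Unshelve. all: by end_near. Qed.

Lemma entire_meromorphic f : (forall z, derivable (f : C^o -> C^o) z 1) ->
  meromorphic f.
Proof.
move=> hf z0; exists 0%N; exists f.
  by near=> z; apply: hf.
by near=> z; rewrite expr0 divr1.
Unshelve. all: by end_near. Qed.

Lemma meromorphic_cst c : meromorphic (fun=> c).
Proof. by apply: entire_meromorphic => z; apply: derivable_cst. Qed.

Lemma meromorphicD f g : meromorphic f -> meromorphic g ->
  meromorphic (fun z => f z + g z).
Proof.
move=> mf mg z0; have [n [a ha ea]] := mf z0; have [m [b hb eb]] := mg z0.
exists (n + m)%N; exists (fun z => a z * (z - z0) ^+ m + b z * (z - z0) ^+ n).
  exact: (holomorphicD (holomorphicM ha (holomorphicX m z0))
    (holomorphicM hb (holomorphicX n z0))).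
near=> z.
have zz : z - z0 != 0 by rewrite subr_eq0; near: z; apply: nbhs_dnbhs_neq.
have -> : f z = a z / (z - z0) ^+ n by near: z.
have -> : g z = b z / (z - z0) ^+ m by near: z.
by rewrite exprD addf_div ?expf_neq0.
Unshelve. all: by end_near. Qed.

Lemma meromorphicM f g : meromorphic f -> meromorphic g ->
  meromorphic (fun z => f z * g z).
Proof.
move=> mf mg z0; have [n [a ha ea]] := mf z0; have [m [b hb eb]] := mg z0.
exists (n + m)%N; exists (fun z => a z * b z); first exact: (holomorphicM ha hb).
near=> z.
have -> : f z = a z / (z - z0) ^+ n by near: z.
have -> : g z = b z / (z - z0) ^+ m by near: z.
by rewrite exprD mulf_div.
Unshelve. all: by end_near. Qed.

Lemma near_addr (P : set C) (z0 s : C) :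
  (\forall z \near z0 + s, P z) -> \forall z \near z0, P (z + s).
Proof.
rewrite (near_shift z0); apply: filterS => z /=.
by rewrite (addrC z0) addrK.
Qed.

Lemma dnear_addr (P : set C) (z0 s : C) :
  (\forall z \near (z0 + s)^', P z) -> \forall z \near z0^', P (z + s).
Proof.
rewrite /dnbhs !near_withinE => /near_addr; apply: filterS => z + zz0.
by apply; rewrite (inj_eq (addIr s)).
Qed.

Lemma meromorphic_shift f s : meromorphic f -> meromorphic (fun z => f (z + s)).
Proof.
move=> mf z0; have [n [g hg eg]] := mf (z0 + s).
exists n; exists (fun z => g (z + s)).
  move/near_addr: hg; apply: filterS => z.
  rewrite /derivable => h; rewrite (_ : (fun h => _) =
     (fun h : C^o => h^-1 *: ((g \o shift (z + s)) (h *: (1 : C^o)) - g (z + s)))) //.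
  by apply/funext => w; rewrite /= addrA.
move/dnear_addr: eg; apply: filterS => z ->.
by rewrite opprD addrACA subrr addr0.
Qed.

Record mfun := MFun { mval :> C -> C; mvalP : meromorphic mval }.
HB.instance Definition _ := gen_eqMixin mfun.
HB.instance Definition _ := gen_choiceMixin mfun.

(* Equality off a closed discrete set. *)
Definition meq (f g : mfun) : bool :=
  `[< forall z0 : C, \forall z \near z0^', f z = g z >].

Lemma meq_equiv : equiv_class_of meq.
Proof.
split=> [f|f g|g f h].
- by apply/asboolP => z0; apply: nearW.
- by apply/asboolP/asboolP => e z0; apply: filterS (e z0) => z ->.
- move=> /asboolP e1 /asboolP e2; apply/asboolP => z0; near=> z.
  have -> : f z = g z by near: z; exact: e1.
  by near: z; exact: e2.
Unshelve. all: by end_near. Qed.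

Canonical meq_equivRel := EquivRelPack meq_equiv.

Definition mero := {eq_quot meq}.
HB.instance Definition _ := Choice.on mero.
HB.instance Definition _ := EqQuotient.on mero.

Definition to_mero (f : C -> C) (mf : meromorphic f) : mero :=
  \pi_mero (MFun mf).

Lemma meroP (f g : mfun) :
  (forall z0 : C, \forall z \near z0^', f z = g z) <->
  \pi_mero f = \pi_mero g.
Proof.
split; first by move=> e; apply/eqmodP; apply/asboolP.
by move/eqmodP/asboolP.
Qed.

Lemma mrepr (f : mfun) z0 :
  \forall z \near z0^', repr (\pi_mero f) z = f z.
Proof. by move: z0; apply/meroP; rewrite reprK. Qed.

Lemma meroW (a : mero) : exists f, a = \pi_mero f.
Proof. by exists (repr a); rewrite reprK. Qed.

Definition m_cst (c : C) : mero := to_mero (meromorphic_cst c).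
Definition m_add (a b : mero) : mero :=
  to_mero (meromorphicD (mvalP (repr a)) (mvalP (repr b))).
Definition m_mul (a b : mero) : mero :=
  to_mero (meromorphicM (mvalP (repr a)) (mvalP (repr b))).
Definition m_opp (a : mero) : mero :=
  to_mero (meromorphicM (meromorphic_cst (-1)) (mvalP (repr a))).
(* T_s f = f(. + s) *)
Definition m_shift (s : C) (a : mero) : mero :=
  to_mero (meromorphic_shift s (mvalP (repr a))).

Lemma to_meroE (f g : C -> C) mf mg : (forall z0, \forall z \near z0^', f z = g z) ->
  @to_mero f mf = @to_mero g mg.
Proof. by move=> e; apply/meroP. Qed.

Lemma m_addE f g mf mg :
  m_add (@to_mero f mf) (@to_mero g mg) = to_mero (meromorphicD mf mg).
Proof.
apply: to_meroE => z0; near=> z.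
have -> : repr (to_mero mf) z = f z by near: z; apply: mrepr.
by have -> : repr (to_mero mg) z = g z by near: z; apply: mrepr.
Unshelve. all: by end_near. Qed.

Lemma m_mulE f g mf mg :
  m_mul (@to_mero f mf) (@to_mero g mg) = to_mero (meromorphicM mf mg).
Proof.
apply: to_meroE => z0; near=> z.
have -> : repr (to_mero mf) z = f z by near: z; apply: mrepr.
by have -> : repr (to_mero mg) z = g z by near: z; apply: mrepr.
Unshelve. all: by end_near. Qed.

Lemma m_oppE f mf :
  m_opp (@to_mero f mf) = to_mero (meromorphicM (meromorphic_cst (-1)) mf).
Proof.
apply: to_meroE => z0; near=> z.
by have -> : repr (to_mero mf) z = f z by near: z; apply: mrepr.
Unshelve. all: by end_near. Qed.

Lemma m_shiftE s f mf :
  m_shift s (@to_mero f mf) = to_mero (meromorphic_shift s mf).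
Proof.
apply: to_meroE => z0.
exact: (@dnear_addr (fun w => repr (to_mero mf) w = f w) _ _ (mrepr _ _)).
Qed.

Lemma to_meroW (a : mero) : exists f mf, a = @to_mero f mf.
Proof. by have [[f mf] ->] := meroW a; exists f; exists mf. Qed.

Lemma m_addA : associative m_add.
Proof.
move=> a b c; have [f [mf ->]] := to_meroW a; have [g [mg ->]] := to_meroW b.
have [h [mh ->]] := to_meroW c; rewrite !m_addE.
by apply: to_meroE => z0; apply: nearW => z; rewrite addrA.
Qed.

Lemma m_addC : commutative m_add.
Proof.
move=> a b; have [f [mf ->]] := to_meroW a; have [g [mg ->]] := to_meroW b.
by rewrite !m_addE; apply: to_meroE => z0; apply: nearW => z; rewrite addrC.
Qed.

Lemma m_add0 : left_id (m_cst 0) m_add.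
Proof.
move=> a; have [f [mf ->]] := to_meroW a.
by rewrite m_addE; apply: to_meroE => z0; apply: nearW => z; rewrite add0r.
Qed.

Lemma m_addN : left_inverse (m_cst 0) m_opp m_add.
Proof.
move=> a; have [f [mf ->]] := to_meroW a; rewrite m_oppE m_addE.
by apply: to_meroE => z0; apply: nearW => z; rewrite mulN1r addNr.
Qed.

HB.instance Definition _ :=
  GRing.isZmodule.Build mero m_addA m_addC m_add0 m_addN.

Lemma m_mulA : associative m_mul.
Proof.
move=> a b c; have [f [mf ->]] := to_meroW a; have [g [mg ->]] := to_meroW b.
have [h [mh ->]] := to_meroW c; rewrite !m_mulE.
by apply: to_meroE => z0; apply: nearW => z; rewrite mulrA.
Qed.

Lemma m_mulC : commutative m_mul.
Proof.
move=> a b; have [f [mf ->]] := to_meroW a; have [g [mg ->]] := to_meroW b.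
by rewrite !m_mulE; apply: to_meroE => z0; apply: nearW => z; rewrite mulrC.
Qed.

Lemma m_mul1 : left_id (m_cst 1) m_mul.
Proof.
move=> a; have [f [mf ->]] := to_meroW a.
by rewrite m_mulE; apply: to_meroE => z0; apply: nearW => z; rewrite mul1r.
Qed.

Lemma m_mulDl : left_distributive m_mul +%R.
Proof.
move=> a b c; have [f [mf ->]] := to_meroW a; have [g [mg ->]] := to_meroW b.
have [h [mh ->]] := to_meroW c.
rewrite [_ + _]m_addE !m_mulE [RHS]m_addE.
by apply: to_meroE => z0; apply: nearW => z; rewrite mulrDl.
Qed.

Lemma m_cst_inj : injective m_cst.
Proof.
move=> c d /meroP /(_ 0) /=; exact: filter_const.
Qed.

Lemma m_neq0 : m_cst 1 != 0.
Proof. by apply/eqP => /m_cst_inj/eqP; rewrite oner_eq0. Qed.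

HB.instance Definition _ :=
  GRing.Zmodule_isComNzRing.Build mero m_mulA m_mulC m_mul1 m_mulDl m_neq0.

(* For C the complex numbers, [mero C] is the field of meromorphic functions on
   the plane, with the pointwise operations. Only its commutative ring
   structure is set up here; the inverse is the inverse in that ring (which, by
   the identity theorem, every nonzero element has). *)
Definition m_unit : pred (mero) := fun a => `[< exists b, b * a = 1 >].
Definition m_inv (a : mero) : mero :=
  if pselect (exists b, b * a = 1) is left e then projT1 (cid e) else a.

Lemma m_mulVf : {in m_unit, left_inverse 1 m_inv *%R}.
Proof.
move=> a /asboolP ua; rewrite /m_inv; case: pselect => // e.
by case: cid.
Qed.

Lemma m_unitP (a b : mero) : b * a = 1 -> m_unit a.
Proof. by move=> ba; apply/asboolP; exists b. Qed.

Lemma m_inv_out : {in [predC m_unit], m_inv =1 id}.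
Proof.
move=> a; rewrite inE => /asboolP ua; rewrite /m_inv.
by case: pselect.
Qed.

HB.instance Definition _ :=
  GRing.ComNzRing_hasMulInverse.Build mero m_mulVf m_unitP m_inv_out.

Lemma to_meroD f g mf mg :
  @to_mero f mf + @to_mero g mg = to_mero (meromorphicD mf mg).
Proof. exact: m_addE. Qed.

Lemma to_meroM f g mf mg :
  @to_mero f mf * @to_mero g mg = to_mero (meromorphicM mf mg).
Proof. exact: m_mulE. Qed.

Lemma m_shiftD s : {morph m_shift s : a b / a + b}.
Proof.
move=> a b; have [f [mf ->]] := to_meroW a; have [g [mg ->]] := to_meroW b.
rewrite to_meroD !m_shiftE to_meroD.
by apply: to_meroE => z0; apply: nearW.
Qed.

Lemma m_shiftM s : {morph m_shift s : a b / a * b}.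
Proof.
move=> a b; have [f [mf ->]] := to_meroW a; have [g [mg ->]] := to_meroW b.
rewrite to_meroM !m_shiftE to_meroM.
by apply: to_meroE => z0; apply: nearW.
Qed.

Lemma m_shift_cst s c : m_shift s (m_cst c) = m_cst c.
Proof. by rewrite m_shiftE; apply: to_meroE => z0; apply: nearW. Qed.

Lemma m_shift_shift s t a : m_shift s (m_shift t a) = m_shift (s + t) a.
Proof.
have [f [mf ->]] := to_meroW a; rewrite !m_shiftE.
by apply: to_meroE => z0; apply: nearW => z; rewrite addrA.
Qed.

Lemma m_shift0 a : m_shift 0 a = a.
Proof.
have [f [mf ->]] := to_meroW a; rewrite m_shiftE.
by apply: to_meroE => z0; apply: nearW => z; rewrite addr0.
Qed.

End Meromorphic.


Section ComplexExp.
Variable R : realType.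

(* exp(x + iy) = e^x (cos y + i sin y) *)
Definition cexp (z : R[i]) : R[i] :=
  (expR (complex.Re z))%:C * (cos (complex.Im z) +i* sin (complex.Im z)).

Lemma cexpD z w : cexp (z + w) = cexp z * cexp w.
Proof.
case: z w => [a b] [c d]; rewrite /cexp /= expRD rmorphM mulrACA; congr (_ * _).
rewrite cosD sinD -[RHS]/((_ - _) +i* (_ + _)).
by congr (_ +i* _); rewrite addrC; congr (_ + _); rewrite mulrC.
Qed.

Lemma diff0_bound (f : R -> R) (df e : R) :
  is_derive (0 : R) (1 : R) (f : R^o -> R^o) df -> 0 < e ->
  \forall x \near (0 : R), `|f x - f 0 - df * x| <= e * `|x|.
Proof.
move=> [df1 df2] e0; have := derivable_nbhs df1; rewrite df2 => /eqaddoP.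
move=> /(_ e e0); apply: filterS => x /=.
rewrite -[X in `|X| <= _ -> _]/(f (x * 1 + 0) - (f 0 + x * df)).
by rewrite mulr1 addr0 opprD addrA (mulrC x).
Qed.

Lemma le_normReIm (h : R[i]) :
  `|complex.Re h|%:C <= `|h| /\ `|complex.Im h|%:C <= `|h|.
Proof.
split; rewrite normc_def lecR -sqrtr_sqr ler_wsqrtr //.
  by rewrite lerDl sqr_ge0.
by rewrite lerDr sqr_ge0.
Qed.

Lemma normReIm_le (h : R[i]) :
  `|h| <= (`|complex.Re h| + `|complex.Im h|)%:C.
Proof.
rewrite normc_def lecR -[leRHS]ger0_norm ?addr_ge0//.
rewrite -sqrtr_sqr ler_wsqrtr // sqrrD !real_normK ?num_real //.
by rewrite -addrA lerD2l lerDr mulrn_wge0 // mulr_ge0.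
Qed.

Lemma cexp_bound (e : R) : 0 < e -> exists2 d : R, 0 < d &
  forall h : R[i], `|h| < d%:C -> `|cexp h - 1 - h| <= e%:C * `|h|.
Proof.
move=> e0; have [e1 [e10 e11 e1e]] : exists e1 : R, [/\ 0 < e1, e1 <= 1 & 12 * e1 <= e].
  exists (Num.min 1 (e / 12)); split.
  - by rewrite lt_min ltr01 divr_gt0.
  - by rewrite ge_min lexx.
  - by rewrite mulrC -ler_pdivlMr // ge_min lexx orbT.
have dexp : is_derive (0 : R) (1 : R) (@expR R : R^o -> R^o) 1.
  by have := is_derive_expR (0 : R); rewrite expR0.
have dcos : is_derive (0 : R) (1 : R) (@cos R : R^o -> R^o) 0.
  by have := is_derive_cos (0 : R); rewrite sin0 oppr0.
have dsin : is_derive (0 : R) (1 : R) (@sin R : R^o -> R^o) 1.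
  by have := is_derive_sin (0 : R); rewrite cos0.
have /nbhs_ballP[d1 /= d10 h1] := diff0_bound dexp e10.
have /nbhs_ballP[d2 /= d20 h2] := diff0_bound dcos e10.
have /nbhs_ballP[d3 /= d30 h3] := diff0_bound dsin e10.
exists (Num.min (Num.min d1 d2) (Num.min d3 e1)).
  by rewrite !lt_min d10 d20 d30.
move=> [x y] hlt.
have [xle yle] := le_normReIm (x +i* y); rewrite /= in xle yle.
have {}hlt (u : R) : `|u|%:C <= `|x +i* y| ->
    [/\ `|u| < d1, `|u| < d2, `|u| < d3 & `|u| < e1].
  move=> /le_lt_trans /(_ hlt); rewrite ltcR !lt_min.
  by case/andP => /andP[-> ->] /andP[-> ->].
have [x1 _ _ xe] := hlt _ xle; have [_ y2 y3 ye] := hlt _ yle.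
have {}h1 : `|expR x - 1 - x| <= e1 * `|x|.
  by have := h1 x; rewrite /ball /= sub0r normrN expR0 mul1r; apply.
have {}h2 : `|cos y - 1| <= e1 * `|y|.
  by have := h2 y; rewrite /ball /= sub0r normrN cos0 mul0r subr0; apply.
have {}h3 : `|sin y - y| <= e1 * `|y|.
  by have := h3 y; rewrite /ball /= sub0r normrN sin0 subr0 mul1r; apply.
have cos1 : `|cos y| <= 1 by rewrite ler_norml cos_geN1 cos_le1.
have sin1 : `|sin y| <= 1 by rewrite ler_norml sin_geN1 sin_le1.
have sin2 : `|sin y| <= 2 * `|y|.
  rewrite -(subrK y (sin y)) (le_trans (ler_normD _ _)) //.
  rewrite mulrDl mul1r lerD2r (le_trans h3) // ler_piMl //.
have x2 : `|1 + x| <= 2.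
  rewrite (le_trans (ler_normD _ _)) // normr1 lerD2l.
  exact: le_trans (ltW xe) e11.
have re : `|expR x * cos y - 1 - x| <= 3 * e1 * (`|x| + `|y|).
  have -> : expR x * cos y - 1 - x =
      (expR x - 1 - x) * cos y + (1 + x) * (cos y - 1) by ring.
  rewrite (le_trans (ler_normD _ _)) // !normrM.
  have H1 : `|expR x - 1 - x| * `|cos y| <= e1 * `|x| * 1 by apply: ler_pM.
  have H2 : `|1 + x| * `|cos y - 1| <= 2 * (e1 * `|y|) by apply: ler_pM.
  have H3 : 0 <= e1 * `|x| by rewrite mulr_ge0 // ltW.
  have H4 : 0 <= e1 * `|y| by rewrite mulr_ge0 // ltW.
  by lra.
have im : `|expR x * sin y - y| <= 3 * e1 * (`|x| + `|y|).
  have -> : expR x * sin y - y =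
      (expR x - 1 - x) * sin y + x * sin y + (sin y - y) by ring.
  rewrite (le_trans (ler_normD _ _)) //.
  have := ler_normD ((expR x - 1 - x) * sin y) (x * sin y); rewrite !normrM => H0.
  have H1 : `|expR x - 1 - x| * `|sin y| <= e1 * `|x| * 1 by apply: ler_pM.
  have H2 : `|x| * `|sin y| <= e1 * (2 * `|y|) by apply: ler_pM => //; apply: ltW.
  have H3 : 0 <= e1 * `|x| by rewrite mulr_ge0 // ltW.
  have H4 : 0 <= e1 * `|y| by rewrite mulr_ge0 // ltW.
  by lra.
rewrite (le_trans (normReIm_le _)) //.
have -> : complex.Re (cexp (x +i* y) - 1 - (x +i* y)) = expR x * cos y - 1 - x.
  by rewrite /cexp /= mul0r subr0.
have -> : complex.Im (cexp (x +i* y) - 1 - (x +i* y)) = expR x * sin y - y.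
  by rewrite /cexp /= mul0r addr0 subr0.
have H : (`|x| + `|y|)%:C <= 2 * `|x +i* y|.
  by rewrite rmorphD mulrDl mul1r lerD.
apply: (@le_trans _ _ (6 * e1 * (`|x| + `|y|))%:C).
  by rewrite lecR; lra.
rewrite rmorphM (le_trans (ler_wpM2l _ H)) //.
  by rewrite lecR mulr_ge0 // ltW.
rewrite mulrA ler_wpM2r // -(rmorph_nat (real_complex R) 2) -rmorphM lecR.
by lra.
Qed.

Lemma cexp_derivable (z : R[i]) : derivable (cexp : R[i]^o -> R[i]^o) z 1.
Proof.
apply/cvg_ex; exists (cexp z : R[i]^o).
apply/cvgrPdist_le => e e0.
have eR : e = (complex.Re e)%:C by rewrite RRe_real // ger0_real // ltW.
have nR : `|cexp z| = (complex.Re `|cexp z|)%:C by rewrite RRe_real // normr_real.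
have n0 : 0 <= complex.Re `|cexp z| by rewrite -lecR -nR; exact: normr_ge0.
pose c := complex.Re e / (complex.Re `|cexp z| + 1).
have c0 : 0 < c.
  by rewrite divr_gt0 ?ltr_wpDl // -ltcR -eR; exact: e0.
have [d d0 hd] := cexp_bound c0.
have dC0 : 0 < d%:C :> R[i] by rewrite ltcR.
near=> t.
have t0 : t != 0 by near: t; exact: (@nbhs_dnbhs_neq R[i]^o 0).
have td : `|t| < d%:C by near: t; exact: (@dnbhs0_lt R[i] R[i]^o).
rewrite /= -[t%:A]/(t * 1) mulr1 cexpD -[_ *: _]/(_ * _).
have -> : cexp z - t^-1 * (cexp t * cexp z - cexp z) =
    - (cexp z * t^-1 * (cexp t - 1 - t)).
  have key (K : fieldType) (w u s : K) : s != 0 ->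
      w - s^-1 * (u * w - w) = - (w * s^-1 * (u - 1 - s)).
    by move=> s0; field.
  exact: (@key R[i]).
suff main : `|- (cexp z * t^-1 * (cexp t - 1 - t)) : R[i]| <= (e : R[i]).
  exact: main.
rewrite normrN (normrM (cexp z * t^-1)) (normrM (cexp z)) normfV -mulrA.
apply: (@le_trans _ _ (`|cexp z| * c%:C)).
   rewrite ler_wpM2l // ler_pdivrMl ?normr_gt0 // mulrC.
  by apply: hd.
rewrite nR -rmorphM eR lecR /c mulrCA ler_piMr //.
  by rewrite -lecR -eR ltW //; exact: e0.
by rewrite ler_pdivrMr ?ltr_wpDl // mul1r lerDl.
Unshelve. all: by end_near. Qed.

Lemma cexp_affine_meromorphic (a b : R[i]) :
  meromorphic (fun z : R[i] => cexp (a * z + b)).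
Proof.
apply: entire_meromorphic => z.
apply/derivable1_diffP.
apply: (@differentiable_comp _ R[i]^o R[i]^o R[i]^o (fun z => a * z + b) cexp).
  apply/derivable1_diffP.
  apply: (@derivableD R[i] R[i]^o R[i]^o (fun z => a * z) (fun=> b) z 1).
    exact: (@derivableZ R[i] R[i]^o R[i]^o id a z 1 (@derivable_id R[i] R[i]^o z 1)).
  exact: (@derivable_cst R[i] R[i]^o R[i]^o b z 1).
exact/derivable1_diffP/cexp_derivable.
Qed.
End ComplexExp.

Section DifferenceOperators.
Variable C : numFieldType.
Notation M := (mero C).

Definition is_diffop (X : M -> M) : Prop :=
  exists u : seq (M * C), X = fun g => \sum_(p <- u) p.1 * m_shift p.2 g.

Record diffop := Diffop { dapp :> M -> M; dappP : is_diffop dapp }.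
HB.instance Definition _ := gen_eqMixin diffop.
HB.instance Definition _ := gen_choiceMixin diffop.

Lemma diffop_eq (X Y : diffop) : X =1 Y -> X = Y.
Proof.
case: X Y => [X hX] [Y hY] /= /funext e; subst Y.
by congr Diffop; apply: Prop_irrelevance.
Qed.

Lemma m_shift_sum (I : Type) (r : seq I) (F : I -> M) s :
  m_shift s (\sum_(i <- r) F i) = \sum_(i <- r) m_shift s (F i).
Proof. exact: (big_morph _ (@m_shiftD C s) (@m_shift_cst C s 0)). Qed.

Lemma diffop_term f s : is_diffop (fun g => f * m_shift s g).
Proof. by exists [:: (f, s)]; apply/funext => g; rewrite big_seq1. Qed.

Lemma diffop_zero : is_diffop (fun=> 0).
Proof. by exists [::]; apply/funext => g; rewrite big_nil. Qed.

Lemma diffop_add X Y : is_diffop X -> is_diffop Y ->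
  is_diffop (fun g => X g + Y g).
Proof.
move=> [u ->] [v ->]; exists (u ++ v); apply/funext => g.
by rewrite big_cat.
Qed.

Lemma diffop_opp X : is_diffop X -> is_diffop (fun g => - X g).
Proof.
move=> [u ->]; exists [seq (- p.1, p.2) | p <- u]; apply/funext => g.
by rewrite big_map -sumrN; apply: eq_bigr => p _; rewrite mulNr.
Qed.

Lemma diffop_comp X Y : is_diffop X -> is_diffop Y ->
  is_diffop (fun g => X (Y g)).
Proof.
move=> [u ->] [v ->].
exists [seq (p.1 * m_shift p.2 r.1, p.2 + r.2) | p <- u, r <- v].
apply/funext => g; rewrite big_allpairs_dep; apply: eq_bigr => p _.
rewrite m_shift_sum mulr_sumr; apply: eq_bigr => r _.
by rewrite m_shiftM m_shift_shift mulrA.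
Qed.

Lemma diffop_additive (X : diffop) : {morph X : a b / a + b}.
Proof.
have [u ->] := dappP X => a b; rewrite -big_split; apply: eq_bigr => p _.
by rewrite m_shiftD mulrDr.
Qed.

(* f T_s *)
Definition d_term f s := Diffop (diffop_term f s).
Definition d_zero := Diffop diffop_zero.
Definition d_one := d_term 1 0.
Definition d_add (X Y : diffop) := Diffop (diffop_add (dappP X) (dappP Y)).
Definition d_opp (X : diffop) := Diffop (diffop_opp (dappP X)).
Definition d_mul (X Y : diffop) := Diffop (diffop_comp (dappP X) (dappP Y)).

Lemma d_addA : associative d_add.
Proof. by move=> X Y Z; apply: diffop_eq => g /=; rewrite addrA. Qed.
Lemma d_addC : commutative d_add.
Proof. by move=> X Y; apply: diffop_eq => g /=; rewrite addrC. Qed.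
Lemma d_add0 : left_id d_zero d_add.
Proof. by move=> X; apply: diffop_eq => g /=; rewrite add0r. Qed.
Lemma d_addN : left_inverse d_zero d_opp d_add.
Proof. by move=> X; apply: diffop_eq => g /=; rewrite addNr. Qed.

HB.instance Definition _ :=
  GRing.isZmodule.Build diffop d_addA d_addC d_add0 d_addN.

Lemma d_mulA : associative d_mul.
Proof. by move=> X Y Z; apply: diffop_eq. Qed.
Lemma d_mul1l : left_id d_one d_mul.
Proof. by move=> X; apply: diffop_eq => g /=; rewrite mul1r m_shift0. Qed.
Lemma d_mul1r : right_id d_one d_mul.
Proof. by move=> X; apply: diffop_eq => g /=; rewrite mul1r m_shift0. Qed.
Lemma d_mulDl : left_distributive d_mul +%R.
Proof. by move=> X Y Z; apply: diffop_eq. Qed.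
Lemma d_mulDr : right_distributive d_mul +%R.
Proof. by move=> X Y Z; apply: diffop_eq => g /=; rewrite diffop_additive. Qed.

HB.instance Definition _ :=
  GRing.Zmodule_isPzRing.Build diffop d_mulA d_mul1l d_mul1r d_mulDl d_mulDr.

Definition d_fun (f : M) : diffop := d_term f 0.
Definition d_shift (s : C) : diffop := d_term 1 s.

(* (D_h)_{st} *)
Definition d_homog (s t : C) (X : diffop) : Prop :=
  if s == t then exists f, X = d_fun f * d_shift (- s) else X = 0.
End DifferenceOperators.

Section DynamicalSL2.
Variables (R : realType) (q : R).
Notation C := (R[i]).
Notation M := (mero C).

(* The function q^(a lambda + b) of lambda; here q > 0. *)
Definition qlin (a b : C) : M :=
  to_mero (cexp_affine_meromorphic (a * (ln q)%:C) (b * (ln q)%:C)).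

(* The constant function q^n. *)
Definition qcst (n : int) : M := m_cst (q%:C ^ n).

Definition Ffun : M := (qlin 2 2 - qcst (-2)) / (qlin 2 2 - 1).
Definition Gfun : M :=
  ((qlin 2 2 - qcst 2) * (qlin 2 2 - qcst (-2))) / (qlin 2 2 - 1) ^+ 2.

(* Formal expressions in the generators L_xy of F_R(SL(2)) and in the functions
   f(lambda) = [Fl f] and f(mu) = [Fr f]; the sign + is [true], - is [false]. *)
Inductive term : Type :=
| Fl of M
| Fr of M
| Gen of bool & bool
| Add of term & term
| Opp of term
| Mul of term & term.
HB.instance Definition _ := gen_eqMixin term.
HB.instance Definition _ := gen_choiceMixin term.

Definition omega (x : bool) : C := if x then 1 else -1.

Local Notation "a + b" := (Add a b) : trm_scope.
Local Notation "- a" := (Opp a) : trm_scope.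
Local Notation "a - b" := (Add a (Opp b)) : trm_scope.
Local Notation "a * b" := (Mul a b) : trm_scope.
Delimit Scope trm_scope with trm.
Bind Scope trm_scope with term.

(* H(lambda, mu) and J(lambda, mu); note
   q^(2(lambda+mu+2)) = q^(2(lambda+1)) q^(2(mu+1)). *)
Definition Hterm : term :=
  (Fl (qcst 1 - qcst (-1))%R * (Fl (qlin 2 2) * Fr (qlin 2 2) - Fl 1%R)
   * Fl (qlin 2 2 - 1)^-1%R * Fr (qlin 2 2 - 1)^-1%R)%trm.
Definition Jterm : term :=
  (Fl (qcst 1 - qcst (-1))%R * (Fr (qlin 2 2) - Fl (qlin 2 2))
   * Fl (qlin 2 2 - 1)^-1%R * Fr (qlin 2 2 - 1)^-1%R)%trm.

Local Notation al := (Gen true true).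
Local Notation be := (Gen true false).
Local Notation ga := (Gen false true).
Local Notation de := (Gen false false).

(* The congruence generated by the ring axioms, the fact that Fl and Fr are
   commuting copies of the C-algebra of meromorphic functions (a scalar c is
   both Fl c and Fr c), and the defining relations of F_R(SL(2)). *)
Reserved Notation "a ~~ b" (at level 70).
Inductive trel : term -> term -> Prop :=
| trel_refl a : a ~~ a
| trel_sym a b : a ~~ b -> b ~~ a
| trel_trans a b c : a ~~ b -> b ~~ c -> a ~~ c
| trel_add a a' b b' : a ~~ a' -> b ~~ b' -> (a + b)%trm ~~ (a' + b')%trm
| trel_opp a a' : a ~~ a' -> (- a)%trm ~~ (- a')%trm
| trel_mul a a' b b' : a ~~ a' -> b ~~ b' -> (a * b)%trm ~~ (a' * b')%trm
| trel_addA a b c : (a + (b + c))%trm ~~ (a + b + c)%trm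
| trel_addC a b : (a + b)%trm ~~ (b + a)%trm
| trel_add0 a : (Fl 0%R + a)%trm ~~ a
| trel_addN a : (- a + a)%trm ~~ Fl 0
| trel_mulA a b c : (a * (b * c))%trm ~~ (a * b * c)%trm
| trel_mul1l a : (Fl 1%R * a)%trm ~~ a
| trel_mul1r a : (a * Fl 1%R)%trm ~~ a
| trel_mulDl a b c : ((a + b) * c)%trm ~~ (a * c + b * c)%trm
| trel_mulDr a b c : (a * (b + c))%trm ~~ (a * b + a * c)%trm
| trel_FlD f g : Fl (f + g) ~~ (Fl f + Fl g)%trm
| trel_FlM f g : Fl (f * g) ~~ (Fl f * Fl g)%trm
| trel_FrD f g : Fr (f + g) ~~ (Fr f + Fr g)%trm
| trel_FrM f g : Fr (f * g) ~~ (Fr f * Fr g)%trm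
| trel_cst c : Fr (m_cst c) ~~ Fl (m_cst c)
| trel_comm f g : (Fl f * Fr g)%trm ~~ (Fr g * Fl f)%trm
| trel_Fl f x y : (Fl f * Gen x y)%trm ~~ (Gen x y * Fl (m_shift (omega x) f))%trm
| trel_Fr f x y : (Fr f * Gen x y)%trm ~~ (Gen x y * Fr (m_shift (omega y) f))%trm
| trel_ab : (al * be)%trm ~~ (Fr (qcst 1 * m_shift (-1) Ffun)%R * (be * al))%trm
| trel_ac : (al * ga)%trm ~~ (Fl (qcst 1 * Ffun)%R * (ga * al))%trm
| trel_bd : (be * de)%trm ~~ (Fl (qcst 1 * Ffun)%R * (de * be))%trm
| trel_cd : (ga * de)%trm ~~ (Fr (qcst 1 * m_shift (-1) Ffun)%R * (de * ga))%trm
| trel_ad : (al * de - de * al)%trm ~~ (Hterm * (ga * be))%trm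
| trel_bc : (be * ga - Fl Gfun * (ga * be))%trm ~~ (Jterm * (al * de))%trm
| trel_det : (al * de - Fl (qcst 1 * Ffun)%R * (ga * be))%trm ~~ Fl 1
where "a ~~ b" := (trel a b).

Definition trelb (a b : term) : bool := `[< trel a b >].

Lemma trelb_equiv : equiv_class_of trelb.
Proof.
split=> [a|a b|b a c].
- by apply/asboolP; apply: trel_refl.
- by apply/asboolP/asboolP; apply: trel_sym.
- by move=> /asboolP ab /asboolP bc; apply/asboolP; apply: trel_trans bc.
Qed.

Canonical trel_equivRel := EquivRelPack trelb_equiv.

(* F_R(SL(2)) *)
Definition dynSL2 := {eq_quot trelb}.
HB.instance Definition _ := Choice.on dynSL2.
HB.instance Definition _ := EqQuotient.on dynSL2.

Lemma dynP (a b : term) : trel a b <-> \pi_dynSL2 a = \pi_dynSL2 b.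
Proof.
split; first by move=> e; apply/eqmodP; apply/asboolP.
by move/eqmodP/asboolP.
Qed.

Lemma dyn_repr a : trel (repr (\pi_dynSL2 a)) a.
Proof. by apply/dynP; rewrite reprK. Qed.

Lemma dynW (x : dynSL2) : exists a, x = \pi_dynSL2 a.
Proof. by exists (repr x); rewrite reprK. Qed.

Definition dyn_add (x y : dynSL2) : dynSL2 := \pi_dynSL2 (Add (repr x) (repr y)).
Definition dyn_mul (x y : dynSL2) : dynSL2 := \pi_dynSL2 (Mul (repr x) (repr y)).
Definition dyn_opp (x : dynSL2) : dynSL2 := \pi_dynSL2 (Opp (repr x)).

Lemma dyn_addE a b : dyn_add (\pi a) (\pi b) = \pi_dynSL2 (Add a b).
Proof. by apply/dynP; apply: trel_add; apply: dyn_repr. Qed.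
Lemma dyn_mulE a b : dyn_mul (\pi a) (\pi b) = \pi_dynSL2 (Mul a b).
Proof. by apply/dynP; apply: trel_mul; apply: dyn_repr. Qed.
Lemma dyn_oppE a : dyn_opp (\pi a) = \pi_dynSL2 (Opp a).
Proof. by apply/dynP; apply: trel_opp; apply: dyn_repr. Qed.

Lemma dyn_addA : associative dyn_add.
Proof.
move=> x y z; have [a ->] := dynW x; have [b ->] := dynW y; have [c ->] := dynW z.
rewrite (dyn_addE b c) (dyn_addE a b) (dyn_addE a) (dyn_addE _ c).
by apply/dynP; apply: trel_addA.
Qed.
Lemma dyn_addC : commutative dyn_add.
Proof.
move=> x y; have [a ->] := dynW x; have [b ->] := dynW y.
by rewrite (dyn_addE a) (dyn_addE b); apply/dynP; apply: trel_addC.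
Qed.
Lemma dyn_add0 : left_id (\pi_dynSL2 (Fl 0)) dyn_add.
Proof.
by move=> x; have [a ->] := dynW x; rewrite dyn_addE; apply/dynP; apply: trel_add0.
Qed.
Lemma dyn_addN : left_inverse (\pi_dynSL2 (Fl 0)) dyn_opp dyn_add.
Proof.
move=> x; have [a ->] := dynW x; rewrite dyn_oppE dyn_addE.
by apply/dynP; apply: trel_addN.
Qed.
HB.instance Definition _ :=
  GRing.isZmodule.Build dynSL2 dyn_addA dyn_addC dyn_add0 dyn_addN.

Lemma dyn_mulA : associative dyn_mul.
Proof.
move=> x y z; have [a ->] := dynW x; have [b ->] := dynW y; have [c ->] := dynW z.
rewrite (dyn_mulE b c) (dyn_mulE a b) (dyn_mulE a) (dyn_mulE _ c).
by apply/dynP; apply: trel_mulA.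
Qed.
Lemma dyn_mul1l : left_id (\pi_dynSL2 (Fl 1)) dyn_mul.
Proof.
by move=> x; have [a ->] := dynW x; rewrite dyn_mulE; apply/dynP; apply: trel_mul1l.
Qed.
Lemma dyn_mul1r : right_id (\pi_dynSL2 (Fl 1)) dyn_mul.
Proof.
by move=> x; have [a ->] := dynW x; rewrite dyn_mulE; apply/dynP; apply: trel_mul1r.
Qed.
Lemma dyn_mulDl : left_distributive dyn_mul +%R.
Proof.
move=> x y z; have [a ->] := dynW x; have [b ->] := dynW y; have [c ->] := dynW z.
rewrite -[LHS]/(dyn_mul (dyn_add _ _) _) -[RHS]/(dyn_add _ _).
rewrite (dyn_addE a b) !(dyn_mulE _ c) dyn_addE.
by apply/dynP; apply: trel_mulDl.
Qed.
Lemma dyn_mulDr : right_distributive dyn_mul +%R.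
Proof.
move=> x y z; have [a ->] := dynW x; have [b ->] := dynW y; have [c ->] := dynW z.
rewrite -[LHS]/(dyn_mul _ (dyn_add _ _)) -[RHS]/(dyn_add _ _).
rewrite (dyn_addE b c) !(dyn_mulE a) dyn_addE.
by apply/dynP; apply: trel_mulDr.
Qed.
HB.instance Definition _ := GRing.Zmodule_isPzRing.Build dynSL2
  dyn_mulA dyn_mul1l dyn_mul1r dyn_mulDl dyn_mulDr.

Definition mu_l (f : M) : dynSL2 := \pi_dynSL2 (Fl f).
Definition mu_r (f : M) : dynSL2 := \pi_dynSL2 (Fr f).
Definition Lgen (x y : bool) : dynSL2 := \pi_dynSL2 (Gen x y).

(* [homog r s] is (F_R)_{rs}. *)
Inductive homog : C -> C -> dynSL2 -> Prop :=
| homog_l f : homog 0 0 (mu_l f)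
| homog_r f : homog 0 0 (mu_r f)
| homog_L x y : homog (omega x) (omega y) (Lgen x y)
| homog0 r s : homog r s 0
| homogD r s a b : homog r s a -> homog r s b -> homog r s (a + b)
| homogM r s r' s' a b : homog r s a -> homog r' s' b ->
    homog (r + r') (s + s') (a * b).
End DynamicalSL2.

Section TensorSquare.
Variables (R : realType) (q : R).
Notation C := (R[i]).
Notation M := (mero C).
Notation A := (dynSL2 q).

Definition composable (a b : A) : Prop :=
  exists r s t : C, homog r s a /\ homog s t b.

Record stens := STens { st_l : A; st_r : A; stP : composable st_l st_r }.

Lemma homog_mu_l_mul r s f (a : A) : homog r s a -> homog r s (mu_l q f * a).
Proof. by move=> h; rewrite -(add0r r) -(add0r s); apply: homogM => //; apply: homog_l. Qed.
Lemma homog_mu_r_mul r s f (a : A) : homog r s a -> homog r s (mu_r q f * a).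
Proof. by move=> h; rewrite -(add0r r) -(add0r s); apply: homogM => //; apply: homog_r. Qed.

Lemma composableI r s t (a b : A) : homog r s a -> homog s t b -> composable a b.
Proof. by move=> ha hb; exists r, s, t. Qed.

Definition stens_mk r s t (a b : A) (ha : homog r s a) (hb : homog s t b) : stens :=
  STens (composableI ha hb).

(* Formal sums of elements a (x) b with a in (F_R)_{rs} and b in (F_R)_{st},
   modulo biadditivity and f(mu) a (x) b = a (x) f(lambda) b. As
   mu_l c = mu_r c for a scalar c, the latter includes balancing over C. *)
Inductive teq : seq stens -> seq stens -> Prop :=
| teq_refl u : teq u u
| teq_sym u v : teq u v -> teq v u
| teq_trans u v w : teq u v -> teq v w -> teq u w
| teq_cat u u' v v' : teq u u' -> teq v v' -> teq (u ++ v) (u' ++ v')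
| teq_catC u v : teq (u ++ v) (v ++ u)
| teq_0l r s t (b : A) (hb : homog s t b) :
    teq [:: stens_mk (homog0 q r s) hb] [::]
| teq_Dl r s t (a a' b : A) (ha : homog r s a) (ha' : homog r s a')
    (hb : homog s t b) :
    teq [:: stens_mk (homogD ha ha') hb] [:: stens_mk ha hb; stens_mk ha' hb]
| teq_Dr r s t (a b b' : A) (ha : homog r s a) (hb : homog s t b)
    (hb' : homog s t b') :
    teq [:: stens_mk ha (homogD hb hb')] [:: stens_mk ha hb; stens_mk ha hb']
| teq_bal r s t (f : M) (a b : A) (ha : homog r s a) (hb : homog s t b) :
    teq [:: stens_mk (homog_mu_r_mul f ha) hb]
        [:: stens_mk ha (homog_mu_l_mul f hb)].

Definition teqb (u v : seq stens) : bool := `[< teq u v >].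

Lemma teqb_equiv : equiv_class_of teqb.
Proof.
split=> [a|a b|b a c].
- by apply/asboolP; apply: teq_refl.
- by apply/asboolP/asboolP; apply: teq_sym.
- by move=> /asboolP ab /asboolP bc; apply/asboolP; apply: teq_trans bc.
Qed.

HB.instance Definition _ := gen_eqMixin stens.
HB.instance Definition _ := gen_choiceMixin stens.
Canonical teq_equivRel := EquivRelPack teqb_equiv.

(* F_R (x)~ F_R *)
Definition tens2 := {eq_quot teqb}.
HB.instance Definition _ := Choice.on tens2.
HB.instance Definition _ := EqQuotient.on tens2.

Lemma tensP (u v : seq stens) : teq u v <-> \pi_tens2 u = \pi_tens2 v.
Proof.
split; first by move=> e; apply/eqmodP; apply/asboolP.
by move/eqmodP/asboolP.
Qed.

Lemma tens_repr u : teq (repr (\pi_tens2 u)) u.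
Proof. by apply/tensP; rewrite reprK. Qed.

Lemma tensW (x : tens2) : exists u, x = \pi_tens2 u.
Proof. by exists (repr x); rewrite reprK. Qed.

Lemma stens_eq (x y : stens) : st_l x = st_l y -> st_r x = st_r y -> x = y.
Proof.
case: x y => [a b h] [a' b' h'] /= e1 e2; subst.
by congr STens; apply: Prop_irrelevance.
Qed.

Lemma homog1 : homog 0 0 (1 : A).
Proof. exact: (homog_l q 1). Qed.

Lemma homogN r s (a : A) : homog r s a -> homog r s (- a).
Proof.
move=> h.
suff -> : - a = mu_l q (-1) * a by apply: homog_mu_l_mul.
apply/eqP; rewrite eq_sym -addr_eq0.
have -> : mu_l q (-1) * a + a = (mu_l q (-1) + mu_l q 1) * a.
  by rewrite mulrDl [mu_l q 1 * a]mul1r.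
have -> : mu_l q (-1) + mu_l q 1 = 0 :> A.
  rewrite -[LHS]/(dyn_add _ _) dyn_addE; apply/dynP.
  by apply: trel_trans (trel_sym (trel_FlD q _ _)) _; rewrite addNr; apply: trel_refl.
by rewrite mul0r.
Qed.

Lemma composableN (a b : A) : composable a b -> composable (- a) b.
Proof.
by move=> [r [s [t [ha hb]]]]; exists r, s, t; split=> //; apply: homogN.
Qed.

Lemma composableM (a b c d : A) :
  composable a b -> composable c d -> composable (a * c) (b * d).
Proof.
move=> [r [s [t [ha hb]]]] [r' [s' [t' [hc hd]]]].
by exists (r + r'), (s + s'), (t + t'); split; apply: homogM.
Qed.

Definition st_opp (x : stens) : stens := STens (composableN (stP x)).
Definition st_mul (x y : stens) : stens := STens (composableM (stP x) (stP y)).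
Definition st_one : stens := stens_mk homog1 homog1.

Definition fs_opp (u : seq stens) := [seq st_opp x | x <- u].
Definition fs_mul (u v : seq stens) := [seq st_mul x y | x <- u, y <- v].

Lemma teq_perm (u v : seq stens) : perm_eq u v -> teq u v.
Proof.
elim: u v => [|x u ih] v.
  by rewrite perm_sym => /perm_nilP ->; apply: teq_refl.
move=> e; have xv : x \in v by rewrite -(perm_mem e) mem_head.
case/path.splitPr: xv e => v1 v2 e.
have {}e : perm_eq u (v1 ++ v2).
  by move: e; rewrite perm_sym (perm_catCA v1 [:: x] v2) /= perm_cons perm_sym.
apply: (@teq_trans _ ([:: x] ++ (v1 ++ v2))).
  by rewrite -[x :: u]cat1s; apply: teq_cat; [apply: teq_refl|apply: ih].
rewrite catA -[v1 ++ x :: v2]/(v1 ++ ([:: x] ++ v2)) catA.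
by apply: teq_cat; [apply: teq_catC|apply: teq_refl].
Qed.


Lemma mu_lM f g : mu_l q (f * g) = mu_l q f * mu_l q g.
Proof.
by rewrite -[RHS]/(dyn_mul _ _) dyn_mulE; apply/dynP; apply: trel_FlM.
Qed.

Lemma mu_rM f g : mu_r q (f * g) = mu_r q f * mu_r q g.
Proof.
by rewrite -[RHS]/(dyn_mul _ _) dyn_mulE; apply/dynP; apply: trel_FrM.
Qed.

Lemma mu_lr f g : mu_l q f * mu_r q g = mu_r q g * mu_l q f.
Proof.
rewrite -[LHS]/(dyn_mul _ _) -[RHS]/(dyn_mul _ _) !dyn_mulE.
by apply/dynP; apply: trel_comm.
Qed.

Lemma mu_l_gen f x y :
  mu_l q f * Lgen q x y = Lgen q x y * mu_l q (m_shift (omega R x) f).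
Proof.
rewrite -[LHS]/(dyn_mul _ _) -[RHS]/(dyn_mul _ _) !dyn_mulE.
by apply/dynP; apply: trel_Fl.
Qed.

Lemma mu_r_gen f x y :
  mu_r q f * Lgen q x y = Lgen q x y * mu_r q (m_shift (omega R y) f).
Proof.
rewrite -[LHS]/(dyn_mul _ _) -[RHS]/(dyn_mul _ _) !dyn_mulE.
by apply/dynP; apply: trel_Fr.
Qed.

Lemma homog_mu_r (r s : C) (a : A) f : homog r s a ->
  mu_r q f * a = a * mu_r q (m_shift s f).
Proof.
move=> h; elim: h f => {r s a}.
- by move=> g f; rewrite m_shift0 mu_lr.
- by move=> g f; rewrite m_shift0 -!mu_rM mulrC.
- by move=> x y f; apply: mu_r_gen.
- by move=> r s f; rewrite mulr0 mul0r.
- by move=> r s a b _ iha _ ihb f; rewrite mulrDr mulrDl iha ihb.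
- move=> r s r' s' a b _ iha _ ihb f.
  by rewrite mulrA iha -!mulrA ihb m_shift_shift (addrC s').
Qed.

Lemma homog_mu_l (r s : C) (a : A) f : homog r s a ->
  mu_l q f * a = a * mu_l q (m_shift r f).
Proof.
move=> h; elim: h f => {r s a}.
- by move=> g f; rewrite m_shift0 -!mu_lM mulrC.
- by move=> g f; rewrite m_shift0 mu_lr.
- by move=> x y f; apply: mu_l_gen.
- by move=> r s f; rewrite mulr0 mul0r.
- by move=> r s a b _ iha _ ihb f; rewrite mulrDr mulrDl iha ihb.
- move=> r s r' s' a b _ iha _ ihb f.
  by rewrite mulrA iha -!mulrA ihb m_shift_shift (addrC r').
Qed.

Lemma teq_map (g : stens -> stens) :
  (forall r s t (b : A) (hb : homog s t b),
    teq [:: g (stens_mk (homog0 q r s) hb)] [::]) ->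
  (forall r s t (a a' b : A) (ha : homog r s a) (ha' : homog r s a')
    (hb : homog s t b), teq [:: g (stens_mk (homogD ha ha') hb)]
    [:: g (stens_mk ha hb); g (stens_mk ha' hb)]) ->
  (forall r s t (a b b' : A) (ha : homog r s a) (hb : homog s t b)
    (hb' : homog s t b'), teq [:: g (stens_mk ha (homogD hb hb'))]
    [:: g (stens_mk ha hb); g (stens_mk ha hb')]) ->
  (forall r s t (f : M) (a b : A) (ha : homog r s a) (hb : homog s t b),
    teq [:: g (stens_mk (homog_mu_r_mul f ha) hb)]
        [:: g (stens_mk ha (homog_mu_l_mul f hb))]) ->
  forall u v, teq u v -> teq (map g u) (map g v).
Proof.
move=> g0 gDl gDr gb u v; elim=> {u v} //=.
- by move=> u; apply: teq_refl.
- by move=> u v _; apply: teq_sym.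
- by move=> u v w _ h1 _ h2; apply: teq_trans h1 h2.
- by move=> u u' v v' _ h1 _ h2; rewrite !map_cat; apply: teq_cat.
- by move=> u v; rewrite !map_cat; apply: teq_catC.
Qed.

Lemma teq_pairs u u' v v' :
  [seq (st_l x, st_r x) | x <- u'] = [seq (st_l x, st_r x) | x <- u] ->
  [seq (st_l x, st_r x) | x <- v'] = [seq (st_l x, st_r x) | x <- v] ->
  teq u v -> teq u' v'.
Proof.
have inj : injective (fun x => (st_l x, st_r x)).
  by move=> x y [e1 e2]; apply: stens_eq.
by move=> /(inj_map inj) -> /(inj_map inj) ->.
Qed.

Lemma teq_opp u v : teq u v -> teq (fs_opp u) (fs_opp v).
Proof.
apply: teq_map.
- by move=> r s t b hb; apply: teq_pairs (teq_0l r hb) => //=; rewrite oppr0.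
- move=> r s t a a' b ha ha' hb.
  by apply: teq_pairs (teq_Dl (homogN ha) (homogN ha') hb) => //=; rewrite opprD.
- move=> r s t a b b' ha hb hb'.
  by apply: teq_pairs (teq_Dr (homogN ha) hb hb').
- move=> r s t f a b ha hb.
  by apply: teq_pairs (teq_bal f (homogN ha) hb) => //=; rewrite mulrN.
Qed.

Lemma teq_mulr y u v : teq u v ->
  teq [seq st_mul x y | x <- u] [seq st_mul x y | x <- v].
Proof.
case: y => c d [r' [s' [t' [hc hd]]]]; move: u v; apply: teq_map.
- move=> r s t b hb.
  by apply: teq_pairs (teq_0l (r + r') (homogM hb hd)) => //=; rewrite mul0r.
- move=> r s t a a' b ha ha' hb.
  apply: teq_pairs (teq_Dl (homogM ha hc) (homogM ha' hc) (homogM hb hd)) => //=.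
  by rewrite mulrDl.
- move=> r s t a b b' ha hb hb'.
  apply: teq_pairs (teq_Dr (homogM ha hc) (homogM hb hd) (homogM hb' hd)) => //=.
  by rewrite mulrDl.
- move=> r s t f a b ha hb.
  by apply: teq_pairs (teq_bal f (homogM ha hc) (homogM hb hd)) => //=;
    rewrite mulrA.
Qed.

Lemma teq_mull y u v : teq u v ->
  teq [seq st_mul y x | x <- u] [seq st_mul y x | x <- v].
Proof.
case: y => c d [r' [s' [t' [hc hd]]]]; move: u v; apply: teq_map.
- move=> r s t b hb.
  by apply: teq_pairs (teq_0l (r' + r) (homogM hd hb)) => //=; rewrite mulr0.
- move=> r s t a a' b ha ha' hb.
  apply: teq_pairs (teq_Dl (homogM hc ha) (homogM hc ha') (homogM hd hb)) => //=.
  by rewrite mulrDr.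
- move=> r s t a b b' ha hb hb'.
  apply: teq_pairs (teq_Dr (homogM hc ha) (homogM hd hb) (homogM hd hb')) => //=.
  by rewrite mulrDr.
- move=> r s t f a b ha hb /=.
  have e : f = m_shift s' (m_shift (- s') f).
    by rewrite m_shift_shift subrr m_shift0.
  apply: teq_pairs
    (teq_bal (m_shift (- s') f) (homogM hc ha) (homogM hd hb)) => /=.
    by rewrite [X in _ = [:: (X, _)]]mulrA (homog_mu_r _ hc) -e mulrA.
  by rewrite [X in _ = [:: (_, X)]]mulrA (homog_mu_l _ hd) -e mulrA.
Qed.

Lemma fs_mul_consr u y v :
  perm_eq (fs_mul u (y :: v)) ([seq st_mul x y | x <- u] ++ fs_mul u v).
Proof. exact/permPl/(@perm_allpairs_consr _ _ _ (fun x y => st_mul x y) u (fun=> y) (fun=> v)). Qed.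

Lemma teq_mul u u' v v' : teq u u' -> teq v v' -> teq (fs_mul u v) (fs_mul u' v').
Proof.
move=> hu hv; apply: (@teq_trans _ (fs_mul u' v)).
  elim: v {v' hv} => [|y v ih].
    by rewrite /fs_mul !allpairs0r; apply: teq_refl.
  apply: teq_trans (teq_perm (fs_mul_consr _ _ _)) _.
  apply: teq_trans (teq_sym (teq_perm (fs_mul_consr _ _ _))).
  by apply: teq_cat => //; apply: teq_mulr.
elim: u' {u hu} => [|x u ih]; first exact: teq_refl.
by rewrite /fs_mul !allpairs_cons; apply: teq_cat => //; apply: teq_mull.
Qed.

Definition tens_add (x y : tens2) : tens2 := \pi_tens2 (repr x ++ repr y).
Definition tens_opp (x : tens2) : tens2 := \pi_tens2 (fs_opp (repr x)).
Definition tens_mul (x y : tens2) : tens2 := \pi_tens2 (fs_mul (repr x) (repr y)).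

Lemma tens_addE u v : tens_add (\pi u) (\pi v) = \pi_tens2 (u ++ v).
Proof. by apply/tensP; apply: teq_cat; apply: tens_repr. Qed.
Lemma tens_oppE u : tens_opp (\pi u) = \pi_tens2 (fs_opp u).
Proof. by apply/tensP; apply: teq_opp; apply: tens_repr. Qed.
Lemma tens_mulE u v : tens_mul (\pi u) (\pi v) = \pi_tens2 (fs_mul u v).
Proof. by apply/tensP; apply: teq_mul; apply: tens_repr. Qed.

Lemma tens_addA : associative tens_add.
Proof.
move=> x y z; have [u ->] := tensW x; have [v ->] := tensW y; have [w ->] := tensW z.
by rewrite (tens_addE v w) (tens_addE u v) (tens_addE u) (tens_addE _ w) catA.
Qed.
Lemma tens_addC : commutative tens_add.
Proof.
move=> x y; have [u ->] := tensW x; have [v ->] := tensW y.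
by rewrite (tens_addE u) (tens_addE v); apply/tensP; apply: teq_catC.
Qed.
Lemma tens_add0 : left_id (\pi_tens2 [::]) tens_add.
Proof. by move=> x; have [u ->] := tensW x; rewrite tens_addE. Qed.
Lemma tens_addN : left_inverse (\pi_tens2 [::]) tens_opp tens_add.
Proof.
move=> x; have [u ->] := tensW x; rewrite tens_oppE tens_addE; apply/tensP.
elim: u => [|[a b [r [s [t [ha hb]]]]] u ih]; first exact: teq_refl.
set y := STens _; apply: (@teq_trans _ ([:: st_opp y; y] ++ (fs_opp u ++ u))).
  by apply: teq_perm; rewrite perm_cons (perm_catCA (fs_opp u) [:: y] u).
rewrite -[[::]]cats0; apply: teq_cat => //.
apply: (@teq_trans _ [:: stens_mk (homogD (homogN ha) ha) hb]).
  by apply: teq_pairs (teq_sym (teq_Dl (homogN ha) ha hb)).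
by apply: teq_pairs (teq_0l r hb) => //=; rewrite addNr.
Qed.
HB.instance Definition _ :=
  GRing.isZmodule.Build tens2 tens_addA tens_addC tens_add0 tens_addN.

Lemma st_mulA x y z : st_mul x (st_mul y z) = st_mul (st_mul x y) z.
Proof. by apply: stens_eq; rewrite /= mulrA. Qed.
Lemma st_mul1l x : st_mul st_one x = x.
Proof. by apply: stens_eq; rewrite /= mul1r. Qed.
Lemma st_mul1r x : st_mul x st_one = x.
Proof. by apply: stens_eq; rewrite /= mulr1. Qed.

Lemma fs_mulA u v w : fs_mul u (fs_mul v w) = fs_mul (fs_mul u v) w.
Proof.
elim: u => [|x u ih] //.
rewrite /fs_mul !allpairs_cons allpairs_cat -!/(fs_mul _ _) -ih; congr cat.
rewrite /fs_mul map_allpairs allpairs_mapl; apply: eq_allpairs => y z.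
exact: st_mulA.
Qed.

Lemma tens_mulA : associative tens_mul.
Proof.
move=> x y z; have [u ->] := tensW x; have [v ->] := tensW y; have [w ->] := tensW z.
by rewrite (tens_mulE v w) (tens_mulE u v) (tens_mulE u) (tens_mulE _ w) fs_mulA.
Qed.
Lemma tens_mul1l : left_id (\pi_tens2 [:: st_one]) tens_mul.
Proof.
move=> x; have [u ->] := tensW x; rewrite tens_mulE /fs_mul allpairs1l.
by rewrite (eq_map st_mul1l) map_id.
Qed.
Lemma tens_mul1r : right_id (\pi_tens2 [:: st_one]) tens_mul.
Proof.
move=> x; have [u ->] := tensW x; rewrite tens_mulE /fs_mul allpairs1r.
by rewrite (eq_map st_mul1r) map_id.
Qed.
Lemma tens_mulDl : left_distributive tens_mul +%R.
Proof.
move=> x y z; have [u ->] := tensW x; have [v ->] := tensW y; have [w ->] := tensW z.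
rewrite -[LHS]/(tens_mul (tens_add _ _) _) -[RHS]/(tens_add _ _).
rewrite (tens_addE u v) !(tens_mulE _ w) tens_addE.
by rewrite /fs_mul allpairs_cat.
Qed.
Lemma tens_mulDr : right_distributive tens_mul +%R.
Proof.
move=> x y z; have [u ->] := tensW x; have [v ->] := tensW y; have [w ->] := tensW z.
rewrite -[LHS]/(tens_mul _ (tens_add _ _)) -[RHS]/(tens_add _ _).
rewrite (tens_addE v w) !(tens_mulE u) tens_addE.
by apply/tensP/teq_perm; exact/permPl/(@perm_allpairs_catr _ _ _ (fun x y => st_mul x y) u (fun=> v) (fun=> w)).
Qed.
HB.instance Definition _ := GRing.Zmodule_isPzRing.Build tens2
  tens_mulA tens_mul1l tens_mul1r tens_mulDl tens_mulDr.

(* The class of a (x) b, for composable a and b (all uses below are such). *)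
Definition tens (a b : A) : tens2 :=
  if pselect (composable a b) is left h then \pi_tens2 [:: STens h] else 0.

End TensorSquare.

Section Pairing.
Variables (R : realType) (q : R).
Notation C := (R[i]).
Notation A := (dynSL2 q).
Notation D := (diffop C).

Record is_coproduct (Delta : {rmorphism A -> tens2 q}) : Prop := {
  coproduct_gen : forall a b : bool, Delta (Lgen q a b) =
    \sum_(x : bool) tens (Lgen q a x) (Lgen q x b);
  coproduct_l : forall f, Delta (mu_l q f) = tens (mu_l q f) 1;
  coproduct_r : forall f, Delta (mu_r q f) = tens 1 (mu_r q f) }.

Record is_counit (eps : {rmorphism A -> D}) : Prop := {
  counit_gen : forall a b : bool,
    eps (Lgen q a b) = if a == b then d_shift (- omega R a) else 0;
  counit_l : forall f, eps (mu_l q f) = d_fun f;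
  counit_r : forall f, eps (mu_r q f) = d_fun f }.

(* <L_ab, L_cd> *)
Definition gen_pairing (a b c d : bool) : D :=
  match a, b, c, d with
  | true, true, true, true => d_shift (-2)
  | true, true, false, false => 1
  | false, false, true, true => 1
  | false, false, false, false => d_fun (m_shift 1 (Gfun q)) * d_shift 2
  | true, false, true, false =>
      d_fun ((qcst q 1 - qcst q (-1)) / (qlin q 1 0 - qlin q (-1) 0))
  | false, true, false, true =>
      d_fun ((qcst q (-1) - qcst q 1) / (qlin q 1 2 - qlin q (-1) (-2)))
  | _, _, _, _ => 0
  end.

(* [tensor_decomp u n s u' u'']: u = sum_i u'_i (x) u''_i with
   u'_i in (F_R)_{r, s_i} and u''_i in (F_R)_{s_i, t}. *)
Definition tensor_decomp (u : tens2 q) (n : nat) (s : 'I_n -> C)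
    (u' u'' : 'I_n -> A) : Prop :=
  [/\ forall i, exists r, homog r (s i) (u' i),
      forall i, exists t, homog (s i) t (u'' i) &
      u = \sum_i tens (u' i) (u'' i)].

Record is_pairing (Delta : A -> tens2 q) (eps : A -> D) (P : A -> A -> D) :
    Prop := {
  pairing_linl : forall c a a' b, P (mu_l q (m_cst c) * a + a') b =
    d_fun (m_cst c) * P a b + P a' b;
  pairing_linr : forall c a b b', P a (mu_l q (m_cst c) * b + b') =
    d_fun (m_cst c) * P a b + P a b';
  pairing_homog : forall r s t u a b, homog r s a -> homog t u b ->
    d_homog (r + u) (s + t) (P a b);
  pairing_mu_l1 : forall f a b, P (mu_l q f * a) b = d_fun f * P a b;
  pairing_mu_l2 : forall f a b, P a (mu_l q f * b) = d_fun f * P a b;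
  pairing_mu_r1 : forall f a b, P (a * mu_r q f) b = P a b * d_fun f;
  pairing_mu_r2 : forall f a b, P a (b * mu_r q f) = P a b * d_fun f;
  pairing_mul1 : forall a b c n (s : 'I_n -> C) (c' c'' : 'I_n -> A),
    tensor_decomp (Delta c) s c' c'' ->
    P (a * b) c = \sum_i P a (c' i) * d_shift (s i) * P b (c'' i);
  pairing_mul2 : forall a b c n (s : 'I_n -> C) (a' a'' : 'I_n -> A),
    tensor_decomp (Delta a) s a' a'' ->
    P a (b * c) = \sum_i P (a' i) b * d_shift (s i) * P (a'' i) c;
  pairing_1r : forall a, P a 1 = eps a;
  pairing_1l : forall b, P 1 b = eps b;
  pairing_gen : forall a b c d,
    P (Lgen q a b) (Lgen q c d) = gen_pairing a b c d }.

(* gamma^(N-k) alpha^k *)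
Definition gamma_alpha (N k : nat) : A :=
  Lgen q false true ^+ (N - k) * Lgen q true true ^+ k.

Definition matrix_elements (Delta : A -> tens2 q) (N : nat)
    (t : 'I_N.+1 -> 'I_N.+1 -> A) : Prop :=
  (forall k j : 'I_N.+1,
     homog (2 * k%:R - N%:R) (2 * j%:R - N%:R) (t k j)) /\
  (forall k : 'I_N.+1, Delta (gamma_alpha N k) =
     \sum_(j < N.+1) tens (t k j) (gamma_alpha N j)).

End Pairing.

Section HypergeometricSeries.
Variable K : comUnitRingType.
Implicit Types a b c d e p z : K.

Definition qpoch a p (n : nat) : K := \prod_(i < n) (1 - a * p ^+ i).

(* 4phi3[p^-k, p^-m, a, b; c, d, e; p, z] *)
Definition phi43 (k m : nat) a b c d e p z : K :=
  \sum_(n < (minn k m).+1)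
    (qpoch (p ^- k) p n * qpoch (p ^- m) p n * qpoch a p n * qpoch b p n)
    / (qpoch p p n * qpoch c p n * qpoch d p n * qpoch e p n) * z ^+ n.
End HypergeometricSeries.

(* Main.v *)
(* The pairing sees only matrix elements: pairing gamma^(M-k) alpha^k with b gamma^(M-j)
   isolates <t_kj, b> up to an invertible factor, so the t_kj may be replaced by the
   elements obtained by multiplying out the coproduct, and associativity of the product
   in the other slot yields Delta (t_kj) = sum_i t_ki (x) t_ij under the pairing. Hence
   the pairings <t^M_kj, t^N_ml> satisfy two-term recurrences in M, whose coefficients
   are pairings of a generator with a matrix element. For k = 0 the recurrence is solved
   by a product; the step from k to k + 1 is a contiguous relation for balanced terminating
   4phi3 series, which is proved by telescoping. All the coefficients are rational
   functions of q^lambda, a field on which the shifts of lambda act. *)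
From HB Require Import structures.
Require Import Defs.
From mathcomp Require Import all_boot all_order all_algebra.
From mathcomp Require Import complex zify ring.
From mathcomp Require Import boolp classical_sets functions reals.
From mathcomp Require Import topology normedtype derive sequences exp trigo.

Set Implicit Arguments.
Unset Strict Implicit.
Unset Printing Implicit Defensive.

Import Order.TTheory GRing.Theory Num.Theory.
Import numFieldNormedType.Exports.
Local Open Scope classical_set_scope.
Local Open Scope complex_scope.
Local Open Scope ring_scope.
Local Open Scope quotient_scope.

(** * Meromorphic functions and rational functions of q^lambda *)

(** In [mero] an inverse means something only for a unit, so denominators must be known invertible
    before any closed formula can be handled. All of them are rational in q^lambda. Over the complex
    numbers a polynomial in q^lambda splits into factors q^lambda - a, and such a factor is inverted
    through a lower bound near its zeros. This gives the field [qfun]. The isolation of one entry is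
    a degree argument: the pairing takes values in a diagonal grading, so at most one summand of a
    coproduct survives. The factor left over is a product of counit values and of pairings of single
    generators with matrix elements, all known in closed form, hence invertible. For k = 0 a factor
    gamma is split off on the left, which keeps k = 0; both summands are multiples of the claimed
    value, and the two ratios add up to 1. For k > 0 an alpha is split off on the right, which
    lowers M and k together. In the two resulting series the parameter q^(-2k) and one denominator
    parameter, q^(-2L) or q^(2(L-M-N-lambda-1)), are multiplied by q^2. This keeps the series
    balanced and is the shape of the contiguous relation. *)

Section ShiftMorphism.
Variable C : numFieldType.
Notation M := (mero C).

Lemma m_cst_is_zmod_morphism : zmod_morphism (@m_cst C).
Proof.
move=> a b; apply/eqP; rewrite eq_sym subr_eq; apply/eqP.
by rewrite [RHS]to_meroD; apply: to_meroE => z0; apply: nearW => z; rewrite subrK.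
Qed.

Lemma m_cst_is_monoid_morphism : monoid_morphism (@m_cst C).
Proof.
split=> // a b; rewrite [RHS]to_meroM.
by apply: to_meroE => z0; apply: nearW.
Qed.

HB.instance Definition _ := GRing.isZmodMorphism.Build C M (@m_cst C)
  m_cst_is_zmod_morphism.
HB.instance Definition _ := GRing.isMonoidMorphism.Build C M (@m_cst C)
  m_cst_is_monoid_morphism.

Lemma m_shift_is_zmod_morphism (s : C) : zmod_morphism (@m_shift C s).
Proof.
move=> a b; apply/eqP; rewrite eq_sym subr_eq -m_shiftD subrK; exact: eqxx.
Qed.

Lemma m_shift_is_monoid_morphism (s : C) : monoid_morphism (@m_shift C s).
Proof. by split; [exact: m_shift_cst | exact: m_shiftM]. Qed.

HB.instance Definition _ s := GRing.isZmodMorphism.Build M M (@m_shift C s)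
  (m_shift_is_zmod_morphism s).
HB.instance Definition _ s := GRing.isMonoidMorphism.Build M M (@m_shift C s)
  (m_shift_is_monoid_morphism s).
End ShiftMorphism.

Section ExponentialUnits.
Variables (R : realType) (q : R).
Hypothesis hq : 0 < q < 1.
Notation C := (R[i]).

Lemma cexp0 : cexp 0 = 1 :> C.
Proof. by rewrite /cexp /= expR0 cos0 sin0 mul1r. Qed.

Lemma cexpN (z : C) : cexp z * cexp (- z) = 1.
Proof. by rewrite -cexpD subrr cexp0. Qed.

Lemma cexp_neq0 (z : C) : cexp z != 0.
Proof.
by apply/eqP => e; have /eqP := cexpN z; rewrite e mul0r eq_sym oner_eq0.
Qed.

Lemma cexp_real (x : R) : cexp x%:C = (expR x)%:C.
Proof. by rewrite /cexp /= cos0 sin0 mulr1. Qed.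

Lemma qlinD (a b a' b' : C) : qlin q (a + a') (b + b') = qlin q a b * qlin q a' b'.
Proof.
rewrite [RHS]to_meroM; apply: to_meroE => z0; apply: nearW => z.
by rewrite -cexpD; congr cexp; ring.
Qed.

Lemma qlin_shift (s a b : C) : m_shift s (qlin q a b) = qlin q a (b + a * s).
Proof.
rewrite m_shiftE; apply: to_meroE => z0; apply: nearW => z.
by congr cexp; ring.
Qed.

Lemma qlin00 : qlin q 0 0 = 1.
Proof.
by apply: to_meroE => z0; apply: nearW => z; rewrite !mul0r addr0 cexp0.
Qed.

Lemma qlin_cst1 : qlin q 0 1 = m_cst q%:C.
Proof.
apply: to_meroE => z0; apply: nearW => z; rewrite !mul0r add0r mul1r cexp_real.
by case/andP: hq => q0 _; rewrite lnK // posrE.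
Qed.

Lemma qlin_mulN (a b : C) : qlin q a b * qlin q (- a) (- b) = 1.
Proof. by rewrite -qlinD !subrr qlin00. Qed.

Lemma qlin_unit (a b : C) : qlin q a b \is a GRing.unit.
Proof. by apply/unitrP; exists (qlin q (- a) (- b)); rewrite mulrC qlin_mulN. Qed.

Lemma qlinV (a b : C) : (qlin q a b)^-1 = qlin q (- a) (- b).
Proof.
by apply: (mulrI (qlin_unit a b)); rewrite mulrV ?qlin_unit // qlin_mulN.
Qed.

Lemma lnq_neq0 : (ln q)%:C != 0 :> C.
Proof.
case/andP: hq => q0 q1.
by rewrite (_ : 0 = 0%:C) // (inj_eq (fmorph_inj _)) lt_eqF // ln_lt0 // q0.
Qed.

End ExponentialUnits.

(** * Inverting entire functions with simple zeros *)

Section InverseMeromorphic.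
Variable C : numFieldType.

(** The linear lower bound says that every zero is simple, and it keeps f nonzero on a punctured
    neighbourhood; at the other points continuity suffices. *)
Lemma isolated_zeros (f : C -> C) :
  (forall z, derivable (f : C^o -> C^o) z 1) ->
  (forall z0, f z0 = 0 -> exists2 K : C, 0 < K &
    \forall z \near z0, K * `|z - z0| <= `|f z|) ->
  forall z0, \forall z \near z0^', f z != 0.
Proof.
move=> df zf z0; have [f0|f0] := eqVneq (f z0) 0.
  have [K K0 hK] := zf _ f0; have hK' := nbhs_dnbhs hK.
  near=> z; rewrite -normr_gt0.
  apply: (@lt_le_trans _ _ (K * `|z - z0|)); last by near: z.
  rewrite mulr_gt0 // normr_gt0 subr_eq0; near: z; exact: nbhs_dnbhs_neq.
have cf : {for z0, continuous (f : C^o -> C^o)}.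
  exact/differentiable_continuous/derivable1_diffP/df.
apply: nbhs_dnbhs.
exact: (@cvgr_neq0 C C^o C^o (nbhs z0) _ (f : C^o -> C^o) _ cf f0).
Unshelve. all: by end_near. Qed.

Lemma meromorphic_inv (f : C -> C) :
  (forall z, derivable (f : C^o -> C^o) z 1) ->
  (forall z0, f z0 = 0 -> exists2 K : C, 0 < K &
    \forall z \near z0, K * `|z - z0| <= `|f z|) ->
  meromorphic (fun z => (f z)^-1).
Proof.
move=> df zf z0.
have cf : {for z0, continuous (f : C^o -> C^o)}.
  exact/differentiable_continuous/derivable1_diffP/df.
have [f0|f0] := eqVneq (f z0) 0; last first.
  exists 0%N; exists (fun z => (f z)^-1); last by near=> z; rewrite expr0 divr1.
  near=> z; apply: derivableV => //.
  by near: z; exact: (@cvgr_neq0 C C^o C^o (nbhs z0) _ (f : C^o -> C^o) _ cf f0).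
have [K K0 hK] := zf _ f0.
(* A third power, rather than the first, makes the derivative at the zero vanish,
   so that the lower bound on [f] is all that is needed there. *)
pose g z := (z - z0) ^+ 3 * (f z)^-1.
exists 3%N; exists g; last first.
  near=> z.
  have zz : z - z0 != 0 by rewrite subr_eq0; near: z; apply: nbhs_dnbhs_neq.
  by rewrite /g mulrAC divff ?expf_neq0 // mul1r.
near=> z; have [->|zz] := eqVneq z z0; last first.
  apply: (@derivableM C C^o (fun z => (z - z0) ^+ 3) (fun z => (f z)^-1)).
    have d1 : derivable ((fun z => z - z0) : C^o -> C^o) z 1.
      apply: (@derivableD C C^o C^o id (fun=> - z0) z 1).
        exact: (@derivable_id C C^o z 1).
      exact: (@derivable_cst C C^o C^o (- z0) z 1).
    exact: (@derivableM C C^o _ _ z 1 d1 (@derivableM C C^o _ _ z 1 d1 d1)).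
  apply: derivableV => //; rewrite -normr_gt0.
  apply: (@lt_le_trans _ _ (K * `|z - z0|)); last by near: z.
  by rewrite mulr_gt0 // normr_gt0 subr_eq0.
apply/cvg_ex; exists (0 : C^o); apply/cvgrPdist_le => e e0.
have hK0 := @near_addr C (fun z => K * `|z - z0| <= `|f z|) 0 z0.
rewrite add0r in hK0; have {hK0} := hK0 hK => hK0.
have hK1 : \forall h \near (0 : C)^', K * `|h + z0 - z0| <= `|f (h + z0)|.
  exact: nbhs_dnbhs hK0.
near=> h.
have h0 : h != 0 by near: h; exact: nbhs_dnbhs_neq.
have he : `|h| < K * e by near: h; apply: (@dnbhs0_lt C C^o); rewrite mulr_gt0.
have hf : K * `|h| <= `|f (h + z0)|.
  have := addrK z0 h => {1}<-; near: h; exact: hK1.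
have fh0 : 0 < `|f (h + z0)|.
  by rewrite (lt_le_trans _ hf) // mulr_gt0 ?normr_gt0.
rewrite sub0r normrN /g /= subrr expr0n mul0r subr0.
rewrite -[h%:A]/(h * 1) mulr1 addrK -[_ *: _]/(_ * _).
have -> : h^-1 * (h ^+ 3 * (f (h + z0))^-1) = h * h / f (h + z0).
  by rewrite !exprS expr0 mulr1 !mulrA mulVf // mul1r.
rewrite normrM normfV normrM ler_pdivrMr //.
apply: le_trans (_ : e * (K * `|h|) <= _); last by rewrite ler_wpM2l // ltW.
by rewrite mulrA ler_wpM2r // (mulrC e) ltW.
Unshelve. all: by end_near. Qed.
End InverseMeromorphic.

Section LinearFactorUnits.
Variables (R : realType) (q : R).
Hypothesis hq : 0 < q < 1.
Notation C := (R[i]).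

(** With w = c (z - z0) the difference is exp(c z0) (exp w - 1), and [cexp_bound] with constant 1/2
    gives |exp w - 1| >= |w| / 2 for small w. The summands [+ 0] match the affine exponent in
    [qlin]. *)
Lemma cexp_linear_lower_bound (c z0 : C) : c != 0 ->
  exists2 K : C, 0 < K & \forall z \near nbhs (z0 : C^o),
    K * `|z - z0| <= `|cexp (c * z + 0) - cexp (c * z0 + 0)|.
Proof.
move=> c0; have [d d0 hd] := @cexp_bound R (2^-1) ltac:(by rewrite invr_gt0).
exists (`|cexp (c * z0)| * (2^-1 * `|c|)).
  by rewrite mulr_gt0 ?normr_gt0 ?cexp_neq0 // mulr_gt0 ?normr_gt0 // invr_gt0.
have dc0 : 0 < d%:C / `|c| by rewrite divr_gt0 ?normr_gt0 // ltcR.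
have hb : \forall z \near nbhs (z0 : C^o), `|z - z0| < d%:C / `|c|.
  apply: (@near_addr C (fun z => `|z| < d%:C / `|c|)).
  by rewrite subrr; apply: (@nbhs0_lt C C^o).
apply: filterS hb => z hz.
have {}hz : `|c * (z - z0)| < d%:C.
  by rewrite normrM mulrC -ltr_pdivlMr ?normr_gt0.
have -> : cexp (c * z + 0) - cexp (c * z0 + 0) =
    cexp (c * z0) * (cexp (c * (z - z0)) - 1).
  by rewrite !addr0 mulrBr mulr1 -cexpD -mulrDr subrKC.
rewrite (normrM (cexp (c * z0))) -mulrA ler_wpM2l // -mulrA -(normrM c).
set w := c * _ in hz *; have := hd w hz.
have -> : (2^-1 : R)%:C = 2^-1 by rewrite fmorphV rmorph_nat.
move=> h1; have h2 : `|w| <= `|cexp w - 1| + `|cexp w - 1 - w|.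
  have -> : `|w| = `|(cexp w - 1) - (cexp w - 1 - w)|.
    by congr `|_|; rewrite opprB addrC subrK.
  exact: ler_normB.
have h3 : `|w| <= `|cexp w - 1| + 2^-1 * `|w| by rewrite (le_trans h2) // lerD2l.
rewrite -(lerD2r (2^-1 * `|w|)) -mulrDl.
by rewrite -mulr2n -[2^-1 *+ 2]mulr_natr mulVf ?pnatr_eq0 // mul1r.
Qed.

(** The analytic input of the whole proof. At a zero z0 one has a = q^z0, so q^z - a is a difference
    of two exponentials and the linear lower bound applies. For a = 0 there are no zeros and the
    condition is void. *)
Lemma qlin_sub_unit (a : C) : qlin q 1 0 - m_cst a \is a GRing.unit.
Proof.
pose L := (ln q)%:C : C.
pose f (z : C) : C := cexp (1 * L * z + 0 * L) - a.
have cexpE (z : C) : cexp (1 * L * z + 0 * L) = cexp (L * z + 0).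
  by rewrite mul1r mul0r.
have df z : derivable (f : C^o -> C^o) z 1.
  apply: (@derivableB C C^o C^o (fun z => cexp (1 * L * z + 0 * L)) (fun=> a) z 1).
    have -> : (fun z => cexp (1 * L * z + 0 * L)) = (@cexp R) \o (fun z => L * z + 0).
      by apply/funext => w /=.
    apply/derivable1_diffP.
    apply: (@differentiable_comp _ C^o C^o C^o (fun z => L * z + 0) (@cexp R)).
      apply/derivable1_diffP.
      apply: (@derivableD C C^o C^o (fun z => L * z) (fun=> 0) z 1).
        exact: (@derivableZ C C^o C^o id L z 1 (@derivable_id C C^o z 1)).
      exact: (@derivable_cst C C^o C^o 0 z 1).
    exact/derivable1_diffP/cexp_derivable.
  exact: (@derivable_cst C C^o C^o a z 1).
have zf z0 : f z0 = 0 -> exists2 K : C, 0 < K &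
    \forall z \near nbhs (z0 : C^o), K * `|z - z0| <= `|f z|.
  move=> fz0; have [K K0 hK] := cexp_linear_lower_bound z0 (lnq_neq0 hq).
  exists K => //; apply: filterS hK => z.
  rewrite -!cexpE /f; have -> // : a = cexp (1 * L * z0 + 0 * L).
  by apply/esym/eqP; rewrite -subr_eq0; apply/eqP.
have mfV := meromorphic_inv df zf.
have mf : meromorphic f.
  rewrite (_ : f = fun z => cexp (1 * L * z + 0 * L) + (- a)) //.
  exact: meromorphicD (cexp_affine_meromorphic _ _) (meromorphic_cst _).
have fE : qlin q 1 0 - m_cst a = to_mero mf.
  rewrite -raddfN [LHS]to_meroD; apply: to_meroE => z0; exact: nearW.
apply/unitrP; exists (to_mero mfV).
suff h : to_mero mfV * to_mero mf = 1 by rewrite fE; split=> //; rewrite mulrC.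
rewrite to_meroM; apply: to_meroE => z0.
by apply: filterS (isolated_zeros df zf z0) => z hz; rewrite mulVf.
Qed.
End LinearFactorUnits.

Section IntegerPowers.
Variables (R : realType) (q : R).
Hypothesis hq : 0 < q < 1.
Notation C := (R[i]).

Lemma qR_neq0 : q%:C != 0 :> C.
Proof.
by rewrite (_ : 0 = 0%:C) // (inj_eq (fmorph_inj _)) gt_eqF //; case/andP: hq.
Qed.

Lemma qlin_int (a b : int) :
  qlin q a%:~R b%:~R = qlin q 1 0 ^ a * qcst q b.
Proof.
have nat_pow (c d : C) n : qlin q (n%:R * c) (n%:R * d) = qlin q c d ^+ n.
  elim: n => [|n ih]; first by rewrite !mul0r qlin00.
  by rewrite exprSr -ih -qlinD -!natr1 !mulrDl !mul1r.
have int_pow (c d : C) (n : int) : qlin q (n%:~R * c) (n%:~R * d) = qlin q c d ^ n.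
  case: n => n; first exact: nat_pow.
  by rewrite NegzE -!exprnN -nat_pow qlinV -!mulNr !mulrNz.
have -> : qlin q a%:~R b%:~R = qlin q a%:~R 0 * qlin q 0 b%:~R.
  by rewrite -qlinD addr0 add0r.
rewrite -[X in qlin q X 0]mulr1 -[X in qlin q _ X](mulr0 (a%:~R)) int_pow.
congr (_ * _); rewrite -[X in qlin q X _](mulr0 (b%:~R)) -[X in qlin q _ X]mulr1.
rewrite int_pow qlin_cst1 // /qcst; case: b => n.
  by rewrite -!exprnP rmorphXn.
by rewrite NegzE -!exprnN -rmorphXn; apply/esym/fmorphV.
Qed.
End IntegerPowers.

(** * The field of rational functions of q^lambda *)

Section RationalSubfield.
Variables (R : realType) (q : R).
Hypothesis hq : 0 < q < 1.
Notation C := (R[i]).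
Notation M := (mero C).

Definition qexp_eval (r : {poly C}) : M :=
  (map_poly (@m_cst C) r).[qlin q 1 0].

Lemma qexp_eval_is_zmod_morphism : zmod_morphism qexp_eval.
Proof. by move=> r s; rewrite /qexp_eval rmorphB hornerD hornerN. Qed.

Lemma qexp_eval_is_monoid_morphism : monoid_morphism qexp_eval.
Proof.
by split=> [|r s]; rewrite /qexp_eval ?rmorph1 ?hornerC // rmorphM hornerM.
Qed.

HB.instance Definition _ := GRing.isZmodMorphism.Build {poly C} M qexp_eval
  qexp_eval_is_zmod_morphism.
HB.instance Definition _ := GRing.isMonoidMorphism.Build {poly C} M qexp_eval
  qexp_eval_is_monoid_morphism.

Lemma qexp_evalC c : qexp_eval c%:P = m_cst c.
Proof. by rewrite /qexp_eval map_polyC hornerC. Qed.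

Lemma qexp_evalX : qexp_eval 'X = qlin q 1 0.
Proof. by rewrite /qexp_eval map_polyX hornerX. Qed.

(** The complex numbers being algebraically closed, r is a nonzero constant times a product of
    factors X - z, each of which evaluates to a unit by [qlin_sub_unit]. *)
Lemma qexp_eval_unit r : r != 0 -> qexp_eval r \is a GRing.unit.
Proof.
move=> r0; have [s ->] := closed_field_poly_normal r.
rewrite -mul_polyC rmorphM /= unitrM; apply/andP; split.
  rewrite qexp_evalC; apply/unitrP; exists (m_cst (lead_coef r)^-1).
  by rewrite -!rmorphM mulVf ?mulfV ?lead_coef_eq0 // rmorph1.
rewrite rmorph_prod /=; elim/big_ind: _ => [|a b ha hb|z _]; first exact: unitr1.
  by rewrite unitrM ha.
by rewrite rmorphB /= qexp_evalX qexp_evalC; apply: qlin_sub_unit.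
Qed.

(** The proof of [0 < q < 1] is an argument so that the predicate determines the closure instances
    below, which depend on it. *)
Definition qrat of (0 < q < 1) : {pred M} := fun a =>
  `[< exists r s : {poly C}, s != 0 /\ a * qexp_eval s = qexp_eval r >].

Lemma qratP a : reflect (exists r s : {poly C}, s != 0 /\
  a * qexp_eval s = qexp_eval r) (a \in qrat hq).
Proof. exact: asboolP. Qed.

Lemma qrat_eval r : qexp_eval r \in qrat hq.
Proof. by apply/qratP; exists r, 1; rewrite oner_neq0 rmorph1 mulr1. Qed.

Lemma qrat_unit a : a \in qrat hq -> a != 0 ->
  a \is a GRing.unit /\ a^-1 \in qrat hq.
Proof.
case/qratP => r [s [s0 e]] a0.
have us := qexp_eval_unit s0.
have r0 : r != 0.
  apply: contraNneq a0 => r0; rewrite r0 rmorph0 in e.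
  by rewrite -(mulrK us a) e mul0r.
have ur := qexp_eval_unit r0.
have ua : a \is a GRing.unit by move: ur; rewrite -e unitrM => /andP[].
split=> //; apply/qratP; exists s, r; split=> //.
by rewrite -e mulKr.
Qed.

Lemma qrat_divring_closed : divring_closed (qrat hq).
Proof.
split=> [|a b|a b].
- by rewrite -(rmorph1 qexp_eval) qrat_eval.
- case/qratP => r [s [s0 e]] /qratP[r' [s' [s0' e']]]; apply/qratP.
  exists (r * s' - r' * s), (s * s'); rewrite mulf_neq0 //; split=> //.
  by rewrite rmorphB !rmorphM /= -e -e'; ring.
move=> ha hb; have [->|b0] := eqVneq b 0.
  by rewrite invr0 mulr0 -(rmorph0 qexp_eval) qrat_eval.
have [_ hbV] := qrat_unit hb b0.
case/qratP: ha => r [s [s0 e]]; case/qratP: hbV => r' [s' [s0' e']]; apply/qratP.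
exists (r * r'), (s * s'); rewrite mulf_neq0 //; split=> //.
by rewrite !rmorphM /= -e -e'; ring.
Qed.

HB.instance Definition _ := GRing.isDivringClosed.Build M (qrat hq)
  qrat_divring_closed.

(* The rational functions of q^lambda: unlike [mero], this ring is visibly a field. *)
Record qfun := QFun { qval :> M; qvalP : qval \in qrat hq }.
HB.instance Definition _ := [isSub for qval].
HB.instance Definition _ := [Choice of qfun by <:].
HB.instance Definition _ := [SubChoice_isSubComUnitRing of qfun by <:].

Lemma qfun_field (x : qfun) : x != 0 -> x \is a GRing.unit.
Proof.
move=> x0.
have v0 : qval x != 0 by apply: contraNneq x0 => e; apply/eqP/val_inj.
have [u hV] := qrat_unit (qvalP x) v0.
apply/unitrP; exists (QFun hV); split; apply: val_inj; rewrite /= ?rmorphM /=.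
  exact: mulVr.
exact: mulrV.
Qed.
HB.instance Definition _ := GRing.ComUnitRing_isField.Build qfun qfun_field.

HB.instance Definition _ := GRing.RMorphism.copy qval (val : qfun -> M).

(** The shift by n multiplies q^lambda by q^n, so it acts on polynomials by composition with q^n X.
    This has degree one, hence nonzero denominators stay nonzero. *)
Lemma qrat_shift (n : int) a : a \in qrat hq -> m_shift n%:~R a \in qrat hq.
Proof.
case/qratP => r [s [s0 e]]; apply/qratP.
have q0 : q%:C ^ n != 0 :> C by rewrite expfz_neq0 // qR_neq0.
pose t : {poly C} := q%:C ^ n *: 'X.
have sh u : m_shift n%:~R (qexp_eval u) = qexp_eval (u \Po t).
  elim/poly_ind: u => [|u c ih]; first by rewrite comp_poly0 !rmorph0.
  rewrite comp_poly_MXaddC !rmorphD !rmorphM /= ih qexp_evalX !qexp_evalC.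
  rewrite m_shift_cst /t -mul_polyC rmorphM /= qexp_evalC qexp_evalX.
  rewrite qlin_shift add0r mul1r [qlin q 1 _](qlin_int hq 1 n) expr1z /qcst.
  by congr (_ + _); ring.
exists (r \Po t), (s \Po t); split; last by rewrite -!sh -rmorphM e.
rewrite comp_poly2_eq0 // /t size_scale ?size_polyX //.
Qed.

Definition qshift (n : int) (x : qfun) : qfun := QFun (qrat_shift n (qvalP x)).

Lemma qshift_is_zmod_morphism n : zmod_morphism (qshift n).
Proof. by move=> x y; apply: val_inj; rewrite /= !rmorphB. Qed.

Lemma qshift_is_monoid_morphism n : monoid_morphism (qshift n).
Proof.
split=> [|x y]; apply: val_inj; first by rewrite /= !rmorph1.
by rewrite /= !rmorphM.
Qed.

HB.instance Definition _ n := GRing.isZmodMorphism.Build qfun qfun (qshift n)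
  (qshift_is_zmod_morphism n).
HB.instance Definition _ n := GRing.isMonoidMorphism.Build qfun qfun (qshift n)
  (qshift_is_monoid_morphism n).

Lemma qlin_qrat : qlin q 1 0 \in qrat hq.
Proof. by rewrite -qexp_evalX qrat_eval. Qed.

Lemma qcst_qrat : qcst q 1 \in qrat hq.
Proof. by rewrite /qcst -qexp_evalC qrat_eval. Qed.

Definition vK : qfun := QFun qlin_qrat.
Definition qK : qfun := QFun qcst_qrat.

Lemma vK_neq0 : vK != 0.
Proof.
apply/eqP => /(congr1 qval) /= e; have := qlin_unit q 1 0.
by rewrite e unitr0.
Qed.

Lemma qK_neq0 : qK != 0.
Proof.
apply/eqP => /(congr1 qval) /= /eqP; rewrite /qcst expr1z.
by rewrite fmorph_eq0 (negPf (qR_neq0 hq)).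
Qed.

Lemma qval_qK (n : int) : qval (qK ^ n) = qcst q n.
Proof. by rewrite fmorphXz /= /qcst expr1z -fmorphXz. Qed.

Lemma qval_qlin (a b : int) : qval (vK ^ a * qK ^ b) = qlin q a%:~R b%:~R.
Proof. by rewrite rmorphM /= qval_qK fmorphXz qlin_int. Qed.

Lemma qK_pow_neq1 (n : int) : n != 0 -> qK ^ n != 1.
Proof.
have nat_neq1 m : qK ^+ m.+1 != 1.
  apply/eqP => /(congr1 qval); have := qval_qK m.+1; rewrite -exprnP => ->.
  rewrite /qcst -exprnP rmorph1 => /eqP; rewrite -subr_eq0 -(rmorph1 (@m_cst C)).
  rewrite -rmorphB fmorph_eq0 subr_eq0 -rmorphXn -(rmorph1 (real_complex R)).
  rewrite (inj_eq (fmorph_inj _)) lt_eqF //; case/andP: hq => q0 q1.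
  by rewrite exprn_ilt1 // ltW.
case: n => [[|m]|m] // _; first by rewrite -exprnP.
by rewrite NegzE -exprnN invr_eq1.
Qed.

Lemma qshift_vK n : qshift n vK = qK ^ n * vK.
Proof.
apply: val_inj; rewrite /= qlin_shift add0r mul1r [qlin q 1 _](qlin_int hq 1 n).
by rewrite -[RHS]/(qval (qK ^ n) * qlin q 1 0) qval_qK expr1z mulrC.
Qed.

Lemma qshift_qK n : qshift n qK = qK.
Proof. by apply: val_inj; rewrite /= /qcst m_shift_cst. Qed.

(** The shift by 1 fixes 1 but multiplies the left side by q^a, and q^a differs from 1. *)
Lemma vK_qK_neq1 (a b : int) : a != 0 -> vK ^ a * qK ^ b != 1.
Proof.
move=> a0; apply/eqP => e; have := congr1 (qshift 1) e.
rewrite rmorphM rmorph1 /= !fmorphXz /= qshift_vK qshift_qK expr1z exprMz_comm.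
  by rewrite -mulrA e mulr1 => /eqP; rewrite (negPf (qK_pow_neq1 a0)).
all: by rewrite ?unitfE ?qK_neq0 ?vK_neq0 //; apply: mulrC.
Qed.
End RationalSubfield.

(** * Basic hypergeometric series *)

Section Morphisms.
Variables (F S : comUnitRingType) (f : {rmorphism F -> S}).

Lemma rmorph_qpoch a p n : f (qpoch a p n) = qpoch (f a) (f p) n.
Proof.
rewrite /qpoch rmorph_prod; apply: eq_bigr => i _.
by rewrite rmorphB rmorph1 rmorphM rmorphXn.
Qed.
End Morphisms.

Section QSeries.
Variables (F : fieldType) (p : F).
Hypothesis p0 : p != 0.
Hypothesis pn : forall n, 1 - p ^+ n.+1 != 0.
Notation qp a n := (qpoch a p n).

Lemma qpoch0 a : qp a 0 = 1.
Proof. by rewrite /qpoch big_ord0. Qed.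

Lemma qpochS a n : qp a n.+1 = qp a n * (1 - a * p ^+ n).
Proof. by rewrite /qpoch big_ord_recr. Qed.

Lemma qpoch_cat a m n : qp a (m + n) = qp a m * qp (a * p ^+ m) n.
Proof.
elim: n => [|n ih]; first by rewrite addn0 qpoch0 mulr1.
by rewrite addnS !qpochS ih -!mulrA -exprD.
Qed.

Lemma phi43_0 m a b c d e z : phi43 0 m a b c d e p z = 1.
Proof. by rewrite /phi43 min0n big_ord1 !qpoch0 !mulr1 divr1. Qed.

Lemma qpoch_recl a n : qp a n.+1 = (1 - a) * qp (a * p) n.
Proof.
rewrite /qpoch big_ord_recl expr0 mulr1; congr (_ * _).
by apply: eq_bigr => i _; rewrite exprS mulrA.
Qed.

Lemma qpoch_shift a n : 1 - a != 0 -> qp (a * p) n = qp a n * (1 - a * p ^+ n) / (1 - a).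
Proof. by move=> a1; rewrite -qpochS qpoch_recl mulrAC divff // mul1r. Qed.

Lemma qpoch_neq0 a n : (forall i, (i < n)%N -> 1 - a * p ^+ i != 0) -> qp a n != 0.
Proof. by move=> h; apply/prodf_neq0 => -[i iN] _; apply: h. Qed.

Lemma qpoch_pp_neq0 n : qp p n != 0.
Proof. by apply: qpoch_neq0 => i _; rewrite -exprS pn. Qed.

Lemma qpoch_vanish k n : (k < n)%N -> qp (p ^- k) n = 0.
Proof.
move=> kn; rewrite /qpoch (bigD1 (Ordinal kn)) //=.
by rewrite mulVf ?expf_neq0 // subrr mul0r.
Qed.

(** * The contiguous relation for balanced series *)

Section Contiguous.
Variables (k : nat) (a b c d e f : F).
(** The balancing condition efg = abcdp. Multiplying a and one of e, f by p preserves it, so the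
    three series of the relation share g. *)
Let g := a * b * c * d * p / (e * f).
Hypotheses (a1 : 1 - a != 0) (e0 : e != 0) (f0 : f != 0).
Hypothesis fe : f - e != 0.
Hypothesis bcdef : b * c * d - e * f != 0.
(** Bounded by k because the relation is applied with e = p^(-L-1) and k <= L, where the factor
    vanishes at n = L + 1. *)
Hypothesis en : forall n, (n <= k)%N -> 1 - e * p ^+ n != 0.
Hypothesis fn : forall n, 1 - f * p ^+ n != 0.
Hypothesis gn : forall n, 1 - g * p ^+ n != 0.

(** Exchanging e and f exchanges [A] with [B], as it does the two series that they multiply; each is
    symmetric in b, c, d. *)
Let A := f * (e - b) * (c - e) * (d - e) / ((e - 1) * (b * c * d - e * f) * (f - e)).
Let B := e * (f - b) * (c - f) * (d - f) / ((f - 1) * (b * c * d - e * f) * (e - f)).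

Let T a' e' f' n := qp a' n * qp b n * qp c n * qp d n /
  (qp p n * qp e' n * qp f' n * qp g n) * p ^+ n.
(* The telescoping certificate of the contiguous relation *)
Let G n := (1 - b * c * d / (e * f))^-1 * T a e f n * (1 - p ^+ n) *
  (1 - g * p ^+ n / p) / p ^+ n / (1 - a).

(** Shifted symbols such as (ep;p)_n are brought back to (e;p)_n. After division by the common
    Pochhammer symbols there remains an identity of rational functions in the parameters and X =
    p^n. *)
Lemma contiguous_step n : (n <= k)%N ->
  T a e f n = A * T (a * p) (e * p) f n + B * T (a * p) e (f * p) n +
    (G n.+1 - G n).
Proof.
move=> nk; have e1 : 1 - e != 0 by have := @en 0 isT; rewrite mulr1.
have f1 : 1 - f != 0 by have := fn 0; rewrite mulr1.
have qe : qp e n != 0 by apply: qpoch_neq0 => i ik; apply: en; lia.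
have qf : qp f n != 0 by apply: qpoch_neq0.
have qg : qp g n != 0 by apply: qpoch_neq0.
have qpp := qpoch_pp_neq0 n.
have en' := en nk; have fn' := fn n; have gn' := gn n; have pn' := pn n.
rewrite /G /T !qpochS !qpoch_shift //.
rewrite exprS in pn' *; have X0 : p ^+ n != 0 by rewrite expf_neq0.
move: (p ^+ n) X0 pn' gn' fn' en' => X X0 pn' gn' fn' en'.
move: (qp e n) (qp f n) (qp g n) (qp p n) qe qf qg qpp => E1 F1 G1 P1 qe qf qg qpp.
move: (qp a n) (qp b n) (qp c n) (qp d n) => a2 b2 c2 d2.
have [e1' f1'] : e - 1 != 0 /\ f - 1 != 0.
  by rewrite -[e - 1]opprB -[f - 1]opprB !oppr_eq0.
have [ef bcdef'] : e - f != 0 /\ e * f - b * c * d != 0.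
  by rewrite -[e - f]opprB -[e * f - _]opprB !oppr_eq0.
have gn2 : e * f - a * b * c * d * p * X != 0.
  have -> : e * f - a * b * c * d * p * X = (1 - g * X) * (e * f).
    by rewrite /g; field; rewrite e0 f0.
  by rewrite !mulf_neq0.
rewrite /A /B /g; field.
by rewrite a1 X0 p0 f0 e0 qg qf qe qpp bcdef' gn2 fn' en' pn' f1 ef bcdef f1' e1 fe e1'.
Qed.

Lemma contiguous_sum N : (N <= k.+1)%N ->
  \sum_(n < N) T a e f n = A * (\sum_(n < N) T (a * p) (e * p) f n) +
    B * (\sum_(n < N) T (a * p) e (f * p) n) + G N.
Proof.
elim: N => [_|N ih Nk].
  by rewrite !big_ord0 /G expr0 subrr !(mulr0, mul0r) !addr0.
rewrite !big_ord_recr /= ih ?(ltnW Nk) // contiguous_step //; ring.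
Qed.
End Contiguous.

(** The boundary value of the telescoping sum disappears in two ways. If m <= k, all sums have m + 1
    terms and G (m + 1) contains (p^-m;p)_(m+1) = 0. Otherwise the left sum has the additional term
    n = k + 1, which cancels G (k + 1) because a = p^(-k-1). *)
Lemma phi43_contiguous (k m : nat) (c d e f : F) :
  let b := p ^- m in let g := p ^- k.+1 * b * c * d * p / (e * f) in
  e != 0 -> f != 0 -> f - e != 0 ->
  b * c * d - e * f != 0 -> (forall n, (n <= k)%N -> 1 - e * p ^+ n != 0) ->
  (forall n, 1 - f * p ^+ n != 0) -> (forall n, 1 - g * p ^+ n != 0) ->
  phi43 k.+1 m c d e f g p p =
    f * (e - b) * (c - e) * (d - e) / ((e - 1) * (b * c * d - e * f) * (f - e))
      * phi43 k m c d (e * p) f g p p +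
    e * (f - b) * (c - f) * (d - f) / ((f - 1) * (b * c * d - e * f) * (e - f))
      * phi43 k m c d e (f * p) g p p.
Proof.
move=> b g e0 f0 fe bcdef en fn gn.
have a0 : p ^- k.+1 != 0 by rewrite invr_eq0 expf_neq0.
have a1 : 1 - p ^- k.+1 != 0.
  by rewrite subr_eq0 eq_sym invr_eq1 eq_sym -subr_eq0.
have ap : p ^- k.+1 * p = p ^- k by rewrite exprS; field; rewrite p0 expf_neq0.
have main := contiguous_sum a1 e0 f0 fe bcdef en fn gn.
rewrite /phi43 -/b.
have [mk|km] := leqP m k.
  have -> : minn k.+1 m = m by lia.
  have := main m.+1 mk; rewrite /= ap => ->.
  by rewrite (qpoch_vanish (ltnSn m)) !(mulr0, mul0r) addr0.
have -> : minn k.+1 m = k.+1 by lia.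
rewrite big_ord_recr /=; have := main k.+1 (leqnn _); rewrite /= ap => ->.
rewrite -addrA [X in _ + X](_ : _ = 0) ?addr0 // -/g.
set t := _ / (qp p k.+1 * qp e k.+1 * qp f k.+1 * qp g k.+1).
rewrite /g; move: (p ^+ k.+1) a0 a1 (pn k) => X X0 X1 X2; field.
have X0' : X != 0 by rewrite -invr_eq0.
rewrite X0' p0 e0 f0 -[X - 1]opprB oppr_eq0 X2 /=.
by rewrite -[e * f - _]opprB oppr_eq0.
Qed.

End QSeries.

(** * Quotients of neighbouring product factors *)

Section CoreRatios.
Variables (F : fieldType) (p : F).
Hypothesis pn : forall n, 1 - p ^+ n.+1 != 0.
Notation qp a n := (qpoch a p n).

(* The q-Pochhammer factors of the pairing formula, for u = q^(2 lambda + 2),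
   x = q^(2 (lambda + 1 - L)) and z = q^(2 (lambda + 1 + M + N - 2 L)) *)
Definition qcore L a b j l c d u x z : F :=
  qp p L * qp p a * qp p b / (qp p j * qp p l * qp p c * qp p d) *
  (1 / (1 - u)) * (qp x a * qp x b / (qp x j * qp x l)) *
  (qp z L.+1 / (qp (u * p) a * qp (u * p) b)).

Variables (u x z : F).
Hypothesis xn : forall n, 1 - x * p ^+ n != 0.
Hypothesis zn : forall n, 1 - z * p ^+ n != 0.
Hypothesis un : forall n, 1 - u * p ^+ n != 0.

Let qx n : qp x n != 0. Proof. by apply: qpoch_neq0. Qed.
Let qz n : qp z n != 0. Proof. by apply: qpoch_neq0. Qed.
Let qup n : qp (u * p) n != 0.
Proof. by apply: qpoch_neq0 => i _; rewrite -mulrA -exprS. Qed.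
Let qu n : qp u n != 0. Proof. by apply: qpoch_neq0. Qed.
Let qpp n : qp p n != 0. Proof. exact: qpoch_pp_neq0. Qed.
Let x1 : 1 - x != 0. Proof. by have := xn 0; rewrite mulr1. Qed.
Let z1 : 1 - z != 0. Proof. by have := zn 0; rewrite mulr1. Qed.
Let u1 : 1 - u != 0. Proof. by have := un 0; rewrite mulr1. Qed.
Let up1 : 1 - u * p != 0. Proof. exact: (un 1). Qed.

(** Each of the four ratios is named after the generator split off in the recurrence that uses it.
    For alpha and beta the powers of p in x and z come from the changes of L and M. For delta and
    gamma they come from the shift of lambda by 1, which multiplies u and x by p, while the change
    of M compensates it in z. *)
Lemma core_alpha L a b j l c d :
  qcore L a b j l c d u (x * p) (z * p) = qcore L.+1 a b j.+1 l c d u x z *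
  ((1 - p ^+ j.+1) * (1 - x * p ^+ a) * (1 - x * p ^+ b) /
   ((1 - p ^+ L.+1) * (1 - x * p ^+ l) * (1 - z))).
Proof.
rewrite /qcore [qp z L.+2]qpoch_recl !qpoch_shift // [qp p L.+1]qpochS [qp p j.+1]qpochS.
rewrite [qp x j.+1]qpochS.
rewrite !exprS; field.
by rewrite -?(mulrA u) -?exprS ?xn ?zn ?un ?pn ?qx ?qz ?qu ?qup ?qpp ?x1 ?z1 ?u1 ?up1.
Qed.

Lemma core_beta L a b j l c d :
  qcore L a b j l.+1 c d u x z = qcore L a b j l c.+1 d.+1 u x (z * p) *
  ((1 - p ^+ c.+1) * (1 - p ^+ d.+1) * (1 - z) /
   ((1 - p ^+ l.+1) * (1 - x * p ^+ l) * (1 - z * p ^+ L.+1))).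
Proof.
rewrite /qcore !qpoch_shift // [qp p l.+1]qpochS [qp p c.+1]qpochS [qp p d.+1]qpochS.
rewrite [qp x l.+1]qpochS.
rewrite !exprS; field.
by rewrite -?(mulrA u) -?exprS ?xn ?zn ?un ?pn ?qx ?qz ?qu ?qup ?qpp ?x1 ?z1 ?u1 ?up1.
Qed.

Lemma core_delta L a b j l c d :
  qcore L a b j l c d (u * p) (x * p) z = qcore L a.+1 b j l c.+1 d u x z *
  ((1 - p ^+ c.+1) * (1 - x * p ^+ b) * (1 - u) * (1 - u * p) /
   ((1 - p ^+ a.+1) * (1 - x * p ^+ j) * (1 - x * p ^+ l) * (1 - u * p ^+ b.+1))).
Proof.
rewrite /qcore [qp (u * p * p) a]qpoch_shift // [qp (u * p * p) b]qpoch_shift //.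
rewrite !(@qpoch_shift F p x) // [qp (u * p) a.+1]qpochS [qp p a.+1]qpochS [qp p c.+1]qpochS.
rewrite [qp x a.+1]qpochS.
rewrite !exprS; field.
by rewrite -?(mulrA u) -?exprS ?xn ?zn ?un ?pn ?qx ?qz ?qu ?qup ?qpp ?x1 ?z1 ?u1 ?up1.
Qed.

Lemma core_gamma L a b j l c d :
  qcore L a b j l c d (u * p) (x * p) z = qcore L a.+1 b.+1 j.+1 l c d u x z *
  ((1 - p ^+ j.+1) * (1 - u) * (1 - u * p) /
   ((1 - p ^+ a.+1) * (1 - p ^+ b.+1) * (1 - x * p ^+ l))).
Proof.
rewrite /qcore [qp (u * p * p) a]qpoch_shift // [qp (u * p * p) b]qpoch_shift //.
rewrite !(@qpoch_shift F p x) // [qp (u * p) a.+1]qpochS [qp (u * p) b.+1]qpochS.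
rewrite [qp p a.+1]qpochS [qp p b.+1]qpochS [qp p j.+1]qpochS.
rewrite [qp x a.+1]qpochS [qp x b.+1]qpochS [qp x j.+1]qpochS.
rewrite !exprS; field.
by rewrite -?(mulrA u) -?exprS ?xn ?zn ?un ?pn ?qx ?qz ?qu ?qup ?qpp ?x1 ?z1 ?u1 ?up1.
Qed.
End CoreRatios.

(* [ring] and [field] do not cope with integer powers. *)
Ltac abstract_exprz :=
  repeat match goal with |- context [@exprz ?T ?x ?n] =>
    generalize (@exprz T x n); intro end.

(* [Q] and [v] stand for q and q^lambda, and [sh n] for the shift of lambda by [n]. *)
Record dynamical_parameters (K : fieldType) (Q v : K)
    (sh : int -> {rmorphism K -> K}) : Prop := {
  dyn_Q_neq0 : Q != 0;
  dyn_v_neq0 : v != 0;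
  dyn_Q_neq1 : forall n : int, n != 0 -> Q ^ n != 1;
  dyn_v_neq1 : forall n : int, v ^+ 2 * Q ^ (2 * n) != 1;
  dyn_sh_Q : forall n, sh n Q = Q;
  dyn_sh_v : forall n, sh n v = Q ^ n * v }.

(** * Coefficient identities *)

Section CoefficientDefinitions.
Variables (K : fieldType) (Q v : K).

(* q^(2 lambda + 2 n) *)
Fact pw_key : unit. Proof. exact: tt. Qed.
Definition pw (n : int) : K := locked_with pw_key (v ^+ 2 * Q ^ (2 * n)).

(* alpha gamma^n = ag_coef n(lambda) gamma^n alpha and
   alpha^n gamma = ga_coef n(lambda) gamma alpha^n *)
Definition ag_coef (n : nat) : K :=
  Q ^ (- n%:Z) * (pw (1 + n%:Z) - 1) / (pw 1 - 1).

Definition ga_coef (n : nat) : K :=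
  Q ^ (- n%:Z) * (pw 2 - 1) / (pw (2 - n%:Z) - 1).

(* [gamma_coef] and [beta_coef] are [ag_coef] and [ga_coef], shifted by the degree of
   a coefficient that crosses the balanced tensor product; see [tmat]. *)
Definition gamma_coef (N l : nat) : K :=
  Q ^ (l%:Z - N%:Z - 1) * (pw (1 + l%:Z) - 1) / (pw (2 * l%:Z - N%:Z) - 1).

Definition beta_coef (l : nat) : K :=
  Q ^ (- l%:Z) * (pw (1 + l%:Z) - 1) / (pw 1 - 1).

Definition beta_beta : K := (Q - Q^-1) / (v - v^-1).
Definition gamma_gamma : K := (Q^-1 - Q) / (Q ^+ 2 * v - Q ^- 2 / v).
Definition delta_delta : K := (pw 1 - 1) * (pw 3 - 1) / (pw 2 - 1) ^+ 2.

(* Closed forms of the coefficients of <beta, t^N_{l+1,l}>, <gamma, t^N_{m,m+1}> and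
   <delta, t^N_{m,m}> *)
Definition be_tmat (N l : nat) : K :=
  v * Q ^ (N%:Z - 3 * l%:Z - 2) * (Q ^ (2 * (1 + l%:Z)) - 1) /
  (pw (N%:Z - 2 * l%:Z - 1) - 1).

Definition ga_tmat (N m : nat) : K :=
  - v * Q ^ (2 + m%:Z - N%:Z) * (1 - Q ^ (2 * (N%:Z - m%:Z))) / (1 - pw 2).

Definition de_tmat (N m : nat) : K :=
  (pw (1 - m%:Z) - 1) * (pw (N%:Z - m%:Z + 2) - 1) /
  ((pw 2 - 1) * (pw (N%:Z - 2 * m%:Z + 1) - 1)).

End CoefficientDefinitions.

(** Supplies side conditions of [field]: a is a denominator cleared of negative powers, b the form
    known to be nonzero, and u the monomial between them. *)
Lemma neq0_factor (F : fieldType) (a b u : F) : b != 0 -> b = a * u -> a != 0.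
Proof. by move=> b0 e; apply: contraNneq b0 => a0; rewrite e a0 mul0r. Qed.

Section CoefficientIdentities.
Variables (K : fieldType) (Q v : K) (sh : int -> {rmorphism K -> K}).
Hypothesis hQ : dynamical_parameters Q v sh.
Notation pw := (pw Q v).
Notation ag_coef := (ag_coef Q v).
Notation ga_coef := (ga_coef Q v).
Notation gamma_coef := (gamma_coef Q v).
Notation beta_coef := (beta_coef Q v).
Notation beta_beta := (beta_beta Q v).
Notation gamma_gamma := (gamma_gamma Q v).
Notation delta_delta := (delta_delta Q v).
Notation be_tmat := (be_tmat Q v).
Notation ga_tmat := (ga_tmat Q v).
Notation de_tmat := (de_tmat Q v).

Let Q_neq0 : Q != 0 := dyn_Q_neq0 hQ.
Let v_neq0 : v != 0 := dyn_v_neq0 hQ.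
Let shQ n : sh n Q = Q := dyn_sh_Q hQ n.
Let shv n : sh n v = Q ^ n * v := dyn_sh_v hQ n.

Lemma Qpow_neq0 n : Q ^ n != 0.
Proof. by rewrite expfz_neq0. Qed.

Lemma QpowD m n : Q ^ (m + n) = Q ^ m * Q ^ n.
Proof. exact: expfzDr. Qed.

Lemma QpowN n : Q ^ (- n) = (Q ^ n)^-1.
Proof. by rewrite invr_expz. Qed.

Lemma Qpow2 n : Q ^ (2 * n) = (Q ^ n) ^+ 2.
Proof. by rewrite mulrC -exprz_exp. Qed.

Lemma Qpow3 n : Q ^ (3 * n) = (Q ^ n) ^+ 3.
Proof. by rewrite mulrC -exprz_exp. Qed.

Lemma QpowS (n : nat) : Q ^ n.+1 = Q * Q ^ n.
Proof. by rewrite exprSz. Qed.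

Lemma pwE n : pw n = v ^+ 2 * Q ^ (2 * n).
Proof. by rewrite /pw unlock. Qed.

Lemma pw_sqr n : pw n = (v * Q ^ n) ^+ 2.
Proof. by rewrite pwE Qpow2 exprMn. Qed.

(** Breaks integer exponents into powers of single variables, which [abstract_exprz] then replaces
    by atoms. *)
Definition QpowE := (pw_sqr, Qpow2, Qpow3, QpowD, QpowN, QpowS, expr1z, expr0z).

Lemma sh_pw m n : sh m (pw n) = pw (m + n).
Proof.
rewrite !pwE rmorphM rmorphXn fmorphXz /= shQ shv.
rewrite (_ : 2 * (m + n) = m + m + 2 * n); last by ring.
by rewrite !QpowD; ring.
Qed.

Lemma pw_neq1 n : pw n - 1 != 0.
Proof. by rewrite subr_eq0 pwE (dyn_v_neq1 hQ). Qed.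

Ltac push_sh :=
  rewrite ?(fmorphXz, rmorphM, rmorphD, rmorphN, rmorph1, fmorphV, rmorphXn) /=
    ?shQ ?shv ?sh_pw.

Lemma ag_coef0 : ag_coef 0 = 1.
Proof. by rewrite /ag_coef expr0z mul1r divff ?pw_neq1. Qed.

Lemma ga_coef0 : ga_coef 0 = 1.
Proof. by rewrite /ga_coef expr0z mul1r subr0 divff ?pw_neq1. Qed.

Lemma ag_coef1 : ag_coef 1 = Q^-1 * (pw 2 - 1) / (pw 1 - 1).
Proof. by []. Qed.

Lemma QpowNS (n : nat) : Q ^ (- n.+1%:Z) = Q^-1 * Q ^ (- n%:Z).
Proof. by rewrite -[Q^-1]/(Q ^ (-1)) -QpowD; congr (Q ^ _); lia. Qed.

Lemma pwS n : pw (n + 1) = pw n * Q ^+ 2.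
Proof. by rewrite !pw_sqr QpowD expr1z; ring. Qed.

Lemma ag_coef1_det : Q ^ 1 * ((pw 1 - Q ^ (-2)) / (pw 1 - 1)) = ag_coef 1.
Proof.
rewrite ag_coef1 (pwS 1) -[Q ^ (-2)]/((Q ^+ 2)^-1) expr1z; field.
by rewrite Q_neq0 pw_neq1.
Qed.

Lemma delta_deltaE :
  sh 1 ((pw 1 - Q ^ 2) * (pw 1 - Q ^ (-2)) / (pw 1 - 1) ^+ 2) = delta_delta.
Proof.
have -> : Q ^ (-2) = (Q ^+ 2)^-1 by [].
have -> : Q ^ 2 = Q ^+ 2 by [].
rewrite !(rmorphM, rmorphB, rmorphXn, fmorphV, rmorph1) /= shQ sh_pw.
rewrite /delta_delta (pwS 2) (pwS 1); have := pw_neq1 2; rewrite (pwS 1).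
by move=> h; field; rewrite h Q_neq0.
Qed.

Lemma ag_coefS n : ag_coef 1 * sh 1 (ag_coef n) = ag_coef n.+1.
Proof.
have h2 := pw_neq1 2; have h1 := pw_neq1 1.
rewrite ag_coef1 /ag_coef QpowNS; push_sh; rewrite -[pw (1 + 1)]/(pw 2).
rewrite (_ : 1 + (1 + n%:Z) = 1 + n.+1%:Z) //.
by abstract_exprz; field; rewrite ?(h1, h2, Q_neq0).
Qed.

Lemma ga_coefS (n : nat) : sh (- n%:Z) (ag_coef 1) * ga_coef n = ga_coef n.+1.
Proof.
rewrite ag_coef1 /ga_coef QpowNS; push_sh.
rewrite (_ : - n%:Z + 2 = 2 - n%:Z); last by lia.
rewrite (_ : - n%:Z + 1 = 2 - n.+1%:Z); last by lia.
by abstract_exprz; field; rewrite ?(pw_neq1, Q_neq0).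
Qed.

Lemma gamma_coefE (N l : nat) : (l <= N)%N ->
  sh (1 + (2 * l%:Z - N%:Z)) (ag_coef (N - l)) = gamma_coef N l.+1.
Proof.
move=> lN; rewrite /ag_coef; push_sh; rewrite /gamma_coef.
by congr (Q ^ _ * (pw _ - 1) / (pw _ - 1)); lia.
Qed.

Lemma beta_coefE (N l : nat) : (l <= N)%N ->
  sh (2 * l%:Z - N%:Z - 1) (sh (N - l)%N (ga_coef l)) = beta_coef l.
Proof.
move=> lN; rewrite /ga_coef; push_sh; rewrite /beta_coef.
by congr (Q ^ _ * (pw _ - 1) / (pw _ - 1)); lia.
Qed.

(** The six identities from here to [de_tmatS] are the induction steps in N for the pairings of
    beta, gamma and delta with matrix elements. *)
Lemma be_tmat0 N : be_tmat N.+1 0 = sh N%:Z (beta_beta).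
Proof.
rewrite /be_tmat /beta_beta; push_sh; rewrite !mulr0 !subr0.
have -> : N.+1%:Z - 1 = N%:Z by lia.
have -> : N.+1%:Z - 2 = N%:Z - 1 by lia.
have := pw_neq1 N; have := Qpow_neq0 N; rewrite !QpowE !mulr1.
have := Q_neq0; have := v_neq0; abstract_exprz => v0 Q0 x0 h; field; rewrite v0 x0 Q0 /=.
by rewrite (neq0_factor (u := 1) h) //; ring.
Qed.

Lemma be_tmatS N l : be_tmat N.+1 l.+1 = be_tmat N l +
  sh (N%:Z - 2 * l.+1%:Z) (beta_beta * beta_coef l.+1).
Proof.
rewrite /be_tmat /beta_coef /beta_beta; push_sh; rewrite !QpowE !mulr1.
have := pw_neq1 (N%:Z - 2 * l%:Z - 1).
have := pw_neq1 (N%:Z - 2 * l%:Z - 2); rewrite !QpowE ?mulr1.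
have := Q_neq0; have := v_neq0; have := Qpow_neq0 N; have := Qpow_neq0 l.
abstract_exprz => y0 y1 v0 Q0 h1 h2; field.
rewrite y0 y1 v0 Q0 (neq0_factor (u := (s ^+ 2 * Q) ^- 2) h2) /=; last first.
  by field; rewrite y0 Q0.
rewrite (neq0_factor (u := (s * Q) ^- 4) h1) //.
by field; rewrite y0 Q0.
Qed.

Lemma ga_tmat0 N : ga_tmat N.+1 0 =
  delta_delta * sh 1 (ga_tmat N 0) +
  gamma_gamma * sh N%:Z (gamma_coef N 1).
Proof.
rewrite /ga_tmat /delta_delta /gamma_gamma /gamma_coef; push_sh.
have := pw_neq1 2; have := pw_neq1 3; rewrite !QpowE ?mulr1.
have := Q_neq0; have := v_neq0; have := Qpow_neq0 N.
abstract_exprz => y0 v0 Q0 h1 h2.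
have h1' := h1; have h2' := h2; rewrite -oppr_eq0 opprB in h1'.
rewrite -oppr_eq0 opprB in h2'; field.
by rewrite y0 v0 Q0 h2 oner_neq0 h1'.
Qed.

Lemma de_tmat0 N : de_tmat N.+1 0 = delta_delta * sh 1 (de_tmat N 0).
Proof.
rewrite /de_tmat /delta_delta; push_sh.
have := pw_neq1 2; have := pw_neq1 3;  rewrite !QpowE ?mulr1.
have := Q_neq0; have := v_neq0; have := Qpow_neq0 N.
have := pw_neq1 (N.+1%:Z + 1); rewrite !QpowE ?mulr1.
abstract_exprz => h3 y0 v0 Q0 h1 h2.
by field; rewrite h1 h2 h3 oner_neq0.
Qed.

Lemma ga_tmatS N m : ga_tmat N.+1 m.+1 = ga_tmat N m.
Proof.
rewrite /ga_tmat; congr (_ * Q ^ _ * (1 - Q ^ _) / _); lia.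
Qed.

Lemma de_tmatS N m : de_tmat N.+1 m.+1 = de_tmat N m +
  ga_tmat N m * sh (N%:Z - 2 * m%:Z) (beta_beta * beta_coef m.+1).
Proof.
rewrite /ga_tmat /de_tmat /beta_coef /beta_beta; push_sh.
have := pw_neq1 2; have := pw_neq1 3;  rewrite !QpowE ?mulr1.
have := Q_neq0; have := v_neq0; have := Qpow_neq0 N; have := Qpow_neq0 m.
have := pw_neq1 (N%:Z - 2 * m%:Z + 1).
have := pw_neq1 (N%:Z - 2 * m%:Z); rewrite !QpowE ?mulr1.
abstract_exprz => h3 h4 y0 y1 v0 Q0 h1 h2.
have h2' := h2; rewrite -oppr_eq0 opprB in h2'.
field; rewrite y0 y1 v0 Q0 h2 h2' (neq0_factor (u := s0 ^- 4) h4) /=; last first.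
  by field.
by rewrite (neq0_factor (u := s0 ^- 4) h3) //; field.
Qed.

End CoefficientIdentities.

(** * The closed formula and its recurrences *)

Section ClosedForm.
Variables (K : fieldType) (Q v : K) (sh : int -> {rmorphism K -> K}).
Hypothesis hQ : dynamical_parameters Q v sh.
Notation pw := (pw Q v).
Notation gamma_coef := (gamma_coef Q v).
Notation beta_coef := (beta_coef Q v).
Notation be_tmat := (be_tmat Q v).
Notation ga_tmat := (ga_tmat Q v).
Notation de_tmat := (de_tmat Q v).
Notation QpowE := (QpowE hQ).
Notation pw_neq1 := (pw_neq1 hQ).
Notation Qpow_neq0 := (Qpow_neq0 hQ).
Notation QpowD := (QpowD hQ).
Notation sh_pw := (sh_pw hQ).

Let Q_neq0 : Q != 0 := dyn_Q_neq0 hQ.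
Let v_neq0 : v != 0 := dyn_v_neq0 hQ.
Let shQ n : sh n Q = Q := dyn_sh_Q hQ n.
Let shv n : sh n v = Q ^ n * v := dyn_sh_v hQ n.

Ltac push_sh :=
  rewrite ?(fmorphXz, rmorphM, rmorphD, rmorphN, rmorph1, fmorphV, rmorphXn) /=
    ?shQ ?shv ?sh_pw.

Definition pK : K := Q ^+ 2.

Lemma pKX n : pK ^+ n = (Q ^ n%:Z) ^+ 2.
Proof. by rewrite /pK -exprnP -!exprM mulnC. Qed.

Lemma pw_pK n (i : nat) : pw n * pK ^+ i = pw (n + i%:Z).
Proof. by rewrite pKX !QpowE !exprMn mulrA. Qed.

Lemma pw_pK1 n : pw n * pK = pw (n + 1).
Proof. by rewrite -[pK]expr1 pw_pK. Qed.

Lemma pK_neq0 : pK != 0.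
Proof. by rewrite expf_neq0 // Q_neq0. Qed.

Lemma pK_pow_neq1 n : 1 - pK ^+ n.+1 != 0.
Proof.
by rewrite subr_eq0 eq_sym /pK -exprM exprnP (dyn_Q_neq1 hQ).
Qed.

Lemma pw_pK_neq1 n (i : nat) : 1 - pw n * pK ^+ i != 0.
Proof. by rewrite pw_pK -oppr_eq0 opprB pw_neq1. Qed.

Lemma pw_neq1' n : 1 - pw n != 0.
Proof. by rewrite -oppr_eq0 opprB pw_neq1. Qed.

Lemma pw_neq0 n : pw n != 0.
Proof. by rewrite pw_sqr expf_neq0 // mulf_neq0 ?v_neq0 ?Qpow_neq0. Qed.

(** The claimed f without its hypergeometric series; the power of q is separated into a power of v =
    q^lambda and a constant. *)
Definition prefactor (M N k j m l L : nat) : K :=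
  (-1) ^+ (j + l + L) *
  (v ^ (j%:Z + l%:Z - L%:Z) *
   Q ^ ((j%:Z + l%:Z - L%:Z) * (1 + j%:Z + l%:Z - M%:Z - N%:Z) - 2 * k%:Z * m%:Z)) *
  qcore pK L (M - k) (N - m) j l (M - j) (N - l) (pw 1) (pw (1 - L%:Z))
    (pw (1 + M%:Z + N%:Z - 2 * L%:Z)).

Definition phi_series (M N k m L : nat) : K :=
  phi43 k m (pw (M%:Z + 1 - k%:Z))^-1 (pw (N%:Z + 1 - m%:Z))^-1
    (Q ^ (2 * L%:Z))^-1 (pw (M%:Z + N%:Z + 1 - L%:Z))^-1 (pw 0)^-1 pK pK.

Lemma sh_pK n : sh n pK = pK.
Proof. by rewrite rmorphXn /= shQ. Qed.

Lemma sh_qcore n L a b j l c d u x z :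
  sh n (qcore pK L a b j l c d u x z) =
  qcore pK L a b j l c d (sh n u) (sh n x) (sh n z).
Proof.
rewrite /qcore !(rmorphM, fmorphV, rmorph1, rmorphB) /= !rmorph_qpoch /= sh_pK.
by rewrite [sh n (u * pK)](rmorphM _ u pK) /= sh_pK.
Qed.

(** With x = [pw (1 - m)], the symbol (x;p)_(N+1) is cut once after N - m and once after m factors;
    in the second cut the next factor is 1 - [pw 1]. *)
Lemma prefactor0 N m : (m <= N)%N -> prefactor 0 N 0 0 m m m = 1.
Proof.
move=> mN; rewrite /prefactor add0n -signr_odd oddD addbb expr0 mul1r.
rewrite add0r subrr expr0z mul0r !mulr0 mul0r subr0 expr0z !mul1r.
rewrite /qcore !qpoch0 !mulr1 !mul1r.
set x := pw (1 - m%:Z).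
have -> : pw (1 + 0%:Z + N%:Z - 2 * m%:Z) = x * pK ^+ (N - m).
  by rewrite pw_pK; congr pw; lia.
have main : qpoch x pK (N - m) * qpoch (x * pK ^+ (N - m)) pK m.+1 =
    qpoch x pK m * ((1 - pw 1) * qpoch (pw 1 * pK) pK (N - m)).
  rewrite -qpoch_cat (_ : N - m + m.+1 = m + (N - m).+1)%N; last by lia.
  rewrite qpoch_cat qpoch_recl /x pw_pK (_ : 1 - m%:Z + m%:Z = 1) //; lia.
have hp n : qpoch pK pK n != 0 by apply/qpoch_pp_neq0/pK_pow_neq1.
have hx n i : qpoch (pw i) pK n != 0 by apply: qpoch_neq0 => ? _; apply: pw_pK_neq1.
rewrite pw_pK1 in main *.
have := hx m (1 - m%:Z); have := hx (N - m)%N (1 + 1); have := pw_neq1' 1.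
have := hp m; have := hp (N - m)%N; move: main; rewrite -/x.
move: (qpoch _ _ _) (qpoch _ _ _) (qpoch _ _ _) (qpoch _ _ _) => a b c d.
move: (qpoch _ _ _) (qpoch _ _ _) => e f m1 f0 e0 u0 a0 b0.
rewrite -mulrA (_ : d / b * (c / a) = d * c / (b * a)); last by field; rewrite a0.
by rewrite m1; field; rewrite a0 b0 e0 f0 u0.
Qed.

(* The summands of the recursion of [tmat], divided by the claimed value of the pairing *)
Definition ratio_delta (M N j m : nat) : K :=
  (pK ^+ j - pK ^+ M.+1) * (1 - pw (N%:Z - 2 * m%:Z + 1) / pK ^+ j) /
  ((1 - pK ^+ M.+1) * (1 - pw (N%:Z - 2 * m%:Z + 1))).

Definition ratio_gamma (M N j m : nat) : K :=
  (1 - pK ^+ j) * (1 - pw (N%:Z - 2 * m%:Z + 1) * pK ^+ M.+1 / pK ^+ j) /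
  ((1 - pK ^+ M.+1) * (1 - pw (N%:Z - 2 * m%:Z + 1))).

(** This closes the induction for k = 0. The edges fit as well: [ratio_delta] vanishes at j = M + 1
    and [ratio_gamma] at j = 0, where the corresponding summand of the recursion is zero. *)
Lemma ratio_delta_gamma M N j m : ratio_delta M N j m + ratio_gamma M N j m = 1.
Proof.
rewrite /ratio_delta /ratio_gamma; have := pK_pow_neq1 M.
have := pw_neq1' (N%:Z - 2 * m%:Z + 1); have := expf_neq0 j pK_neq0.
move: (pw _) (pK ^+ j) (pK ^+ M.+1) => x y z y0 x1 z1; field.
by rewrite y0 x1 z1.
Qed.

Lemma prefactor_delta M N j m l : (j <= M)%N -> l = (j + m)%N -> (l <= N)%N ->
  de_tmat N m * sh 1 (prefactor M N 0 j m l l) =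
  prefactor M.+1 N 0 j m l l * ratio_delta M N j m.
Proof.
move=> jM el lN.
rewrite /prefactor !subn0 rmorphM /= sh_qcore !sh_pw !addrK.
have -> : (M.+1 - j)%N = (M - j).+1 by lia.
have -> : 1 + (1 + M%:Z + N%:Z - 2 * l%:Z) = 1 + M.+1%:Z + N%:Z - 2 * l%:Z by lia.
rewrite (_ : pw (1 + 1) = pw 1 * pK) ?pw_pK1 // -?pw_pK1.
rewrite (_ : pw (1 + (1 - l%:Z)) = pw (1 - l%:Z) * pK); last first.
  by rewrite pw_pK1 addrC.
rewrite (core_delta pK_pow_neq1 _ (pw_pK_neq1 _) (pw_pK_neq1 _)).
move: (qcore _ _ _ _ _ _ _ _ _ _ _) => core.
push_sh; rewrite -!exprnP.
have -> : j%:Z * (1 + j%:Z + l%:Z - M%:Z - N%:Z) - 2 * 0%:Z * m%:Z =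
  (j%:Z * (1 + j%:Z + l%:Z - M.+1%:Z - N%:Z) - 2 * 0%:Z * m%:Z) + j%:Z by lia.
rewrite QpowD; move: (Q ^ (_ - _)) => t.
rewrite !pw_pK pw_pK1 /de_tmat /ratio_delta.
have -> : 1 - l%:Z + (N - m)%N%:Z = (N%:Z - 2 * m%:Z + 1) - j%:Z by lia.
have -> : 1 - l%:Z + j%:Z = 1 - m%:Z by lia.
have -> : 1 - l%:Z + l%:Z = 1 by lia.
have -> : 1 + (N - m).+1%:Z = N%:Z - m%:Z + 2 by lia.
have -> : pK ^+ M.+1 = pK ^+ (M - j).+1 * pK ^+ j.
  by rewrite -exprD; congr (_ ^+ _); lia.
have -> : pw (N%:Z - 2 * m%:Z + 1 - j%:Z) = pw (N%:Z - 2 * m%:Z + 1) / pK ^+ j.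
  by rewrite pKX !QpowE; field; rewrite !Qpow_neq0.
rewrite -[pw (1 + 1)]/(pw 2).
have h1 := pw_neq1' 1; have h2 := pw_neq1' 2; have h3 := pw_neq1' (1 - m%:Z).
have h4 := pw_neq1' (N%:Z - m%:Z + 2); have h5 := pw_neq1' (N%:Z - 2 * m%:Z + 1).
have h7 := expf_neq0 j pK_neq0.
have h2' := pw_neq1 2; have h5' := pw_neq1 (N%:Z - 2 * m%:Z + 1).
have h8 : 1 - pK ^+ (M - j).+1 * pK ^+ j != 0.
  by rewrite -exprD (_ : (M - j).+1 + j = M.+1)%N ?pK_pow_neq1 //; lia.
have -> : (Q * v) ^+ j * (t * Q ^+ j) = pK ^+ j * v ^+ j * t.
  by rewrite /pK exprMn -!exprM mul2n -addnn exprD; ring.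
move: (pK ^+ (M - j).+1) (pK ^+ j) h7 h8 => X Y h7 h8.
by field; rewrite ?(h1, h2, h3, h4, h5, h7, h2', h5', h8).
Qed.

Lemma prefactor_gamma M N j m l : (j <= M)%N -> l = (j.+1 + m)%N -> (l <= N)%N ->
  ga_tmat N m * sh 1 (prefactor M N 0 j m.+1 l l) *
    sh (1 + M%:Z + N%:Z - 2 * l%:Z) (gamma_coef M j.+1) =
  prefactor M.+1 N 0 j.+1 m l l * ratio_gamma M N j.+1 m.
Proof.
move=> jM el lN.
rewrite /prefactor !subn0 rmorphM /= sh_qcore !sh_pw !addrK.
have -> : (M.+1 - j.+1)%N = (M - j)%N by lia.
have -> : (N - m)%N = (N - m.+1).+1 by lia.
have -> : 1 + (1 + M%:Z + N%:Z - 2 * l%:Z) = 1 + M.+1%:Z + N%:Z - 2 * l%:Z by lia.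
rewrite (_ : pw (1 + 1) = pw 1 * pK) ?pw_pK1 // -?pw_pK1.
rewrite (_ : pw (1 + (1 - l%:Z)) = pw (1 - l%:Z) * pK); last first.
  by rewrite pw_pK1 addrC.
rewrite (core_gamma pK_pow_neq1 _ (pw_pK_neq1 _) (pw_pK_neq1 _)).
move: (qcore _ _ _ _ _ _ _ _ _ _ _) => core.
rewrite /gamma_coef; push_sh; rewrite -!exprnP expr1.
set E := j.+1%:Z * _ - _.
have -> : j%:Z * (1 + j%:Z + l%:Z - M%:Z - N%:Z) - 2 * 0%:Z * m.+1%:Z =
  E + (M%:Z + N%:Z - j%:Z - l%:Z - 1) by rewrite /E; lia.
rewrite (QpowD E); move: (Q ^ E) => t.
rewrite !pw_pK pw_pK1 /ga_tmat /ratio_gamma.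
have -> : 1 - l%:Z + l%:Z = 1 by lia.
rewrite -[pw (1 + 1)]/(pw 2).
have -> : pw (1 + M%:Z + N%:Z - 2 * l%:Z + (2 * j.+1%:Z - M%:Z)) =
  pw (N%:Z - 2 * m%:Z + 1) by congr pw; lia.
have -> : pw (1 + M%:Z + N%:Z - 2 * l%:Z + (1 + j.+1%:Z)) =
  pw (N%:Z - 2 * m%:Z + 1) * pK ^+ M.+1 / pK ^+ j.+1.
  apply: (mulIf (expf_neq0 j.+1 pK_neq0)).
  rewrite divfK; last exact: (expf_neq0 j.+1 pK_neq0).
  by rewrite !pw_pK; congr pw; lia.
have -> : Q ^ (2 * (N%:Z - m%:Z)) = pK ^+ (N - m.+1).+1.
  by rewrite Qpow2 pKX; congr ((Q ^ _) ^+ 2); lia.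
(* The monomials in v and Q are compared by their exponents alone; what remains is rational in
   values of [pw] and powers of q^2. *)
have mono : v * Q ^ (2 + m%:Z - N%:Z) * ((Q * v) ^+ j *
    (t * Q ^ (M%:Z + N%:Z - j%:Z - l%:Z - 1))) * Q ^ (j.+1%:Z - M%:Z - 1) =
    v ^+ j.+1 * t.
  transitivity (v ^+ j.+1 * t * (Q ^ (2 + m%:Z - N%:Z) * Q ^ j%:Z *
    Q ^ (M%:Z + N%:Z - j%:Z - l%:Z - 1) * Q ^ (j.+1%:Z - M%:Z - 1))).
    by rewrite exprMn -exprnP exprS; ring.
  rewrite -!QpowD (_ : Q ^ _ = 1) ?mulr1 // -(expr0z Q); congr (Q ^ _); lia.
move: mono; have := pw_neq1' 1; have := pw_neq1' 2; have := pw_neq1 (N%:Z - 2 * m%:Z + 1).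
have := pK_pow_neq1 M; have := pK_pow_neq1 (N - m.+1); have := expf_neq0 j.+1 pK_neq0.
have -> : (-1) ^+ (j.+1 + l + l) = - (-1) ^+ (j + l + l) :> K.
  by rewrite !addSn exprS mulN1r.
move=> h1 h2 h3 h4 h5 h6 <-.
move: (pK ^+ j.+1) (pK ^+ (N - m.+1).+1) (pK ^+ M.+1) h1 h2 h3 => X Y Z h1 h2 h3.
have h4' : 1 - pw (N%:Z - 2 * m%:Z + 1) != 0 by rewrite -oppr_eq0 opprB.
by abstract_exprz; field; rewrite ?(h1, h2, h3, h4, h5, h6, h4').
Qed.

(** Here only the prefactors are divided, since the series differ: [ratio_alpha] and [ratio_beta]
    are the two coefficients of the contiguous relation in the notation of the pairing. *)
Definition ratio_alpha (M N k j m l L : nat) : K :=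
  pK ^+ m * (1 - pK ^+ j) * (1 - pw (1 - L%:Z + (M - k)%N%:Z)) *
  (1 - pw (1 - L%:Z + (N - m)%N%:Z)) /
  ((1 - pK ^+ L) * (1 - pw (1 - L%:Z + l%:Z)) *
   (1 - pw (2 + M%:Z + N%:Z - 2 * L%:Z))).

Definition ratio_beta (M N j l L : nat) : K :=
  - (pw (1 - L%:Z + l%:Z) * (1 - pK ^+ (M.+1 - j)) * (1 - pK ^+ (N - l)) *
     (1 - pw (2 + M%:Z + N%:Z - 2 * L%:Z + j%:Z))) /
  ((1 - pw (1 - L%:Z + l%:Z)) *
   (1 - pw (2 + M%:Z + N%:Z - L%:Z)) *
   (1 - pw (2 + M%:Z + N%:Z - 2 * L%:Z))).

Lemma prefactor_alpha M N k j m l L : (k <= M)%N -> (j <= M)%N -> (m <= N)%N ->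
  (l <= N)%N -> (k + l = L)%N -> (j + m = L)%N ->
  prefactor M N k j m l L =
  prefactor M.+1 N k.+1 j.+1 m l L.+1 * ratio_alpha M N k j.+1 m l L.+1.
Proof.
move=> kM jM mN lN kl jm; rewrite /prefactor !subSS.
rewrite (_ : pw (1 - L%:Z) = pw (1 - L.+1%:Z) * pK); last first.
  by rewrite pw_pK1; congr pw; lia.
rewrite (_ : pw (1 + M%:Z + N%:Z - 2 * L%:Z) =
  pw (1 + M.+1%:Z + N%:Z - 2 * L.+1%:Z) * pK); last first.
  by rewrite pw_pK1; congr pw; lia.
rewrite (core_alpha pK_pow_neq1 (pw_pK_neq1 _) (pw_pK_neq1 _) (pw_pK_neq1 _)).
move: (qcore _ _ _ _ _ _ _ _ _ _ _) => core.
rewrite /ratio_alpha !pw_pK.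
have -> : (-1) ^+ (j.+1 + l + L.+1) = (-1) ^+ (j + l + L) :> K.
  by rewrite !addSn addnS !exprS !mulN1r opprK.
have -> : j.+1%:Z + l%:Z - L.+1%:Z = j%:Z + l%:Z - L%:Z by lia.
have -> : 1 + M.+1%:Z + N%:Z - 2 * L.+1%:Z = 2 + M%:Z + N%:Z - 2 * L.+1%:Z by lia.
set E := _ - 2 * k.+1%:Z * _.
have -> : (j%:Z + l%:Z - L%:Z) * (1 + j%:Z + l%:Z - M%:Z - N%:Z) - 2 * k%:Z * m%:Z =
  E + 2 * m%:Z by rewrite /E; lia.
rewrite (QpowD E) Qpow2 -pKX; move: (Q ^ E) (v ^ _) => t w; field.
by rewrite ?(pK_pow_neq1, pw_neq1').
Qed.

Lemma prefactor_beta M N k j m l L : (k <= M)%N -> (j <= M)%N -> (m <= N)%N ->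
  (l < N)%N -> (k.+1 + l = L)%N -> (j + m = L)%N ->
  prefactor M N k j m l.+1 L *
    sh (M%:Z - 2 * L%:Z + 2 * l%:Z + 2) (be_tmat N l) *
    sh (1 + M%:Z + N%:Z - 2 * L%:Z) (beta_coef j) =
  prefactor M.+1 N k.+1 j m l L * ratio_beta M N j l L.
Proof.
move=> kM jM mN lN kl jm; rewrite /prefactor !subSS.
have -> : (M.+1 - j)%N = (M - j).+1 by lia.
have -> : (N - l)%N = (N - l.+1).+1 by lia.
rewrite (_ : pw (1 + M.+1%:Z + N%:Z - 2 * L%:Z) =
  pw (1 + M%:Z + N%:Z - 2 * L%:Z) * pK); last first.
  by rewrite pw_pK1; congr pw; lia.
rewrite (core_beta pK_pow_neq1 (pw_pK_neq1 _) (pw_pK_neq1 _) (pw_pK_neq1 _)).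
move: (qcore _ _ _ _ _ _ _ _ _ _ _) => core.
rewrite /ratio_beta /be_tmat /beta_coef; push_sh; rewrite !pw_pK.
have -> : (-1) ^+ (j + l.+1 + L) = - (-1) ^+ (j + l + L) :> K.
  by rewrite addnS addSn exprS mulN1r.
set E := (_ * _ - 2 * k.+1%:Z * _).
have -> : 1 + M%:Z + N%:Z - 2 * L%:Z + L.+1%:Z = 2 + M%:Z + N%:Z - L%:Z by lia.
have -> : 1 + M%:Z + N%:Z - 2 * L%:Z + (1 + j%:Z) =
  2 + M%:Z + N%:Z - 2 * L%:Z + j%:Z by lia.
have -> : M%:Z - 2 * L%:Z + 2 * l%:Z + 2 + (N%:Z - 2 * l%:Z - 1) =
  1 + M%:Z + N%:Z - 2 * L%:Z by lia.
have -> : 1 + M%:Z + N%:Z - 2 * L%:Z + 1 = 2 + M%:Z + N%:Z - 2 * L%:Z by lia.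
have -> : Q ^ (2 * (1 + l%:Z)) = pK ^+ l.+1.
  by rewrite Qpow2 pKX; congr ((Q ^ _) ^+ 2); lia.
have -> : (M.+1 - j)%N = (M - j).+1 by lia.
have -> : (N - l)%N = (N - l.+1).+1 by lia.
set E2 := (_ * _ - 2 * k%:Z * _).
(* The monomials do not cancel completely: they leave the factor [pw (1 - L + l)] in the numerator
   of [ratio_beta]. *)
have mono : v ^ (j%:Z + l.+1%:Z - L%:Z) * Q ^ E2 *
    (Q ^ (M%:Z - 2 * L%:Z + 2 * l%:Z + 2) * v * Q ^ (N%:Z - 3 * l%:Z - 2)) *
    Q ^ (- j%:Z) = v ^ (j%:Z + l%:Z - L%:Z) * Q ^ E * pw (1 - L%:Z + l%:Z).
  rewrite pwE (_ : j%:Z + l.+1%:Z - L%:Z = j%:Z + l%:Z - L%:Z + 1); last by lia.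
  rewrite (expfzDr _ _ v_neq0) expr1z.
  transitivity (v ^ (j%:Z + l%:Z - L%:Z) * v ^+ 2 * (Q ^ E2 *
     Q ^ (M%:Z - 2 * L%:Z + 2 * l%:Z + 2) * Q ^ (N%:Z - 3 * l%:Z - 2) *
     Q ^ (- j%:Z))).
    by move: (v ^ (j%:Z + l%:Z - L%:Z)) => w; abstract_exprz; ring.
  rewrite -!QpowD [RHS]mulrACA -QpowD -!mulrA; congr (_ * (_ * (_ * Q ^ _))).
  by rewrite /E /E2; lia.
have hx := pw_neq1' (1 - L%:Z + l%:Z).
have hz := pw_neq1' (2 + M%:Z + N%:Z - L%:Z).
have hz1 := pw_neq1 (1 + M%:Z + N%:Z - 2 * L%:Z).
have hz2 := pw_neq1 (2 + M%:Z + N%:Z - 2 * L%:Z).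
have hz2' := pw_neq1' (2 + M%:Z + N%:Z - 2 * L%:Z).
have hl := pK_pow_neq1 l.
transitivity ((-1) ^+ (j + l + L) *
  (v ^ (j%:Z + l.+1%:Z - L%:Z) * Q ^ E2 *
    (Q ^ (M%:Z - 2 * L%:Z + 2 * l%:Z + 2) * v * Q ^ (N%:Z - 3 * l%:Z - 2)) *
    Q ^ (- j%:Z)) * core *
  (- ((1 - pK ^+ (M - j).+1) * (1 - pK ^+ (N - l.+1).+1) *
     (1 - pw (2 + M%:Z + N%:Z - 2 * L%:Z + j%:Z))) /
  ((1 - pw (1 - L%:Z + l%:Z)) * (1 - pw (2 + M%:Z + N%:Z - L%:Z)) *
   (1 - pw (2 + M%:Z + N%:Z - 2 * L%:Z))))); last first.
  by rewrite mono; abstract_exprz; field; rewrite ?(hx, hz, hz2').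
by abstract_exprz; field; rewrite ?(hx, hz, hz1, hz2, hz2', hl).
Qed.

Lemma pwV_pK_neq1 n (i : nat) : 1 - (pw n)^-1 * pK ^+ i != 0.
Proof.
have := pw_neq1 (n - i%:Z); have := pw_pK (n - i%:Z) i; rewrite subrK => <-.
have := pw_neq0 (n - i%:Z); have := expf_neq0 i pK_neq0.
move: (pw _) (pK ^+ i) => x y y0 x0 h.
by apply: (neq0_factor (u := x) h); field; rewrite x0 y0.
Qed.

Lemma pK_Q n : pK ^+ n = Q ^ (2 * n%:Z).
Proof. by rewrite pKX Qpow2. Qed.

(** Lowering M and k together keeps the numerator parameter c, which depends on M - k. If L + 1
    drops to L, then e becomes ep and f stays; if it is kept, then e stays and f becomes fp. The
    last denominator parameter q^(-2 lambda) is the one fixed by balance. *)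
Lemma phi_series_contiguous M N k j m l L : (k <= M)%N -> (m <= N)%N ->
  (l <= N)%N -> (j <= M.+1)%N -> (k + l)%N = L -> (j + m)%N = L.+1 ->
  phi_series M.+1 N k.+1 m L.+1 =
  ratio_alpha M N k j m l L.+1 * phi_series M N k m L +
  ratio_beta M N j l L.+1 * phi_series M N k m L.+1.
Proof.
move=> kM mN lN jM kl jm; rewrite /phi_series.
set c := (pw (M%:Z + 1 - k%:Z))^-1; set d := (pw (N%:Z + 1 - m%:Z))^-1.
set e := (Q ^ (2 * L.+1%:Z))^-1.
set f := (pw (M%:Z + N%:Z + 2 - L.+1%:Z))^-1.
have -> : (pw (M.+1%:Z + 1 - k.+1%:Z))^-1 = c by congr (pw _)^-1; lia.
have -> : (pw (M.+1%:Z + N%:Z + 1 - L.+1%:Z))^-1 = f by congr (pw _)^-1; lia.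
have -> : (pw (M%:Z + N%:Z + 1 - L%:Z))^-1 = f by congr (pw _)^-1; lia.
have -> : (Q ^ (2 * L%:Z))^-1 = e * pK.
  rewrite /e -!pK_Q exprS; field.
  by rewrite pK_neq0 expf_neq0 // pK_neq0.
have -> : (pw (M%:Z + N%:Z + 1 - L.+1%:Z))^-1 = f * pK.
  rewrite /f (_ : M%:Z + N%:Z + 2 - L.+1%:Z = M%:Z + N%:Z + 1 - L.+1%:Z + 1); last by lia.
  by rewrite -pw_pK1; field; rewrite pK_neq0 pw_neq0.
set b := pK ^- m.
(* Independent quantities in which every parameter is a quotient of monomials. The index j is
   eliminated through q^(2j) = X Y q^2 / Z, as j + m = k + l + 1. *)
pose X := pK ^+ k; pose Y := pK ^+ l; pose Z := pK ^+ m.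
pose S := pK ^+ (M - k); pose T := pK ^+ (N - m); pose w := pw 0.
have [X0 [Y0 Z0]] : X != 0 /\ Y != 0 /\ Z != 0 by rewrite !expf_neq0 ?pK_neq0.
have [S0 T0] : S != 0 /\ T != 0 by rewrite !expf_neq0 ?pK_neq0.
have w0 : w != 0 by exact: pw_neq0.
have p0 := pK_neq0.
have pwI (n : int) (x y : K) (i i' : nat) : x = pK ^+ i -> y = pK ^+ i' ->
    n + i'%:Z = i%:Z -> pw n = w * x / y.
  move=> -> -> e'; apply: (mulIf (expf_neq0 i' pK_neq0)).
  by rewrite divfK ?expf_neq0 ?pK_neq0 // !pw_pK add0r e'.
have pI (n : nat) (x y : K) (i i' : nat) : x = pK ^+ i -> y = pK ^+ i' ->
    (n + i' = i)%N -> pK ^+ n = x / y.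
  move=> -> -> e'; apply: (mulIf (expf_neq0 i' pK_neq0)).
  by rewrite divfK ?expf_neq0 ?pK_neq0 // -exprD e'.
have cE : c = (w * (S * pK))^-1.
  rewrite /c (@pwI _ (S * pK) 1 (M - k).+1%N 0) ?expr0 ?divr1 ?exprSr //;
    (clear -kl jm kM mN lN jM; lia).
have dE : d = (w * (T * pK))^-1.
  rewrite /d (@pwI _ (T * pK) 1 (N - m).+1 0) ?expr0 ?divr1 ?exprSr //;
    (clear -kl jm kM mN lN jM; lia).
have eE : e = (X * Y * pK)^-1.
  by rewrite /e -pK_Q -exprD -exprSr kl.
have fE : f = Y / (w * (S * T * Z * pK)).
  rewrite /f (@pwI _ (S * T * Z * pK) Y (M - k + (N - m) + m).+1%N l) //.
  - by rewrite invf_div.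
  - by rewrite exprSr !exprD.
  - (clear -kl jm kM mN lN jM; lia).
have bE : b = Z^-1 by [].
have gE : w^-1 = pK ^- k.+1 * b * c * d * pK / (e * f).
  rewrite bE cE dE eE fE exprS -/X; field.
  by rewrite ?(X0, Y0, Z0, S0, T0, w0, p0, oner_neq0).
have H1 : X * Y * Y - w * (S * T * Z) != 0.
  have := pw_neq1' (2 + M%:Z + N%:Z - 2 * L.+1%:Z).
  rewrite (@pwI _ (S * T * Z) (X * Y * Y)
     (M - k + (N - m) + m)%N (k + l + l)%N) ?exprD //; last by (clear -kl jm kM mN lN jM; lia).
  move=> h; apply: (neq0_factor (u := (X * Y * Y)^-1) h); field.
  by rewrite ?(X0, Y0).
have H2 : X - w != 0.
  have := pw_neq1' (- k%:Z); rewrite (@pwI _ 1 X 0 k) //; last by (clear -kl jm kM mN lN jM; lia).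
  move=> h; apply: (neq0_factor (u := X^-1) h); field.
  by rewrite ?(X0, Y0).
have H4 : Y - w * (S * T * Z * pK) != 0.
  have := pw_neq1' (2 + M%:Z + N%:Z - L.+1%:Z).
  rewrite (@pwI _ (S * T * Z * pK) Y (M - k + (N - m) + m).+1%N l) ?exprSr ?exprD //;
    last by (clear -kl jm kM mN lN jM; lia).
  move=> h; apply: (neq0_factor (u := Y^-1) h); field.
  by rewrite Y0.
have H3 : 1 - X * Y * pK != 0.
  by have := pK_pow_neq1 L; rewrite exprSr -kl exprD.
have AE : ratio_alpha M N k j m l L.+1 =
    f * (e - b) * (c - e) * (d - e) / ((e - 1) * (b * c * d - e * f) * (f - e)).
  rewrite /ratio_alpha bE cE dE eE fE.
  rewrite (@pI L.+1 (X * Y * pK) 1 L.+1 0) ?expr0 ?divr1 //; last 2 first.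
  - by rewrite exprSr -kl exprD.
  - (clear -kl jm kM mN lN jM; lia).
  rewrite (@pI j (X * Y * pK) Z L.+1 m) //; last by rewrite exprSr -kl exprD.
  rewrite (@pwI (1 - L.+1%:Z + (M - k)%N%:Z) S (X * Y) (M - k)%N (k + l)%N) ?exprD //;
    last by (clear -kl jm kM mN lN jM; lia).
  rewrite (@pwI (1 - L.+1%:Z + (N - m)%N%:Z) T (X * Y) (N - m)%N (k + l)%N) ?exprD //;
    last by (clear -kl jm kM mN lN jM; lia).
  rewrite (@pwI (1 - L.+1%:Z + l%:Z) 1 X 0 k) //; last by (clear -kl jm kM mN lN jM; lia).
  rewrite (@pwI (2 + M%:Z + N%:Z - 2 * L.+1%:Z) (S * T * Z) (X * Y * Y)
     (M - k + (N - m) + m)%N (k + l + l)%N) ?exprD //; last by (clear -kl jm kM mN lN jM; lia).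
  rewrite -/Z; field; rewrite ?(X0, Y0, Z0, S0, T0, w0, p0) /=.
  rewrite (neq0_factor (u := 1) H1); last by ring.
  rewrite (neq0_factor (u := 1) H2); last by ring.
  by rewrite (neq0_factor (u := 1) H3) //; ring.
have BE : ratio_beta M N j l L.+1 =
    e * (f - b) * (c - f) * (d - f) / ((f - 1) * (b * c * d - e * f) * (e - f)).
  rewrite /ratio_beta bE cE dE eE fE.
  rewrite (@pwI (1 - L.+1%:Z + l%:Z) 1 X 0 k) //; last by (clear -kl jm kM mN lN jM; lia).
  rewrite (@pI (M.+1 - j)%N (S * Z) Y (M - k + m)%N l) ?exprD //;
    last by (clear -kl jm kM mN lN jM; lia).
  rewrite (@pI (N - l)%N (Z * T) Y (m + (N - m))%N l) ?exprD //;
    last by (clear -kl jm kM mN lN jM; lia).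
  rewrite (@pwI (2 + M%:Z + N%:Z - 2 * L.+1%:Z + j%:Z) (S * T * pK) Y
     (M - k + (N - m)).+1%N l) ?exprSr ?exprD //; last by (clear -kl jm kM mN lN jM; lia).
  rewrite (@pwI (2 + M%:Z + N%:Z - L.+1%:Z) (S * T * Z * pK) Y
     (M - k + (N - m) + m).+1%N l) ?exprSr ?exprD //; last by (clear -kl jm kM mN lN jM; lia).
  rewrite (@pwI (2 + M%:Z + N%:Z - 2 * L.+1%:Z) (S * T * Z) (X * Y * Y)
     (M - k + (N - m) + m)%N (k + l + l)%N) ?exprD //; last by (clear -kl jm kM mN lN jM; lia).
  field; rewrite ?(X0, Y0, Z0, S0, T0, w0, p0, H1) /=.
  rewrite (neq0_factor (u := -1) H1); last by ring.
  rewrite (neq0_factor (u := 1) H2); last by ring.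
  by rewrite (neq0_factor (u := 1) H4) //; ring.
have e0 : e != 0 by rewrite invr_eq0 Qpow_neq0.
have f0 : f != 0 by rewrite invr_eq0 pw_neq0.
rewrite AE BE gE; apply: phi43_contiguous => //.
- exact: pK_pow_neq1.
- apply: (neq0_factor (u := w * S * T * Z * X * Y * pK) H1).
  by rewrite fE eE; field; rewrite ?(X0, Y0, Z0, S0, T0, w0, p0).
- apply: (neq0_factor (u := X * w ^+ 2 * S * T * Z * pK ^+ 2) H2).
  by rewrite -/b bE cE dE fE eE; field; rewrite ?(X0, Y0, Z0, S0, T0, w0, p0).
- move=> n nk; have dn : ((L - n).+1 + n = L.+1)%N by (clear -kl nk; lia).
  have := pK_pow_neq1 (L - n); have := expf_neq0 n pK_neq0.
  have := expf_neq0 (L - n).+1 pK_neq0; rewrite /e -pK_Q -dn exprD.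
  move: (pK ^+ n) (pK ^+ (L - n).+1) => x y y0 x0 h.
  by apply: (neq0_factor (u := - y) h); field; rewrite x0 y0.
- by move=> n; apply: pwV_pK_neq1.
- by rewrite -/b -gE => n; apply: pwV_pK_neq1.
Qed.
End ClosedForm.

Section QfunParameters.
Variables (R : realType) (q : R).
Hypothesis hq : 0 < q < 1.
Notation K := (qfun hq).

Lemma qshift0 (x : K) : qshift 0 x = x.
Proof. by apply: val_inj; rewrite /= m_shift0. Qed.

Lemma qshift_shift m n (x : K) : qshift m (qshift n x) = qshift (m + n) x.
Proof. by apply: val_inj; rewrite /= m_shift_shift intrD. Qed.

Definition qsh (n : int) : {rmorphism K -> K} := @qshift _ _ hq n.

Lemma qfun_parameters : dynamical_parameters (qK hq) (vK hq) qsh.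
Proof.
split; first exact: qK_neq0; first exact: vK_neq0; first exact: qK_pow_neq1.
- by move=> n; rewrite exprnP vK_qK_neq1.
- exact: qshift_qK.
- exact: qshift_vK.
Qed.
End QfunParameters.

(** * The dynamical quantum group and its matrix elements *)

Section IntegerDegrees.
Variables (R : realType) (q : R).
Notation C := (R[i]).
Notation A := (dynSL2 q).
Notation al := (Lgen q true true).
Notation be := (Lgen q true false).
Notation ga := (Lgen q false true).
Notation de := (Lgen q false false).

Lemma homog_gen (x y : bool) :
  homog (if x then 1%:~R else (-1)%:~R) (if y then 1%:~R else (-1)%:~R)
    (Lgen q x y).
Proof.
have -> (b : bool) : (if b then 1%:~R else (-1)%:~R) = omega R b by case: b.
exact: homog_L.
Qed.

Lemma homog_al : homog 1%:~R 1%:~R al. Proof. exact: (homog_gen true true). Qed.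
Lemma homog_be : homog 1%:~R (-1)%:~R be. Proof. exact: (homog_gen true false). Qed.
Lemma homog_ga : homog (-1)%:~R 1%:~R ga. Proof. exact: (homog_gen false true). Qed.
Lemma homog_de : homog (-1)%:~R (-1)%:~R de. Proof. exact: (homog_gen false false). Qed.

Lemma homog_mul (r s r' s' : int) (a b : A) : homog r%:~R s%:~R a ->
  homog r'%:~R s'%:~R b -> homog (r + r')%:~R (s + s')%:~R (a * b).
Proof. by move=> ha hb; rewrite !intrD; apply: homogM. Qed.

Lemma homog_exp (r s : int) (a : A) (n : nat) : homog r%:~R s%:~R a ->
  homog (r * n%:Z)%:~R (s * n%:Z)%:~R (a ^+ n).
Proof.
move=> ha; elim: n => [|n ih]; first by rewrite !mulr0 expr0; apply: homog1.
by rewrite exprS intS !mulrDr !mulr1; apply: homog_mul.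
Qed.

Lemma homog_gamma_alpha N k : (k <= N)%N ->
  homog (2 * k%:Z - N%:Z)%:~R (N%:Z)%:~R (gamma_alpha q N k).
Proof.
move=> kN; rewrite (_ : 2 * k%:Z - N%:Z = (-1) * (N - k)%N%:Z + 1 * k%:Z); last by lia.
rewrite [X in homog _ X%:~R](_ : _ = 1 * (N - k)%N%:Z + 1 * k%:Z); last by lia.
by apply: homog_mul; apply: homog_exp; [exact: homog_ga | exact: homog_al].
Qed.

Lemma homog_cast (r s r' s' : int) (a : A) : homog r%:~R s%:~R a ->
  r = r' -> s = s' -> homog (r'%:~R : C) s'%:~R a.
Proof. by move=> h <- <-. Qed.

Lemma gamma_alpha_gammaS N k : (k <= N)%N ->
  gamma_alpha q N.+1 k = ga * gamma_alpha q N k.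
Proof. by move=> kN; rewrite /gamma_alpha subSn // exprS mulrA. Qed.

Lemma gamma_alpha_alphaS N k :
  gamma_alpha q N.+1 k.+1 = gamma_alpha q N k * al.
Proof. by rewrite /gamma_alpha subSS exprSr mulrA. Qed.

End IntegerDegrees.

(** * Reordering products of alpha and gamma *)

Section Commutation.
Variables (R : realType) (q : R).
Hypothesis hq : 0 < q < 1.
Notation A := (dynSL2 q).
Notation K := (qfun hq).
Notation al := (Lgen q true true).
Notation ga := (Lgen q false true).
Notation v := (vK hq).
Notation Q := (qK hq).
Notation pw := (pw Q v).
Notation ag_coef := (ag_coef Q v).
Notation ga_coef := (ga_coef Q v).
Let hQ := qfun_parameters hq.

Definition fl (x : K) : A := mu_l q (qval x).
Definition fr (x : K) : A := mu_r q (qval x).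

Lemma flM x y : fl (x * y) = fl x * fl y.
Proof. by rewrite /fl rmorphM mu_lM. Qed.

Lemma fl1 : fl 1 = 1.
Proof. by rewrite /fl rmorph1. Qed.

Lemma fl_homog (r s : int) (a : A) x : homog r%:~R s%:~R a ->
  fl x * a = a * fl (qshift r x).
Proof. exact: homog_mu_l. Qed.

Lemma fr_homog (r s : int) (a : A) x : homog r%:~R s%:~R a ->
  fr x * a = a * fr (qshift s x).
Proof. exact: homog_mu_r. Qed.

Lemma homog_fl (r s : int) (a : A) x : homog r%:~R s%:~R a ->
  a * fl x = fl (qshift (- r) x) * a.
Proof. by move=> h; rewrite (fl_homog _ h) qshift_shift subrr qshift0. Qed.

Lemma alpha_gamma : al * ga = fl (ag_coef 1) * (ga * al).
Proof.
have -> : al * ga = mu_l q (qcst q 1 * Ffun q) * (ga * al).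
  rewrite -[LHS]/(dyn_mul _ _) -[X in _ * X]/(dyn_mul _ _) -[RHS]/(dyn_mul _ _).
  rewrite (dyn_mulE q (Gen R false true) (Gen R true true)) !dyn_mulE.
  apply/dynP; exact: trel_ac.
congr (mu_l q _ * _); rewrite -(qval_qK hq 1) /Ffun.
have -> : qlin q 2 2 = qval (pw 1).
  by rewrite pwE exprnP qval_qlin.
rewrite -(qval_qK hq (-2)) -(rmorph1 (@qval _ _ hq)) -!rmorphB -fmorphV -!rmorphM.
by congr qval; rewrite -(ag_coef1_det hQ).
Qed.

Lemma fl_fl_mul x y a b : fl x * (fl y * a * b) = fl (x * y) * (a * b).
Proof. by rewrite flM -!mulrA. Qed.

Lemma alpha_gamma_exp n : al * ga ^+ n = fl (ag_coef n) * (ga ^+ n * al).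
Proof.
elim: n => [|n ih]; first by rewrite (ag_coef0 hQ) fl1 !mul1r mulr1.
rewrite exprS mulrA alpha_gamma -!mulrA ih (mulrA ga) (homog_fl _ (homog_ga q)).
apply: etrans (fl_fl_mul (ag_coef 1) _ ga _) _; congr (fl _ * _).
exact: (ag_coefS hQ).
Qed.

Lemma alpha_exp_gamma n : al ^+ n * ga = fl (ga_coef n) * (ga * al ^+ n).
Proof.
elim: n => [|n ih]; first by rewrite (ga_coef0 hQ) fl1 !mul1r mulr1.
rewrite exprSr -mulrA alpha_gamma mulrA (homog_fl _ (homog_exp n (homog_al q))).
rewrite -mulrA [al ^+ n * _]mulrA ih mul1r.
apply: etrans (fl_fl_mul (qshift (- n%:Z) (ag_coef 1)) _ _ _) _; congr (fl _ * _).
exact: (ga_coefS hQ).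
exact: (esym (mulrA _ _ _)).
Qed.

Lemma alpha_gamma_alpha N k : (k <= N)%N -> al * gamma_alpha q N k =
  fl (ag_coef (N - k)) * gamma_alpha q N.+1 k.+1.
Proof.
move=> kN; rewrite gamma_alpha_alphaS /gamma_alpha mulrA alpha_gamma_exp.
by rewrite -!mulrA -exprS -exprSr.
Qed.

Lemma gamma_alpha_gamma N k : (k <= N)%N -> gamma_alpha q N k * ga =
  fl (qshift (N - k)%N (ga_coef k)) * gamma_alpha q N.+1 k.
Proof.
move=> kN; rewrite gamma_alpha_gammaS // /gamma_alpha -mulrA alpha_exp_gamma.
rewrite mulrA (homog_fl _ (homog_exp _ (homog_ga q))) mulN1r opprK -!mulrA.
by rewrite (mulrA (ga ^+ _)) -exprSr exprS -mulrA.
Qed.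
End Commutation.

Section TensorLemmas.
Variables (R : realType) (q : R).
Notation C := (R[i]).
Notation A := (dynSL2 q).
Implicit Types (r s t : C) (a b : A).

Lemma tensE r s t a b (ha : homog r s a) (hb : homog s t b) :
  tens a b = \pi_(tens2 q) [:: stens_mk ha hb].
Proof.
rewrite /tens; case: pselect => [h|]; last by case; exists r, s, t.
by congr (\pi_(tens2 q) [:: _]); apply: stens_eq.
Qed.

Lemma tensDl r s t a a' b : homog r s a -> homog r s a' -> homog s t b ->
  tens (a + a') b = tens a b + tens a' b.
Proof.
move=> ha ha' hb; rewrite (tensE (homogD ha ha') hb) (tensE ha hb) (tensE ha' hb).
rewrite -[RHS]/(tens_add _ _) tens_addE; apply/tensP; exact: teq_Dl.
Qed.

Lemma tens0l s t b : homog s t b -> tens 0 b = 0 :> tens2 q.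
Proof. by move=> hb; rewrite (tensE (homog0 q 0 s) hb); apply/tensP; apply: teq_0l. Qed.

Lemma tens_balance r s t f a b : homog r s a -> homog s t b ->
  tens a (mu_l q f * b) = tens (mu_r q f * a) b.
Proof.
move=> ha hb; rewrite (tensE ha (homog_mu_l_mul f hb)).
by rewrite (tensE (homog_mu_r_mul f ha) hb); apply/esym/tensP; apply: teq_bal.
Qed.

Lemma tensM r s t r' s' t' a b c d :
  homog r s a -> homog s t b -> homog r' s' c -> homog s' t' d ->
  tens a b * tens c d = tens (a * c) (b * d).
Proof.
move=> ha hb hc hd.
rewrite (tensE ha hb) (tensE hc hd) (tensE (homogM ha hc) (homogM hb hd)).
rewrite -[LHS]/(tens_mul _ _) tens_mulE; apply/tensP.
by apply: teq_pairs (teq_refl [:: stens_mk (homogM ha hc) (homogM hb hd)]).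
Qed.

Lemma tens11 : tens 1 1 = 1 :> tens2 q.
Proof. by rewrite (tensE (homog1 q) (homog1 q)). Qed.
End TensorLemmas.

(** * Explicit matrix elements *)

Section CanonicalMatrixElements.
Variables (R : realType) (q : R).
Hypothesis hq : 0 < q < 1.
Notation A := (dynSL2 q).
Notation al := (Lgen q true true).
Notation be := (Lgen q true false).
Notation ga := (Lgen q false true).
Notation de := (Lgen q false false).
Notation v := (vK hq).
Notation Q := (qK hq).
Notation gamma_coef := (gamma_coef Q v).
Notation beta_coef := (beta_coef Q v).
Let hQ := qfun_parameters hq.
Notation fl := (@fl R q hq).
Notation fr := (@fr R q hq).

(* Obtained by multiplying out Delta (gamma^(N-m) alpha^m) one generator at a time,
   from the left for gamma and from the right for alpha; junk for m > N. *)
Fixpoint tmat (N m l : nat) : A :=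
  match N, m with
  | 0, _ => if l == 0%N then 1 else 0
  | N'.+1, 0 => de * tmat N' 0 l +
      (if l is l'.+1 then ga * tmat N' 0 l' * fr (gamma_coef N' l) else 0)
  | N'.+1, m'.+1 => (if l is l'.+1 then tmat N' m' l' * al else 0) +
      tmat N' m' l * be * fr (beta_coef l)
  end.

Lemma tmat_out N m l : (N < l)%N -> tmat N m l = 0.
Proof.
elim: N m l => [|N ih] [|m] [|l] //=; rewrite ltnS => h;
  by rewrite !ih ?mulr0 ?mul0r ?addr0 // ltnW.
Qed.

Lemma homog_fr (r s : int) (a : A) x : homog r%:~R s%:~R a ->
  homog r%:~R s%:~R (a * fr x).
Proof. by move=> h; rewrite -[r]addr0 -[s]addr0; apply: homog_mul => //; apply: homog_r. Qed.

Lemma homog_tmat N m l : (m <= N)%N ->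
  homog (2 * m%:Z - N%:Z)%:~R (2 * l%:Z - N%:Z)%:~R (tmat N m l).
Proof.
elim: N m l => [|N ih] [|m] l //= mN.
- by case: l => [|l]; [exact: homog1 | exact: homog0].
- apply: homogD.
    by apply: homog_cast (homog_mul (homog_de q) (ih 0%N l _)) _ _; lia.
  case: l => [|l]; first exact: homog0; apply: homog_fr.
  by apply: homog_cast (homog_mul (homog_ga q) (ih 0%N l _)) _ _; lia.
- apply: homogD.
    case: l => [|l]; first exact: homog0.
    by apply: homog_cast (homog_mul (ih m l _) (homog_al q)) _ _; lia.
  apply: homog_fr.
  by apply: homog_cast (homog_mul (ih m l _) (homog_be q)) _ _; lia.
Qed.

(** A coefficient created in the second leg crosses the balanced tensor product and then moves past
    a, which shifts it by the right degree of a. *)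
Lemma tens_move (r s s' t : int) (a b : A) x : homog r%:~R s%:~R a ->
  homog s'%:~R t%:~R b -> s' = s ->
  tens a (fl x * b) = tens (a * fr (qshift s x)) b.
Proof.
by move=> ha hb e; subst s'; rewrite (tens_balance _ ha hb) -(fr_homog _ ha).
Qed.

Lemma tensDl_int (r s r' s' s'' t : int) (a a' b : A) : homog r%:~R s%:~R a ->
  homog r'%:~R s'%:~R a' -> homog s''%:~R t%:~R b -> r' = r -> s' = s -> s'' = s ->
  tens (a + a') b = tens a b + tens a' b.
Proof. by move=> ha ha' hb e1 e2 e3; subst r' s' s''; apply: tensDl ha ha' hb. Qed.

Lemma sum_shift_split (V : zmodType) N (F G : nat -> V) : G N.+1 = 0 ->
  \sum_(l < N.+2) ((if l : nat is l'.+1 then F l' else 0) + G l) =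
  \sum_(l < N.+1) F l + \sum_(l < N.+1) G l.
Proof.
move=> G0; rewrite big_split; congr (_ + _).
  by rewrite big_ord_recl /= add0r.
by rewrite big_ord_recr /= G0 addr0.
Qed.

Section Coproduct.
Variable Delta : {rmorphism A -> tens2 q}.
Hypothesis hDelta : is_coproduct Delta.

Lemma Delta_gen (a b : bool) : Delta (Lgen q a b) =
  tens (Lgen q a true) (Lgen q true b) + tens (Lgen q a false) (Lgen q false b).
Proof. by rewrite (coproduct_gen hDelta) big_bool. Qed.

(** In the second leg a new alpha on the left or gamma on the right breaks the order gamma^(N-l)
    alpha^l. Restoring it costs a coefficient, which [tens_move] turns into the factor [gamma_coef]
    or [beta_coef] of [tmat]. *)
Lemma Delta_gamma_alpha N m : (m <= N)%N -> Delta (gamma_alpha q N m) =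
  \sum_(l < N.+1) tens (tmat N m l) (gamma_alpha q N l).
Proof.
elim: N m => [|N ih] [|m] // mN.
- by rewrite big_ord1 /gamma_alpha /= !expr0 mulr1 rmorph1 tens11.
- rewrite gamma_alpha_gammaS // rmorphM /= Delta_gen ih // mulrDl !mulr_sumr.
  pose F l := tens (ga * tmat N 0 l * fr (gamma_coef N l.+1))
    (gamma_alpha q N.+1 l.+1).
  pose G l := tens (de * tmat N 0 l) (gamma_alpha q N.+1 l).
  transitivity (\sum_(l < N.+1) F l + \sum_(l < N.+1) G l).
    congr (_ + _); apply: eq_bigr => -[l lN] _ /=; rewrite ltnS in lN.
      rewrite (tensM (homog_ga q) (homog_al q) (homog_tmat l (leq0n N))
        (homog_gamma_alpha q lN)) (alpha_gamma_alpha hq lN).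
      rewrite (tens_move _ (homog_mul (homog_ga q) (homog_tmat l (leq0n N)))
         (homog_gamma_alpha q (_ : l < N.+1)%N)); [|by []|lia].
      by congr (tens (_ * fr _) _); apply: (gamma_coefE hQ lN).
    rewrite (tensM (homog_de q) (homog_ga q) (homog_tmat l (leq0n N))
      (homog_gamma_alpha q lN)).
    by rewrite -gamma_alpha_gammaS.
  rewrite -(@sum_shift_split _ N F G); last first.
    by rewrite /G tmat_out // mulr0 (tens0l (homog_gamma_alpha q (leqnn _))).
  apply: eq_bigr => -[l lN] _ /=; rewrite ltnS in lN.
  rewrite addrC; case: l lN => [|l] lN; first by rewrite !addr0.
  rewrite (tensDl_int (homog_mul (homog_de q) (homog_tmat l.+1 (leq0n N)))
    (homog_fr _ (homog_mul (homog_ga q) (homog_tmat l (leq0n N))))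
    (homog_gamma_alpha q lN)) //; lia.
- have {}mN : (m <= N)%N := mN.
  rewrite gamma_alpha_alphaS rmorphM /= Delta_gen ih // mulrDr !mulr_suml.
  pose F l := tens (tmat N m l * al) (gamma_alpha q N.+1 l.+1).
  pose G l := tens (tmat N m l * be * fr (beta_coef l)) (gamma_alpha q N.+1 l).
  transitivity (\sum_(l < N.+1) F l + \sum_(l < N.+1) G l).
    congr (_ + _); apply: eq_bigr => -[l lN] _ /=; rewrite ltnS in lN.
      rewrite (tensM (homog_tmat l mN) (homog_gamma_alpha q lN)
        (homog_al q) (homog_al q)).
      by rewrite -gamma_alpha_alphaS.
    rewrite (tensM (homog_tmat l mN) (homog_gamma_alpha q lN)
        (homog_be q) (homog_ga q)) (gamma_alpha_gamma hq lN).
    rewrite (tens_move _ (homog_mul (homog_tmat l mN) (homog_be q))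
         (homog_gamma_alpha q (leqW lN))); last by lia.
    by congr (tens (_ * fr _) _); apply: (beta_coefE hQ lN).
  rewrite -(@sum_shift_split _ N F G); last first.
    by rewrite /G tmat_out // !mul0r (tens0l (homog_gamma_alpha q (leqnn _))).
  apply: eq_bigr => -[l lN] _ /=; rewrite ltnS in lN.
  case: l lN => [|l] lN; first by rewrite !add0r.
  rewrite (tensDl_int (homog_mul (homog_tmat l mN) (homog_al q))
    (homog_fr _ (homog_mul (homog_tmat l.+1 mN) (homog_be q)))
    (homog_gamma_alpha q lN)) //; lia.
Qed.
End Coproduct.
End CanonicalMatrixElements.

(** * The pairing *)

Section DifferenceTerms.
Variables (R : realType) (q : R).
Hypothesis hq : 0 < q < 1.
Notation C := (R[i]).
Notation K := (qfun hq).

Definition dterm (x : K) (n : int) : diffop C := d_term (qval x) n%:~R.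

Lemma dtermM x m y n : dterm x m * dterm y n = dterm (x * qshift m y) (m + n).
Proof.
apply: diffop_eq => g; rewrite /= m_shiftM m_shift_shift mulrA.
by rewrite -intrD.
Qed.

Lemma dtermD x y n : dterm x n + dterm y n = dterm (x + y) n.
Proof. by apply: diffop_eq => g; rewrite /= -mulrDl. Qed.

Lemma dterm0 n : dterm 0 n = 0.
Proof. by apply: diffop_eq => g; rewrite /= mul0r. Qed.

Lemma dterm1 : dterm 1 0 = 1.
Proof. by []. Qed.

Lemma dterm_mulI A B x n : x != 0 -> A * dterm x n = B * dterm x n -> A = B.
Proof.
move=> x0 e; have := congr1 (fun X => X * dterm (qshift (- n) x^-1) (- n)) e.
rewrite -!mulrA !dtermM qshift_shift subrr qshift0 divff //.
by rewrite dterm1 !mulr1.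
Qed.

Lemma d_shiftE (n : int) : d_shift n%:~R = dterm 1 n.
Proof. by rewrite /dterm rmorph1. Qed.

Lemma d_funE x : d_fun (qval x) = dterm x 0.
Proof. by []. Qed.
End DifferenceTerms.

Section PairingGenerators.
Variables (R : realType) (q : R).
Hypothesis hq : 0 < q < 1.
Notation C := (R[i]).
Notation A := (dynSL2 q).
Notation K := (qfun hq).
Notation al := (Lgen q true true).
Notation be := (Lgen q true false).
Notation ga := (Lgen q false true).
Notation de := (Lgen q false false).
Notation v := (vK hq).
Notation Q := (qK hq).
Notation pw := (pw Q v).
Notation gamma_gamma := (gamma_gamma Q v).
Notation delta_delta := (delta_delta Q v).
Notation beta_beta := (beta_beta Q v).
Let hQ := qfun_parameters hq.
Notation fr := (@fr R q hq).
Notation dterm := (@dterm R q hq).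
Variables (Delta : {rmorphism A -> tens2 q}) (eps : {rmorphism A -> diffop C}).
Variable P : A -> A -> diffop C.
Hypotheses (hDelta : is_coproduct Delta) (heps : is_counit eps).
Hypothesis hP : is_pairing Delta eps P.

Lemma pairingDl a a' b : P (a + a') b = P a b + P a' b.
Proof.
have := pairing_linl hP 1 a a' b.
by rewrite rmorph1 [mu_l q 1 * a]mul1r [d_fun 1 * _]mul1r.
Qed.

Lemma pairingDr a b b' : P a (b + b') = P a b + P a b'.
Proof.
have := pairing_linr hP 1 a b b'.
by rewrite rmorph1 [mu_l q 1 * b]mul1r [d_fun 1 * _]mul1r.
Qed.

Lemma pairing0l b : P 0 b = 0.
Proof. by apply: (addrI (P 0 b)); rewrite -pairingDl !addr0. Qed.

Lemma pairing0r a : P a 0 = 0.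
Proof. by apply: (addrI (P a 0)); rewrite -pairingDr !addr0. Qed.

Lemma pairing_fr1 x a b : P (a * fr x) b = P a b * dterm x 0.
Proof. exact: (pairing_mu_r1 hP). Qed.

Lemma pairing_fr2 x a b : P a (b * fr x) = P a b * dterm x 0.
Proof. exact: (pairing_mu_r2 hP). Qed.

(** Components of the difference operators off the diagonal are zero. Degrees are integers here so
    that [lia] can decide which pairings vanish. *)
Lemma pairing_deg (r s t u : int) a b : homog r%:~R s%:~R a ->
  homog t%:~R u%:~R b -> r + u <> s + t -> P a b = 0.
Proof.
move=> ha hb e; have := pairing_homog hP ha hb.
rewrite /d_homog -!intrD (inj_eq (@intr_inj _)).
by case: eqP.
Qed.

Lemma pairing_gen_mul (a b : bool) x y : P (Lgen q a b) (x * y) =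
  P (Lgen q a true) x * dterm 1 1 * P (Lgen q true b) y +
  P (Lgen q a false) x * dterm 1 (-1) * P (Lgen q false b) y.
Proof.
pose s (i : 'I_2) : C := if i == 0 then 1%:~R else (-1)%:~R.
pose c' (i : 'I_2) : A := Lgen q a (i == 0).
pose c'' (i : 'I_2) : A := Lgen q (i == 0) b.
have dec : tensor_decomp (Delta (Lgen q a b)) s c' c''.
  split=> [i|i|].
  - by exists (if a then 1%:~R else (-1)%:~R); exact: homog_gen.
  - by exists (if b then 1%:~R else (-1)%:~R); exact: homog_gen.
  - by rewrite Delta_gen // big_ord_recl big_ord1.
by rewrite (pairing_mul2 hP _ _ dec) big_ord_recl big_ord1 /s /= !(d_shiftE hq).
Qed.

Lemma pairing_al_gen c d : P al (Lgen q c d) =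
  if c && d then dterm 1 (-2) else if c || d then 0 else dterm 1 0.
Proof.
rewrite (pairing_gen hP); case: c d => [] [] //=.
Qed.

Lemma pairing_be_gen c d : P be (Lgen q c d) =
  if c && ~~ d then dterm beta_beta 0 else 0.
Proof.
rewrite (pairing_gen hP); case: c d => [] [] //=.
rewrite -(qval_qK hq 1) -(qval_qK hq (-1)) -d_funE; congr d_fun.
rewrite rmorphM fmorphV !rmorphB /=; congr (_ / (_ - _)).
by rewrite qlinV oppr0.
Qed.

Lemma pairing_ga_gen c d : P ga (Lgen q c d) =
  if d && ~~ c then dterm gamma_gamma 0 else 0.
Proof.
rewrite (pairing_gen hP); case: c d => [] [] //=.
rewrite -(qval_qK hq 1) -(qval_qK hq (-1)) -d_funE; congr d_fun.
rewrite rmorphM fmorphV !rmorphB /=.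
have -> : qlin q 1 2 = qval (Q ^+ 2 * v).
  by rewrite mulrC -[v]expr1z exprnP qval_qlin.
have -> : qlin q (-1) (-2) = qval (Q ^- 2 / v).
  by rewrite mulrC -[v^-1]/(v ^ (-1)) -[Q ^- 2]/(Q ^ (-2)) qval_qlin.
by [].
Qed.

Lemma pairing_de_gen c d : P de (Lgen q c d) =
  if c && d then dterm 1 0 else if c || d then 0 else dterm delta_delta 2.
Proof.
rewrite (pairing_gen hP); case: c d => [] [] //=.
rewrite -[2]/(2%:~R) (d_shiftE hq) /Gfun.
have e : qlin q 2 2 = qval (pw 1) by rewrite pwE exprnP qval_qlin.
rewrite e -(qval_qK hq 2) -(qval_qK hq (-2)) -(rmorph1 (@qval _ _ hq)).
rewrite -!rmorphB -!rmorphM -rmorphXn -fmorphV -rmorphM.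
have sh x : m_shift 1 (qval x) = qval (qshift 1 x :> K) by [].
rewrite sh d_funE dtermM qshift0 mulr1 add0r; congr dterm.
exact: (delta_deltaE hQ).
Qed.

End PairingGenerators.

(** * Pairings of generators with matrix elements *)

Section GeneratorMatrixElements.
Variables (R : realType) (q : R).
Hypothesis hq : 0 < q < 1.
Notation C := (R[i]).
Notation A := (dynSL2 q).
Notation al := (Lgen q true true).
Notation be := (Lgen q true false).
Notation ga := (Lgen q false true).
Notation de := (Lgen q false false).
Notation v := (vK hq).
Notation Q := (qK hq).
Notation pw := (pw Q v).
Let hQ := qfun_parameters hq.
Notation dterm := (@dterm R q hq).
Notation tmat := (tmat hq).
Notation be_tmat := (be_tmat Q v).
Notation ga_tmat := (ga_tmat Q v).
Notation de_tmat := (de_tmat Q v).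
Variables (Delta : {rmorphism A -> tens2 q}) (eps : {rmorphism A -> diffop C}).
Variable P : A -> A -> diffop C.
Hypotheses (hDelta : is_coproduct Delta) (heps : is_counit eps).
Hypothesis hP : is_pairing Delta eps P.

Lemma counit_gen_dterm b c : eps (Lgen q b c) =
  if b == c then dterm 1 (if b then -1 else 1) else 0.
Proof.
rewrite (counit_gen heps); case: b c => [] [] //=.
by rewrite opprK -(d_shiftE hq); congr d_shift; exact: (esym (mulr1z _)).
Qed.

Lemma counit_tmat N m : (m <= N)%N -> eps (tmat N m m) = dterm 1 (N%:Z - 2 * m%:Z).
Proof.
elim: N m => [|N ih] [|m] //= mN.
- by rewrite rmorph1.
- rewrite addr0 rmorphM /= ih // counit_gen_dterm dtermM rmorph1 mulr1.
  by congr dterm; lia.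
- rewrite rmorphD !rmorphM /= !counit_gen_dterm /= mulr0 mul0r addr0.
  rewrite ih // dtermM rmorph1 mulr1.
  by congr dterm; lia.
Qed.

Let simp_gen := (pairingDr hP, pairing_fr2 (hq := hq) hP, pairing_gen_mul hq hDelta hP,
  pairing0r hP, (mul0r, mulr0, add0r, addr0),
  pairing_al_gen hq hP, pairing_be_gen hq hP, pairing_ga_gen hq hP, pairing_de_gen hq hP).

(** By degrees alpha and delta pair nontrivially only with diagonal entries, beta only with entries
    (l + 1, l) and gamma only with entries (m, m + 1). The inductions follow the recursion of
    [tmat]: a product in the second slot splits the generator in the first one. *)
Lemma pairing_al_tmat N m : (m <= N)%N ->
  P al (tmat N m m) = dterm 1 (N%:Z - 2 * m%:Z - 1).
Proof.
elim: N m => [|N ih] [|m] // mN; rewrite /= ?simp_gen /= ?simp_gen.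
- by rewrite (pairing_1r hP) counit_gen_dterm.
- by rewrite ih // !dtermM !rmorph1 !mulr1; congr dterm; lia.
- by rewrite ih // !dtermM !rmorph1 !mulr1; congr dterm; lia.
Qed.

Lemma pairing_be_tmat N l : (l < N)%N ->
  P be (tmat N l.+1 l) = dterm (be_tmat N l) (N%:Z - 2 * l%:Z - 1).
Proof.
elim: N l => [|N ih] l // lN; rewrite /= ?simp_gen /= ?simp_gen.
rewrite pairing_al_tmat // !dtermM.
case: l lN => [|l] lN; rewrite ?simp_gen /= ?simp_gen; clear simp_gen.
  rewrite (be_tmat0 hQ); congr dterm; last by lia.
  rewrite !rmorph1 !mul1r /beta_coef oppr0 expr0z addr0 mul1r.
  by rewrite divff ?(pw_neq1 hQ) // rmorph1 mulr1; congr qshift; lia.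
rewrite ih // (be_tmatS hQ) -dtermD !dtermM !rmorph1 !mul1r !mulr1; congr (_ + _).
  by congr dterm; lia.
congr dterm; last by lia.
by rewrite -[LHS]rmorphM /=; congr qshift; lia.
Qed.

Lemma pairing_ga_tmat N m : (m <= N)%N ->
  P ga (tmat N m m.+1) = dterm (ga_tmat N m) (N%:Z - 2 * m%:Z - 1).
Proof.
(* The edge m = N, where both sides are zero, is included because the induction for delta reaches
   it. *)
have out n : P ga (tmat n n n.+1) = dterm (ga_tmat n n) (n%:Z - 2 * n%:Z - 1).
  by rewrite tmat_out // (pairing0r hP) /ga_tmat subrr mulr0 expr0z subrr
    mulr0 mul0r dterm0.
elim: N m => [|N ih] m mN; first by case: m mN => // _; apply: out.
have [->|mN1] := eqVneq m N.+1; first exact: out.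
have {mN mN1} : (m <= N)%N by lia.
case: m => [|m] mN; rewrite /= ?simp_gen /= ?simp_gen.
  rewrite pairing_al_tmat // ih // !dtermM !rmorph1 ?mul1r ?mulr1.
  rewrite (ga_tmat0 hQ) -dtermD; congr (_ + _).
    by congr dterm; try congr (_ * qshift _ _); lia.
  by congr dterm; try congr (_ * qshift _ _); lia.
by rewrite ih ?(ltnW mN) // !dtermM !rmorph1 !mulr1 (ga_tmatS hQ); congr dterm; lia.
Qed.

Lemma pairing_de_tmat N m : (m <= N)%N ->
  P de (tmat N m m) = dterm (de_tmat N m) (N%:Z - 2 * m%:Z + 1).
Proof.
elim: N m => [|N ih] [|m] // mN; rewrite /= ?simp_gen /= ?simp_gen.
- rewrite (pairing_1r hP) counit_gen_dterm /=; congr dterm.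
  have -> : de_tmat 0 0 = (pw 1 - 1) * (pw 2 - 1) / ((pw 2 - 1) * (pw 1 - 1)) by [].
  by rewrite [X in X / _]mulrC divff // mulf_neq0 ?(pw_neq1 hQ).
- by rewrite ih // !dtermM (de_tmat0 hQ) !rmorph1 ?mulr1; congr dterm;
    try congr (_ * qshift _ _); lia.
rewrite ih // pairing_ga_tmat // !dtermM (de_tmatS hQ) -dtermD.
rewrite !rmorph1 ?mulr1; congr (_ + _); first by congr dterm; lia.
rewrite addr0 -[X in dterm X]mulrA -[X in _ * X]rmorphM /=.
by congr dterm; try congr (_ * qshift _ _); lia.
Qed.
End GeneratorMatrixElements.

(** * Matrix elements as seen by the pairing *)

Section Duality.
Variables (R : realType) (q : R).
Hypothesis hq : 0 < q < 1.
Notation C := (R[i]).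
Notation A := (dynSL2 q).
Notation al := (Lgen q true true).
Notation be := (Lgen q true false).
Notation ga := (Lgen q false true).
Notation v := (vK hq).
Notation Q := (qK hq).
Let hQ := qfun_parameters hq.
Notation dterm := (@dterm R q hq).
Notation tmat := (tmat hq).
Notation ga_tmat := (ga_tmat Q v).
Variables (Delta : {rmorphism A -> tens2 q}) (eps : {rmorphism A -> diffop C}).
Variable P : A -> A -> diffop C.
Hypotheses (hDelta : is_coproduct Delta) (heps : is_counit eps).
Hypothesis hP : is_pairing Delta eps P.

Lemma degree_cast (k N : nat) : (2 * k%:R - N%:R : C) = (2 * k%:Z - N%:Z)%:~R.
Proof. by rewrite rmorphB rmorphM. Qed.

Lemma sum_single (V : zmodType) n (F : nat -> V) i0 : (i0 < n)%N ->
  (forall i, (i < n)%N -> i <> i0 -> F i = 0) -> \sum_(i < n) F i = F i0.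
Proof.
move=> i0n h; rewrite (bigD1 (Ordinal i0n)) //= big1 ?addr0 // => i ne.
by apply: h => // e; case/eqP: ne; apply: val_inj.
Qed.

Definition nat_matrix_elements N (t : nat -> nat -> A) : Prop :=
  (forall k j, (k <= N)%N -> (j <= N)%N ->
    homog (2 * k%:Z - N%:Z)%:~R (2 * j%:Z - N%:Z)%:~R (t k j)) /\
  (forall k, (k <= N)%N -> Delta (gamma_alpha q N k) =
     \sum_(j < N.+1) tens (t k j) (gamma_alpha q N j)).

Lemma tmat_elements N : nat_matrix_elements N (tmat N).
Proof.
by split=> [k j kN _|k kN]; [exact: homog_tmat | exact: Delta_gamma_alpha].
Qed.

Lemma nat_matrix_elementsP N (t : 'I_N.+1 -> 'I_N.+1 -> A) :
  matrix_elements Delta t ->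
  nat_matrix_elements N (fun k j => t (inord k) (inord j)).
Proof.
case=> ht hD; split=> [k j kN jN|k kN].
  by rewrite -!degree_cast; have := ht (inord k) (inord j); rewrite !inordK.
have := hD (inord k); rewrite inordK // => ->.
by apply: eq_bigr => j _; rewrite inord_val.
Qed.

Lemma elements_decomp N t k : nat_matrix_elements N t -> (k <= N)%N ->
  tensor_decomp (Delta (gamma_alpha q N k))
    (fun i : 'I_N.+1 => (2 * i%:Z - N%:Z)%:~R) (fun i => t k i)
    (fun i => gamma_alpha q N i).
Proof.
case=> ht hD kN; split=> [i|i|]; last exact: hD.
  by exists (2 * k%:Z - N%:Z)%:~R; apply: ht => //; rewrite -ltnS.
by exists (N%:Z)%:~R; apply: homog_gamma_alpha; rewrite -ltnS.
Qed.

Lemma pairing_mul_gamma_alpha N t a b m : nat_matrix_elements N t ->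
  (m <= N)%N -> P (a * b) (gamma_alpha q N m) =
  \sum_(i < N.+1) P a (t m i) * dterm 1 (2 * i%:Z - N%:Z) *
    P b (gamma_alpha q N i).
Proof.
move=> ht mN; rewrite (pairing_mul1 hP _ _ (elements_decomp ht mN)).
by apply: eq_bigr => i _; rewrite (d_shiftE hq).
Qed.

Lemma pairing_gamma_alpha_mul M t a b k : nat_matrix_elements M t ->
  (k <= M)%N -> P (gamma_alpha q M k) (a * b) =
  \sum_(j < M.+1) P (t k j) a * dterm 1 (2 * j%:Z - M%:Z) *
    P (gamma_alpha q M j) b.
Proof.
move=> ht kM; rewrite (pairing_mul2 hP _ _ (elements_decomp ht kM)).
by apply: eq_bigr => i _; rewrite (d_shiftE hq).
Qed.

Lemma pairing_ga_mul b N m : (m < N)%N -> P (ga * b) (gamma_alpha q N m) =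
  P ga (tmat N m m.+1) * dterm 1 (2 * m.+1%:Z - N%:Z) * P b (gamma_alpha q N m.+1).
Proof.
move=> mN; rewrite (pairing_mul_gamma_alpha _ _ (tmat_elements N) (ltnW mN)).
apply: (@sum_single _ _ (fun i => P ga (tmat N m i) * dterm 1 (2 * i%:Z - N%:Z) *
    P b (gamma_alpha q N i))) => // i iN ne.
rewrite (pairing_deg hP (homog_ga q) (homog_tmat hq i (ltnW mN))) ?mul0r //.
lia.
Qed.

Lemma pairing_al_mul b N : P (al * b) (gamma_alpha q N N) =
  P al (tmat N N N) * dterm 1 N%:Z * P b (gamma_alpha q N N).
Proof.
rewrite (pairing_mul_gamma_alpha _ _ (tmat_elements N) (leqnn N)).
rewrite (@sum_single _ _ (fun i => P al (tmat N N i) * dterm 1 (2 * i%:Z - N%:Z) *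
    P b (gamma_alpha q N i)) N) => // [|i iN ne].
  by congr (_ * dterm 1 _ * _); lia.
rewrite (pairing_deg hP (homog_al q) (homog_tmat hq i (leqnn N))) ?mul0r //.
lia.
Qed.

Definition invertible_term (X : diffop C) : Prop :=
  exists2 x, x != 0 & exists s, X = dterm x s.

Lemma invertible_termM X Y : invertible_term X -> invertible_term Y ->
  invertible_term (X * Y).
Proof.
move=> [x x0 [s ->]] [y y0 [t ->]]; exists (x * qshift s y).
  by rewrite mulf_neq0 // fmorph_eq0.
by exists (s + t); rewrite dtermM.
Qed.

Lemma invertible_term1 s : invertible_term (dterm 1 s).
Proof. by exists 1; [exact: oner_neq0 | exists s]. Qed.

Lemma invertible_mulI X Y Z : invertible_term Z -> X * Z = Y * Z -> X = Y.
Proof. by move=> [x x0 [s ->]]; apply: dterm_mulI. Qed.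

Lemma ga_tmat_neq0 N m : (m < N)%N -> ga_tmat N m != 0.
Proof.
move=> mN; rewrite !mulf_neq0 ?oppr_eq0 ?vK_neq0 ?(Qpow_neq0 hQ) //.
  by rewrite subr_eq0 eq_sym qK_pow_neq1 //; lia.
by rewrite invr_eq0 -oppr_eq0 opprB (pw_neq1 hQ).
Qed.

(** Each gamma taken from the left raises the index by one, from N - n up to N, and contributes some
    [ga_tmat N m] with m < N, which is nonzero. At index N each alpha contributes a pure shift, and
    the counit of alpha^N is one too. *)
Lemma gamma_alpha_pairing_invertible n j N : (n <= N)%N ->
  invertible_term (P (ga ^+ n * al ^+ j) (gamma_alpha q N (N - n))).
Proof.
elim: n => [_|n ih nN].
  rewrite subn0 mul1r; elim: j => [|j ih].
    rewrite (pairing_1l hP) /gamma_alpha subnn mul1r rmorphXn /=.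
    rewrite (counit_gen_dterm hq heps) /=; elim: N => [|N ih].
      by rewrite expr0 -(dterm1 hq); apply: invertible_term1.
    by rewrite exprS; apply: invertible_termM => //; apply: invertible_term1.
  rewrite exprS pairing_al_mul (pairing_al_tmat hq hDelta heps hP) //.
  by do !apply: invertible_termM => //; apply: invertible_term1.
have {}ih := ih (ltnW nN).
rewrite exprS -mulrA pairing_ga_mul; last by lia.
rewrite (_ : (N - n.+1).+1 = N - n)%N; last by lia.
apply: invertible_termM => //; apply: invertible_termM; last first.
  exact: invertible_term1.
have e : (N - n = (N - n.+1).+1)%N by lia.
rewrite e (pairing_ga_tmat hq hDelta heps hP); last by lia.
by exists (ga_tmat N (N - n.+1)); [rewrite ga_tmat_neq0 //; lia | eexists].
Qed.

(* By degrees, gamma^(M-j) pairs to zero with gamma^(M-i) alpha^i unless i = j. *)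
Lemma dual_l M j : (j <= M)%N -> exists2 Z, invertible_term Z &
  forall t k b, nat_matrix_elements M t -> (k <= M)%N ->
    P (gamma_alpha q M k) (b * ga ^+ (M - j)) = P (t k j) b * Z.
Proof.
move=> jM; exists (dterm 1 (2 * j%:Z - M%:Z) *
    P (gamma_alpha q M j) (ga ^+ (M - j))).
  apply: invertible_termM; first exact: invertible_term1.
  have := @gamma_alpha_pairing_invertible (M - j) j (M - j) (leqnn _).
  by rewrite subnn {1}/gamma_alpha subn0 expr0 mulr1.
move=> t k b ht kM; rewrite (pairing_gamma_alpha_mul _ _ ht kM) mulrA.
apply: (@sum_single _ _ (fun j' => P (t k j') b * dterm 1 (2 * j'%:Z - M%:Z) *
    P (gamma_alpha q M j') (ga ^+ (M - j)))) => // i iM ne.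
rewrite (pairing_deg hP (homog_gamma_alpha q (_ : i <= M)%N)
  (homog_exp _ (homog_ga q))) ?mulr0 //; lia.
Qed.

Lemma dual_r N l : (l <= N)%N -> exists2 Z, invertible_term Z &
  forall t m a, nat_matrix_elements N t -> (m <= N)%N ->
    P (a * ga ^+ (N - l)) (gamma_alpha q N m) = P a (t m l) * Z.
Proof.
move=> lN; exists (dterm 1 (2 * l%:Z - N%:Z) *
    P (ga ^+ (N - l)) (gamma_alpha q N l)).
  apply: invertible_termM; first exact: invertible_term1.
  have := @gamma_alpha_pairing_invertible (N - l) 0 N (leq_subr _ _).
  by rewrite expr0 mulr1 subKn.
move=> t m a ht mN; rewrite (pairing_mul_gamma_alpha _ _ ht mN) mulrA.
apply: (@sum_single _ _ (fun i => P a (t m i) * dterm 1 (2 * i%:Z - N%:Z) *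
    P (ga ^+ (N - l)) (gamma_alpha q N i))) => // i iN ne.
rewrite (pairing_deg hP (homog_exp _ (homog_ga q))
  (homog_gamma_alpha q (_ : i <= N)%N)) ?mulr0 //; lia.
Qed.

(** The factor Z of [dual_l] depends neither on the family t nor on b, so both sides are recovered
    from the same pairing with gamma^(M-k) alpha^k. This lets [tmat] stand in for a given family. *)
Lemma pairing_elements_l M t t' k j b : nat_matrix_elements M t ->
  nat_matrix_elements M t' -> (k <= M)%N -> (j <= M)%N ->
  P (t k j) b = P (t' k j) b.
Proof.
move=> ht ht' kM jM; have [Z uZ hZ] := dual_l jM.
by apply: (invertible_mulI uZ); rewrite -!hZ.
Qed.

Lemma pairing_elements_r N t t' m l a : nat_matrix_elements N t ->
  nat_matrix_elements N t' -> (m <= N)%N -> (l <= N)%N ->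
  P a (t m l) = P a (t' m l).
Proof.
move=> ht ht' mN lN; have [Z uZ hZ] := dual_r lN.
by apply: (invertible_mulI uZ); rewrite -!hZ.
Qed.

(* Coassociativity on matrix elements, as seen by the pairing: both sides come
   from the two bracketings of [a * b * ga ^+ (N - l)]. *)
Lemma pairing_mul_tmat N a b m l : (m <= N)%N -> (l <= N)%N ->
  P (a * b) (tmat N m l) = \sum_(i < N.+1)
    P a (tmat N m i) * dterm 1 (2 * i%:Z - N%:Z) * P b (tmat N i l).
Proof.
move=> mN lN; have [Z uZ hZ] := dual_r lN; have ht := tmat_elements N.
apply: (invertible_mulI uZ); rewrite -hZ // -mulrA.
rewrite (pairing_mul_gamma_alpha _ _ ht mN) mulr_suml.
by apply: eq_bigr => i _; rewrite -!mulrA -hZ // -ltnS.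
Qed.

(** The equation between the signs and the indices singles out m' as the only intermediate index
    that the degrees allow. *)
Lemma pairing_gen_l_tmat (c d : bool) x N m l m' : (m <= N)%N -> (l <= N)%N ->
  (if d then 1 else -1) + 2 * m%:Z = (if c then 1 else -1) + 2 * m'%:Z :> int ->
  (m' <= N)%N ->
  P (Lgen q c d * x) (tmat N m l) = P (Lgen q c d) (tmat N m m') *
    dterm 1 (2 * m'%:Z - N%:Z) * P x (tmat N m' l).
Proof.
move=> mN lN e m'N; rewrite pairing_mul_tmat //.
apply: (@sum_single _ _ (fun i => P (Lgen q c d) (tmat N m i) *
    dterm 1 (2 * i%:Z - N%:Z) * P x (tmat N i l))) => // i iN ne.
rewrite (@pairing_deg _ _ _ _ _ hP (if c then 1 else -1) (if d then 1 else -1)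
  _ _ _ _ _ (homog_tmat hq i mN)) ?mul0r //; last by case: (c) (d) e => [] [] /=; lia.
by have := homog_gen q c d; case: (c); case: (d).
Qed.

Lemma pairing_gen_r_tmat (c d : bool) x N m l l' : (m <= N)%N -> (l <= N)%N ->
  (if d then 1 else -1) + 2 * l'%:Z = (if c then 1 else -1) + 2 * l%:Z :> int ->
  (l' <= N)%N ->
  P (x * Lgen q c d) (tmat N m l) = P x (tmat N m l') *
    dterm 1 (2 * l'%:Z - N%:Z) * P (Lgen q c d) (tmat N l' l).
Proof.
move=> mN lN e l'N; rewrite pairing_mul_tmat //.
apply: (@sum_single _ _ (fun i => P x (tmat N m i) *
    dterm 1 (2 * i%:Z - N%:Z) * P (Lgen q c d) (tmat N i l))) => // i iN ne.
rewrite (@pairing_deg _ _ _ _ _ hP (if c then 1 else -1) (if d then 1 else -1)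
  _ _ _ _ _ (homog_tmat hq l (_ : i <= N)%N)) ?mulr0 //; last by case: (c) (d) e => [] [] /=; lia.
by have := homog_gen q c d; case: (c); case: (d).
Qed.

(** The degrees would require the intermediate index N + 1. *)
Lemma pairing_be_tmat_top x N m : (m <= N)%N -> P (x * be) (tmat N m N) = 0.
Proof.
move=> mN; rewrite pairing_mul_tmat // big1 // => -[i iN] _ /=.
rewrite (pairing_deg hP (homog_be q) (homog_tmat hq N (_ : i <= N)%N)) ?mulr0 //; lia.
Qed.
End Duality.

(** * Solving the recurrences *)

Section PairingOfMatrixElements.
Variables (R : realType) (q : R).
Hypothesis hq : 0 < q < 1.
Notation C := (R[i]).
Notation A := (dynSL2 q).
Notation K := (qfun hq).
Notation ga := (Lgen q false true).
Notation de := (Lgen q false false).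
Notation v := (vK hq).
Notation Q := (qK hq).
Let hQ := qfun_parameters hq.
Notation dterm := (@dterm R q hq).
Notation tmat := (tmat hq).
Notation prefactor := (prefactor Q v).
Notation phi_series := (phi_series Q v).
Notation ratio_alpha := (ratio_alpha Q v).
Notation ratio_beta := (ratio_beta Q v).
Notation ratio_gamma := (ratio_gamma Q v).
Notation ratio_delta := (ratio_delta Q v).
Variables (Delta : {rmorphism A -> tens2 q}) (eps : {rmorphism A -> diffop C}).
Variable P : A -> A -> diffop C.
Hypotheses (hDelta : is_coproduct Delta) (heps : is_counit eps).
Hypothesis hP : is_pairing Delta eps P.

Lemma dterm_prod3 x s t y u :
  dterm x s * dterm 1 t * dterm y u = dterm (x * qshift (s + t) y) (s + t + u).
Proof. by rewrite !dtermM rmorph1 mulr1. Qed.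

Lemma pairing_tmat_step0 M N j m l : (j <= M.+1)%N -> (j + m = l)%N -> (l <= N)%N ->
  (forall j m, (j <= M)%N -> (j + m = l)%N -> (m <= N)%N ->
    P (tmat M 0 j) (tmat N m l) =
    dterm (prefactor M N 0 j m l l) (M%:Z + N%:Z - 2 * l%:Z)) ->
  P (tmat M.+1 0 j) (tmat N m l) =
  dterm (prefactor M.+1 N 0 j m l l) (M.+1%:Z + N%:Z - 2 * l%:Z).
Proof.
move=> jM jm lN ih; have mN : (m <= N)%N by lia.
rewrite /= (pairingDl hP).
have -> : P (de * tmat M 0 j) (tmat N m l) =
    dterm (prefactor M.+1 N 0 j m l l * ratio_delta M N j m)
      (M.+1%:Z + N%:Z - 2 * l%:Z).
  have [jM'|jM'] := leqP j M; last first.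
    have -> : j = M.+1 by lia.
    by rewrite tmat_out // mulr0 (pairing0l hP) /ratio_delta subrr !mul0r mulr0 dterm0.
  rewrite (pairing_gen_l_tmat hq hDelta heps hP _ mN lN (m' := m)) // ih //.
  rewrite (pairing_de_tmat hq hDelta heps hP mN) dterm_prod3.
  rewrite -(prefactor_delta hQ) //.
  have -> : N%:Z - 2 * m%:Z + 1 + (2 * m%:Z - N%:Z) = 1 by lia.
  by congr dterm; lia.
have -> : P (if j is l'.+1 then ga * tmat M 0 l' * fr (gamma_coef Q v M j) else 0)
    (tmat N m l) = dterm (prefactor M.+1 N 0 j m l l * ratio_gamma M N j m)
      (M.+1%:Z + N%:Z - 2 * l%:Z).
  case: j jM jm => [|j] jM jm.
    by rewrite (pairing0l hP) /ratio_gamma expr0 subrr !mul0r mulr0 dterm0.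
  have mN' : (m < N)%N by lia.
  rewrite (pairing_fr1 hP) (pairing_gen_l_tmat hq hDelta heps hP _ mN lN (m' := m.+1)) //;
    last by lia.
  rewrite ih //; try lia.
  rewrite (pairing_ga_tmat hq hDelta heps hP mN) dterm_prod3 dtermM.
  rewrite -(prefactor_gamma hQ) //.
  have -> : N%:Z - 2 * m%:Z - 1 + (2 * m.+1%:Z - N%:Z) = 1 by lia.
  have -> : 1 + (M%:Z + N%:Z - 2 * l%:Z) = 1 + M%:Z + N%:Z - 2 * l%:Z by lia.
  by congr dterm; lia.
by rewrite dtermD -mulrDr (ratio_delta_gamma hQ) mulr1.
Qed.

(** Induction on M with all indices free. Summands absent at the edges match zeros of the
    coefficients: [ratio_alpha] vanishes at j = 0, and [ratio_beta] at j = M + 1 and at l = N. *)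
Lemma pairing_tmat M N k j m l L : (k <= M)%N -> (j <= M)%N -> (m <= N)%N ->
  (l <= N)%N -> (k + l = L)%N -> (j + m = L)%N ->
  P (tmat M k j) (tmat N m l) =
  dterm (prefactor M N k j m l L * phi_series M N k m L) (M%:Z + N%:Z - 2 * L%:Z).
Proof.
have series0 M' m' L' : phi_series M' N 0 m' L' = 1 by apply: phi43_0.
elim: M k j m l L => [|M ih] k j m l L kM jM mN lN kl jm.
  have k0 : k = 0 by lia.
  have j0 : j = 0 by lia.
  subst k j; have lL : l = L by lia.
  have mL : m = L by lia.
  subst l m.
  rewrite /= (pairing_1l hP) (counit_tmat hq heps) // (prefactor0 hQ) //.
  by rewrite series0 mulr1; congr dterm; lia.
case: k kM kl => [|k] kM kl.
  have lL : l = L by lia.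
  subst l; rewrite series0 mulr1.
  apply: pairing_tmat_step0 => // j' m' j'M jm' m'N.
  by rewrite (ih _ _ _ _ L) // series0 mulr1.
case: L kl jm => [|L] kl jm; first by lia.
have {}kl : (k + l = L)%N by lia.
rewrite /= (pairingDl hP) (phi_series_contiguous hQ (kM : (k <= M)%N) mN lN jM kl jm).
rewrite mulrDr -dtermD; congr (_ + _).
  case: j jM jm => [|j] jM jm.
    rewrite (pairing0l hP) /ratio_alpha expr0 subrr.
    by rewrite !(mulr0, mul0r) dterm0.
  rewrite (pairing_gen_r_tmat hq hDelta heps hP _ mN lN (l' := l)) //.
  rewrite (ih _ _ _ _ L) //; try lia.
  rewrite (pairing_al_tmat hq hDelta heps hP lN) dterm_prod3 rmorph1 mulr1.
  rewrite mulrA -(prefactor_alpha hQ) //; try lia.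
  by congr dterm; lia.
have [jM'|jM'] := leqP j M; last first.
  have -> : j = M.+1 by lia.
  rewrite tmat_out // !mul0r (pairing0l hP) /ratio_beta subnn expr0 subrr.
  by rewrite !(mulr0, mul0r, oppr0) dterm0.
have [lN'|lN'] := ltnP l N; last first.
  have -> : l = N by lia.
  rewrite (pairing_fr1 hP) (pairing_be_tmat_top hq hDelta heps hP _ mN) mul0r.
  by rewrite /ratio_beta subnn expr0 subrr !(mulr0, mul0r, oppr0) dterm0.
rewrite (pairing_fr1 hP) (pairing_gen_r_tmat hq hDelta heps hP _ mN lN (l' := l.+1)) //;
    last by lia.
rewrite (ih _ _ _ _ L.+1) //; try lia.
rewrite (pairing_be_tmat hq hDelta heps hP lN') dterm_prod3 dtermM.
rewrite mulrA -(prefactor_beta hQ) //; try lia.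
have -> : M%:Z + N%:Z - 2 * L.+1%:Z + (2 * l.+1%:Z - N%:Z) =
  M%:Z - 2 * L.+1%:Z + 2 * l%:Z + 2 by lia.
have -> : M%:Z - 2 * L.+1%:Z + 2 * l%:Z + 2 + (N%:Z - 2 * l%:Z - 1) =
  1 + M%:Z + N%:Z - 2 * L.+1%:Z by lia.
have swap (a b c d : K) : a * b * c * d = a * c * d * b.
  by rewrite -!mulrA; congr (_ * _); rewrite mulrC -mulrA.
by rewrite swap; congr dterm; lia.
Qed.
End PairingOfMatrixElements.

(** * Transfer of the formula to meromorphic functions *)

Section FormulaInMeromorphicFunctions.
Variables (R : realType) (q : R).
Hypothesis hq : 0 < q < 1.
Notation C := (R[i]).
Notation K := (qfun hq).
Notation v := (vK hq).
Notation Q := (qK hq).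
Notation pw := (pw Q v).

(** A ring morphism out of a field respects inverses, so the divisions in [mero] are images of
    divisions in [qfun]. *)
Lemma rmorph_phi43 (F : fieldType) (S : comUnitRingType) (f : {rmorphism F -> S})
    k m a b c d e p z :
  f (phi43 k m a b c d e p z) = phi43 k m (f a) (f b) (f c) (f d) (f e) (f p) (f z).
Proof.
rewrite /phi43 rmorph_sum; apply: eq_bigr => i _.
by rewrite !(rmorphM, fmorphV, rmorphXn) !rmorph_qpoch !fmorphV !rmorphXn.
Qed.

Lemma rmorph_qcore (F : fieldType) (S : comUnitRingType) (f : {rmorphism F -> S})
    p L a b j l c d u x z :
  f (qcore p L a b j l c d u x z) =
  (qpoch (f p) (f p) L * qpoch (f p) (f p) a * qpoch (f p) (f p) b /
    (qpoch (f p) (f p) j * qpoch (f p) (f p) l * qpoch (f p) (f p) c *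
     qpoch (f p) (f p) d)) * (1 / (1 - f u)) *
  (qpoch (f x) (f p) a * qpoch (f x) (f p) b /
    (qpoch (f x) (f p) j * qpoch (f x) (f p) l)) *
  (qpoch (f z) (f p) L.+1 /
    (qpoch (f (u * p)) (f p) a * qpoch (f (u * p)) (f p) b)).
Proof.
by rewrite /qcore !(rmorphM, fmorphV, rmorphB, rmorph1) !rmorph_qpoch rmorphM.
Qed.

Lemma qlin_pw (n : int) (c : C) : c = (2 * n)%:~R -> qlin q 2 c = qval (pw n).
Proof. by move=> ->; rewrite pwE exprnP qval_qlin. Qed.

Lemma qlin_pwV (n : int) (c : C) : c = - (2 * n)%:~R ->
  qlin q (-2) c = qval (pw n)^-1.
Proof. by move=> ->; rewrite fmorphV /= -(@qlin_pw n (2 * n)%:~R) // qlinV. Qed.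

Lemma dtermE (x : K) n : dterm x n = d_fun (qval x) * d_shift n%:~R.
Proof.
by apply: diffop_eq => g; rewrite /= m_shiftM m_shift_shift add0r m_shift_cst mul1r.
Qed.
End FormulaInMeromorphicFunctions.

Theorem theorem4p12 (R : realType) (q : R) (hq : 0 < q < 1)
    (Delta : {rmorphism dynSL2 q -> tens2 q})
    (eps : {rmorphism dynSL2 q -> diffop R[i]})
    (P : dynSL2 q -> dynSL2 q -> diffop R[i])
    (hDelta : is_coproduct Delta) (heps : is_counit eps)
    (hP : is_pairing Delta eps P)
    (M N : nat)
    (tM : 'I_M.+1 -> 'I_M.+1 -> dynSL2 q) (htM : matrix_elements Delta tM)
    (tN : 'I_N.+1 -> 'I_N.+1 -> dynSL2 q) (htN : matrix_elements Delta tN)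
    (k j : 'I_M.+1) (m l : 'I_N.+1) :
  ((k + l)%N <> (j + m)%N -> P (tM k j) (tN m l) = 0) /\
  (forall L : nat, (k + l)%N = L -> (j + m)%N = L ->
    let p : mero R[i] := qcst q 2 in
    let x : mero R[i] := qlin q 2 (2 * (1 - L%:R)) in
    let y : mero R[i] := qlin q 2 4 in
    let f : mero R[i] :=
      (-1) ^+ (j + l + L)
      * qlin q (j%:R + l%:R - L%:R)
          ((j%:R + l%:R - L%:R) * (1 + j%:R + l%:R - M%:R - N%:R)
           - 2 * k%:R * m%:R)
      * ((qpoch p p L * qpoch p p (M - k) * qpoch p p (N - m))
         / (qpoch p p j * qpoch p p l * qpoch p p (M - j) * qpoch p p (N - l)))
      * (1 / (1 - qlin q 2 2))
      * ((qpoch x p (M - k) * qpoch x p (N - m)) / (qpoch x p j * qpoch x p l))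
      * (qpoch (qlin q 2 (2 * (1 + M%:R + N%:R - 2 * L%:R))) p L.+1
         / (qpoch y p (M - k) * qpoch y p (N - m)))
      * phi43 k m (qlin q (-2) (2 * (k%:R - M%:R - 1)))
          (qlin q (-2) (2 * (m%:R - N%:R - 1)))
          (qcst q (- (2 * L)%:Z)) (qlin q (-2) (2 * (L%:R - M%:R - N%:R - 1)))
          (qlin q (-2) 0) p p in
    P (tM k j) (tN m l) = d_fun f * d_shift (M%:R + N%:R - 2 * L%:R)).
Proof.
have natM := nat_matrix_elementsP htM; have natN := nat_matrix_elementsP htN.
have kM := leq_ord k; have jM := leq_ord j.
have mN := leq_ord m; have lN := leq_ord l.
have tME : tM k j = tM (inord k) (inord j) by rewrite !inord_val.
have tNE : tN m l = tN (inord m) (inord l) by rewrite !inord_val.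
rewrite tME tNE; split=> [ne|L kl jm p x y f].
  apply: (pairing_deg hP (natM.1 _ _ kM jM) (natN.1 _ _ mN lN)).
  by clear -ne; lia.
(* Both given families are exchanged for [tmat]. Afterwards every ingredient of f is recognised as
   the image under [qval] of its counterpart in [prefactor] or [phi_series]. *)
rewrite (pairing_elements_l hq hDelta heps hP _ natM (tmat_elements hq hDelta M) kM jM).
rewrite (pairing_elements_r hq hDelta heps hP _ natN (tmat_elements hq hDelta N) mN lN).
rewrite (pairing_tmat hq hDelta heps hP kM jM mN lN kl jm) dtermE.
congr (d_fun _ * d_shift _); last by rewrite !(rmorphB, rmorphD, rmorphM).
pose Q := qK hq; pose v := vK hq.
have ep : p = qval (pK Q) by rewrite /pK exprnP qval_qK.
have ex : x = qval (pw Q v (1 - L%:Z)) by apply: qlin_pw; rewrite !(rmorphB, rmorphM).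
have ey : y = qval (pw Q v 1 * pK Q).
  by rewrite (pw_pK1 (qfun_parameters hq)); apply: qlin_pw.
have e1 : qlin q 2 2 = qval (pw Q v 1) by apply: qlin_pw.
have ez : qlin q 2 (2 * (1 + M%:R + N%:R - 2 * L%:R)) =
    qval (pw Q v (1 + M%:Z + N%:Z - 2 * L%:Z)).
  by apply: qlin_pw; rewrite !(rmorphB, rmorphD, rmorphM).
have eg : qlin q (j%:R + l%:R - L%:R)
      ((j%:R + l%:R - L%:R) * (1 + j%:R + l%:R - M%:R - N%:R) -
       2 * k%:R * m%:R) =
   qval (v ^ (j%:Z + l%:Z - L%:Z) *
     Q ^ ((j%:Z + l%:Z - L%:Z) * (1 + j%:Z + l%:Z - M%:Z - N%:Z) -
       2 * k%:Z * m%:Z)).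
  by rewrite qval_qlin !(rmorphB, rmorphD, rmorphM).
have ea : qlin q (-2) (2 * (k%:R - M%:R - 1)) = qval (pw Q v (M%:Z + 1 - k%:Z))^-1.
  apply: qlin_pwV; rewrite !(rmorphB, rmorphD, rmorphM) /=; ring.
have eb : qlin q (-2) (2 * (m%:R - N%:R - 1)) = qval (pw Q v (N%:Z + 1 - m%:Z))^-1.
  apply: qlin_pwV; rewrite !(rmorphB, rmorphD, rmorphM) /=; ring.
have ec : qcst q (- (2 * L)%:Z) = qval (Q ^ (2 * L%:Z))^-1.
  by rewrite -qval_qK invr_expz PoszM.
have ed : qlin q (-2) (2 * (L%:R - M%:R - N%:R - 1)) =
    qval (pw Q v (M%:Z + N%:Z + 1 - L%:Z))^-1.
  apply: qlin_pwV; rewrite !(rmorphB, rmorphD, rmorphM) /=; ring.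
have ee : qlin q (-2) 0 = qval (pw Q v 0)^-1.
  by apply: qlin_pwV; rewrite mulr0 oppr0.
rewrite /f ep ex ey e1 ez eg ea eb ec ed ee.
rewrite rmorphM rmorph_phi43; congr (_ * _).
by rewrite rmorphM rmorphM rmorph_sign rmorph_qcore -!mulrA.
Qed.
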